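(* Assume (SH) and (H), and let $\phi:\mathbb{R}^n\to\mathbb{R}$ be locally Lipschitz. Let $\overline{x}$ be optimal for $\mathcal{P}(t_0,x_0)$ and suppose $\partial^+\phi(\overline{x}(T))\neq\emptyset$. Let $\overline{p}:[t_0,T]\to\mathbb{R}^n$ be an arc such that, for a.e. $s\in[t_0,T]$, $$\dot{\overline{x}}(s)\in\partial_p^-H(\overline{x}(s),\overline{p}(s)),\qquad -\dot{\overline{p}}(s)\in\partial_x^-H(\overline{x}(s),\overline{p}(s)),$$ and $-\overline{p}(T)\in\partial^+\phi(\overline{x}(T))$. Then: (1) if $\partial_x^-V(t_0,x_0)\ne\emptyset$, then for all $t\in[t_0,T]$ the function $V(t,\cdot)$ is differentiable at $\overline{x}(t)$ with $\nabla_xV(t,\overline{x}(t))=-\overline{p}(t)$; (2) if $\phi$ is locally semiconcave and $\partial_x^-V(t_0,x_0)\neq\emptyset$, then for all $t\in[t_0,T)$ the function $V(\cdot,\cdot)$ is differentiable at $(t,\overline{x}(t))$ with $\nabla V(t,\overline{x}(t))=\left(H(\overline{x}(t),\overline{p}(t)),-\overline{p}(t)\right)$.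
   Context: Fix $T\in\mathbb{R}$, a multifunction $F:\mathbb{R}^n\rightrightarrows\mathbb{R}^n$ and $\phi:\mathbb{R}^n\to\mathbb{R}$. An arc is an absolutely continuous function on a compact interval. For $(t_0,x_0)\in(-\infty,T]\times\mathbb{R}^n$, the Mayer problem $\mathcal{P}(t_0,x_0)$ is to minimize $\phi(x(T))$ over all arcs $x:[t_0,T]\to\mathbb{R}^n$ with $\dot x(s)\in F(x(s))$ for a.e. $s\in[t_0,T]$ and $x(t_0)=x_0$; a minimizer is called optimal for $\mathcal{P}(t_0,x_0)$. The value function $V:(-\infty,T]\times\mathbb{R}^n\to\mathbb{R}$ is the infimum $V(t_0,x_0)$ of this problem. The Hamiltonian is $H(x,p)=\sup_{v\in F(x)}\langle v,p\rangle$, $x,p\in\mathbb{R}^n$. (SH): (i) $F(x)$ is nonempty, convex, compact for each $x$; (ii) $F$ is locally Lipschitz, i.e. each $x$ has a neighborhood $K$ and a constant $c>0$ with $F(z)\subset F(y)+c|z-y|B(0,1)$ for all $z,y\in K$; (iii) there is $\gamma>0$ with $\max\{|v|:v\in F(x)\}\le\gamma(1+|x|)$ for all $x$. (H): for every $r>0$: (i) there is $c\ge0$ such that for all $p\in S^{n-1}$ (unit sphere) the map $x\mapsto H(x,p)$ is semiconvex on $B(0,r)$ with constant $c$; (ii) $\nabla_pH(x,p)$ exists and is Lipschitz in $x$ on $B(0,r)$, uniformly for $p\in\mathbb{R}^n\setminus\{0\}$. A function $f$ is semiconcave on $\Omega$ (with constant $c$) if it is continuous and $f(x+h)+f(x-h)-2f(x)\le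 c|h|^2$ whenever $[x-h,x+h]\subset\Omega$; it is locally semiconcave if it is semiconcave on a neighborhood of each point; $f$ is semiconvex if $-f$ is semiconcave. $B(x,\epsilon)$ is the closed ball. The Fréchet subdifferential and superdifferential of $f$ at $x$ are $\partial^-f(x)=\{p:\liminf_{y\to x}\frac{f(y)-f(x)-\langle p,y-x\rangle}{|y-x|}\ge0\}$ and $\partial^+f(x)=\{p:\limsup_{y\to x}\frac{f(y)-f(x)-\langle p,y-x\rangle}{|y-x|}\le0\}$; $\partial_x^-H$, $\partial_p^-H$ denote the Fréchet subdifferentials of $H(\cdot,p)$ and $H(x,\cdot)$, and $\partial_x^-V(t,x)$ that of $V(t,\cdot)$ at $x$. $\nabla V=(V_t,\nabla_xV)$. *)

(* Defs.v *)
From HB Require Import structures.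
From mathcomp Require Import all_boot all_order all_algebra.
From mathcomp Require Import all_classical all_reals all_analysis.
Set Implicit Arguments.
Unset Strict Implicit.
Unset Printing Implicit Defensive.
Import Order.TTheory GRing.Theory Num.Theory.
Import numFieldNormedType.Exports.
Local Open Scope classical_set_scope.
Local Open Scope ring_scope.

Section Euclidean.
Context {R : realType} {n : nat}.
Implicit Types (x y p v h : 'rV[R]_n) (f : 'rV[R]_n -> R).

Definition dotv x y : R := \sum_(i < n) x 0 i * y 0 i.

(* The library norm on 'rV[R]_n is the max norm.  It induces the same
   topology, derivatives and differentials, but every metric quantity below
   uses the Euclidean norm. *)
Definition enorm x : R := Num.sqrt (dotv x x).

Definition eball x (r : R) : set 'rV[R]_n := [set y | enorm (y - x) <= r].

Definition lipschitz_near_pts f : Prop :=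
  forall x, exists2 K, nbhs x K &
    exists c : R, forall y z, K y -> K z -> `|f z - f y| <= c * enorm (z - y).

(* The gradient of f at x; it is meaningful when f is differentiable at x. *)
Definition grad f x : 'rV[R]_n :=
  \row_(i < n) 'd f x (delta_mx 0 i : 'rV[R]_n).

Definition semiconcave_on (A : set 'rV[R]_n) (c : R) f : Prop :=
  {within A, continuous f} /\
  forall x h, (forall t : R, -1 <= t <= 1 -> A (x + t *: h)) ->
    f (x + h) + f (x - h) - 2 * f x <= c * enorm h ^+ 2.

Definition semiconvex_on (A : set 'rV[R]_n) (c : R) f : Prop :=
  semiconcave_on A c (fun x => - f x).

Definition locally_semiconcave f : Prop :=
  forall x, exists2 U, nbhs x U & exists c : R, semiconcave_on U c f.

Definition frechet_quot f x p (y : 'rV[R]_n) : \bar R :=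
  ((f y - f x - dotv p (y - x)) / enorm (y - x))%:E.

Definition subdiff f x : set 'rV[R]_n :=
  [set p | (0 <= limf_einf (frechet_quot f x p) x^')%E].

Definition superdiff f x : set 'rV[R]_n :=
  [set p | (limf_esup (frechet_quot f x p) x^' <= 0)%E].

End Euclidean.

Section Mayer.
Context {R : realType} {n : nat}.
Implicit Types (F : 'rV[R]_n -> set 'rV[R]_n) (phi : 'rV[R]_n -> R).

(* Absolute continuity on [a, b].  Arcs are total functions on R of which
   only the values on [a, b] matter. *)
Definition is_arc (a b : R) (x : R -> 'rV[R]_n) : Prop :=
  forall eps : R, 0 < eps -> exists2 delta : R, 0 < delta &
    forall (m : nat) (u v : 'I_m -> R),
      (forall i, a <= u i /\ u i <= v i /\ v i <= b) ->
      trivIset setT (fun i => `]u i, v i[%classic) ->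
      \sum_(i < m) (v i - u i) < delta ->
      \sum_(i < m) enorm (x (v i) - x (u i)) < eps.

(* The property P s d holds for a.e. s in [a, b] with d the derivative of x
   at s (in particular, that derivative exists). *)
Definition ae_deriv (a b : R) (x : R -> 'rV[R]_n)
    (P : R -> 'rV[R]_n -> Prop) : Prop :=
  {ae (@lebesgue_measure R), forall s : R,
    s \in `[a, b] -> derivable x s 1 /\ P s (derive1 x s)}.

Definition admissible F (T t0 : R) (x0 : 'rV[R]_n) (x : R -> 'rV[R]_n) : Prop :=
  [/\ is_arc t0 T x, ae_deriv t0 T x (fun s d => F (x s) d) & x t0 = x0].

Definition optimal F phi (T t0 : R) (x0 : 'rV[R]_n) (x : R -> 'rV[R]_n) : Prop :=
  admissible F T t0 x0 x /\
  forall y, admissible F T t0 x0 y -> phi (x T) <= phi (y T).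

(* inf and sup are the real-valued ones: they are genuine bounds when the set
   is nonempty and bounded, as is the case for both of the sets below under
   the standing assumptions on F and phi.  The value function is only
   meaningful for t <= T. *)
Definition value F phi (T t : R) (x : 'rV[R]_n) : R :=
  inf [set phi (y T) | y in admissible F T t x].

Definition hamiltonian F (x p : 'rV[R]_n) : R :=
  sup [set dotv v p | v in F x].

Definition assumption_SH F : Prop :=
  [/\ (forall x : 'rV[R]_n, [/\ F x !=set0, convex_set (F x) & compact (F x)]),
      (forall x : 'rV[R]_n, exists2 K, nbhs x K & exists2 c : R, 0 < c &
         forall z y, K z -> K y ->
           F z `<=` [set w + (c * enorm (z - y)) *: b
                    | w in F y & b in eball 0 1])
    & exists2 gamma : R, 0 < gamma &
        forall x v, F x v -> enorm v <= gamma * (1 + enorm x)].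

Definition assumption_H F : Prop :=
  forall r : R, 0 < r ->
    (exists2 c : R, 0 <= c & forall p : 'rV[R]_n, enorm p = 1 ->
       semiconvex_on (eball 0 r) c (fun x => hamiltonian F x p)) /\
    ((forall x p : 'rV[R]_n, eball 0 r x -> p != 0 ->
        differentiable (hamiltonian F x) p) /\
     exists k : R, forall p : 'rV[R]_n, p != 0 ->
       forall x y, eball 0 r x -> eball 0 r y ->
         enorm (grad (hamiltonian F x) p - grad (hamiltonian F y) p)
           <= k * enorm (x - y)).

(* The gradient (W_t, grad_x W) of a function of time and space. *)
Definition grad_tx (W : R -> 'rV[R]_n -> R) (t : R) (x : 'rV[R]_n) :
    R * 'rV[R]_n :=
  (derive1 (fun s => W s x) t, grad (W t) x).

End Mayer.

(* Main.v *)
Require Import Defs.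
From HB Require Import structures.
From mathcomp Require Import all_boot all_order all_algebra.
From mathcomp Require Import all_classical all_reals all_analysis.
From mathcomp Require Import ring lra.
Set Implicit Arguments.
Unset Strict Implicit.
Unset Printing Implicit Defensive.
Import Order.TTheory GRing.Theory Num.Theory.
Import numFieldNormedType.Exports.
Local Open Scope classical_set_scope.
Local Open Scope ring_scope.

(** Let xb be the optimal trajectory, pb its costate, V the value function and
    V* = phi(xb(T)), the value of V along xb.  Both parts follow from one
    expansion, uniform in s in [t0, T] (value_expand):

      V(s, xb(s) + h) = V* - <pb(s), h> + o(|h|).

    Upper half (value_upper).  It is enough to find, from xb(s) + h, a
    trajectory y for which the final displacement z(T) = y(T) - xb(T) satisfies
    |z(T)| <= C |h| and <pb(T), z(T)> >= <pb(s), h> - C |h|^2 (tube): the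
    supergradient - pb(T) of phi at xb(T) then bounds phi(y(T)).  When pb does
    not vanish, y solves y' = grad_p H(y, pb).  The derivative of <pb, y - xb>
    is H(y, pb) - H(xb, pb) + <pb', y - xb>, and since - pb' is a subgradient of
    H(., pb) at xb and H is semiconvex in x, it is at least - c |pb| |y - xb|^2
    (pairing_growth).  By (H) this field is continuous in time and Lipschitz in
    the state, so Picard iteration solves the equation (picard).

    The field is undefined where pb = 0, but |pb'| <= k |pb|, so pb vanishes
    either nowhere or identically (costate_dichotomy).  In the second case
    |z(T)| <= C |h| is all that is needed, and it is an approximate form of
    Filippov's theorem (filippov_tracking).  It is proved by an Euler scheme
    each step of which follows a Lipschitz selection of F chosen so that its
    initial value is close to the mean velocity of xb (selection_approx); such
    selections are built by convex combination from the maps grad_p H(., p).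

    Lower half (value_lower).  The upper half at t0 shows that - pb(t0) is a
    supergradient of V(t0, .) at x0, so it is the only possible subgradient.
    The same trajectories, followed backward from xb(s) + h to time t0, and
    dynamic programming carry the lower bound from t0 to s.

    The expansion at s = t is part (1).  For part (2), the expansion of V near
    (t, xb(t)) at a time t + tau > t is the uniform one centred at
    xb(t + tau), because <pb(t), xb(t + tau) - xb(t)> = tau H(xb(t), pb(t)) +
    o(tau) (pairing_rate).  At earlier times it follows from part (1) by dynamic
    programming: a trajectory reaching time t gains at most
    tau H(xb(t), pb(t)) + o(tau) in the pairing with pb(t), and a maximizing
    one attains this (value_expand_earlier).

    All differential inequalities along arcs are integrated by abs_cont_ndecr:
    an absolutely continuous function with nonnegative derivative almost
    everywhere is nondecreasing.  What is used of F and H is collected in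
    ham_data. *)

(** * Euclidean norm and Frechet semidifferentials *)

Section EuclideanNorm.
Context {R : realType} {n : nat}.
Implicit Types (x y z p v h : 'rV[R]_n) (a b c : R).

Lemma dotvC x y : dotv x y = dotv y x.
Proof. by rewrite /dotv; apply: eq_bigr => i _; rewrite mulrC. Qed.

Lemma dotvDl x y z : dotv (x + y) z = dotv x z + dotv y z.
Proof. by rewrite /dotv -big_split; apply: eq_bigr => i _; rewrite mxE mulrDl. Qed.

Lemma dotvZl a x y : dotv (a *: x) y = a * dotv x y.
Proof. by rewrite /dotv big_distrr; apply: eq_bigr => i _; rewrite mxE /= mulrA. Qed.

Lemma dotvNl x y : dotv (- x) y = - dotv x y.
Proof. by rewrite -scaleN1r dotvZl mulN1r. Qed.

Lemma dotvBl x y z : dotv (x - y) z = dotv x z - dotv y z.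
Proof. by rewrite dotvDl dotvNl. Qed.

Lemma dotvDr x y z : dotv x (y + z) = dotv x y + dotv x z.
Proof. by rewrite dotvC dotvDl !(dotvC _ x). Qed.

Lemma dotvZr a x y : dotv x (a *: y) = a * dotv x y.
Proof. by rewrite dotvC dotvZl dotvC. Qed.

Lemma dotvNr x y : dotv x (- y) = - dotv x y.
Proof. by rewrite dotvC dotvNl dotvC. Qed.

Lemma dotvBr x y z : dotv x (y - z) = dotv x y - dotv x z.
Proof. by rewrite dotvDr dotvNr. Qed.

Lemma dotv0l x : dotv 0 x = 0.
Proof. by rewrite -(scale0r 0) dotvZl mul0r. Qed.

Lemma dotv0r x : dotv x 0 = 0.
Proof. by rewrite dotvC dotv0l. Qed.

Lemma dotvv_ge0 x : 0 <= dotv x x.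
Proof. by apply: sumr_ge0 => i _; rewrite -expr2 sqr_ge0. Qed.

Lemma enorm_ge0 x : 0 <= enorm x.
Proof. exact: sqrtr_ge0. Qed.

Lemma sqr_enorm x : enorm x ^+ 2 = dotv x x.
Proof. by rewrite sqr_sqrtr // dotvv_ge0. Qed.

Lemma enorm0 : enorm (0 : 'rV[R]_n) = 0.
Proof. by rewrite /enorm dotv0l sqrtr0. Qed.

Lemma coord_le_enorm x i : `|x 0 i| <= enorm x.
Proof.
rewrite -sqrtr_sqr ler_sqrt; last exact: dotvv_ge0.
rewrite /dotv (bigD1 i) //= -expr2 lerDl.
by apply: sumr_ge0 => j _; rewrite -expr2 sqr_ge0.
Qed.

Lemma enorm_eq0 x : (enorm x == 0) = (x == 0).
Proof.
apply/eqP/eqP => [x0|->]; last exact: enorm0.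
apply/rowP => i; rewrite mxE; apply/eqP; rewrite -normr_eq0.
by rewrite eq_le normr_ge0 andbT -x0 coord_le_enorm.
Qed.

Lemma enorm_gt0 x : (0 < enorm x) = (x != 0).
Proof. by rewrite lt0r enorm_eq0 enorm_ge0 andbT. Qed.

Lemma enormZ a x : enorm (a *: x) = `|a| * enorm x.
Proof.
rewrite /enorm dotvZl dotvZr mulrA -expr2 sqrtrM ?sqr_ge0 //.
by rewrite sqrtr_sqr.
Qed.

Lemma enormN x : enorm (- x) = enorm x.
Proof. by rewrite -scaleN1r enormZ normrN1 mul1r. Qed.

Lemma enormB x y : enorm (x - y) = enorm (y - x).
Proof. by rewrite -enormN opprB. Qed.

Lemma dotv_le x y : dotv x y <= enorm x * enorm y.
Proof.
have [->|y0] := eqVneq y 0; first by rewrite dotv0r enorm0 mulr0.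
have y1 : 0 < enorm y by rewrite enorm_gt0.
have := dotvv_ge0 (enorm y ^+ 2 *: x - dotv x y *: y).
rewrite dotvBl !dotvBr !dotvZl !dotvZr -!sqr_enorm (dotvC y x) => H.
have : 0 <= enorm y ^+ 2 * ((enorm x * enorm y) ^+ 2 - dotv x y ^+ 2) by nra.
rewrite pmulr_rge0 ?exprn_gt0 // subr_ge0 => H2.
have [d0|d0] := lerP (dotv x y) 0.
  by apply: le_trans d0 _; rewrite mulr_ge0 // enorm_ge0.
by rewrite -ler_sqr ?nnegrE ?(ltW d0) // mulr_ge0 // enorm_ge0.
Qed.

Lemma ndotv_le x y : - (enorm x * enorm y) <= dotv x y.
Proof. by rewrite lerNl -dotvNl -(enormN x) dotv_le. Qed.

Lemma norm_dotv_le x y : `|dotv x y| <= enorm x * enorm y.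
Proof. by rewrite ler_norml ndotv_le dotv_le. Qed.

Lemma enormD x y : enorm (x + y) <= enorm x + enorm y.
Proof.
rewrite -ler_sqr ?nnegrE ?addr_ge0 ?enorm_ge0 //.
rewrite sqr_enorm dotvDl !dotvDr (dotvC y x) -!sqr_enorm.
by have := dotv_le x y; nra.
Qed.

Lemma enorm_triangle x y z : enorm (x - z) <= enorm (x - y) + enorm (y - z).
Proof. by rewrite (le_trans _ (enormD _ _)) // addrA subrK. Qed.

Lemma enorm_sum (I : finType) (f : I -> 'rV[R]_n) :
  enorm (\sum_i f i) <= \sum_i enorm (f i).
Proof.
elim/big_ind2: _ => //; first by rewrite enorm0.
move=> x a y b xa yb; apply: le_trans (enormD _ _) _; exact: lerD.
Qed.

Lemma enorm_le_coord x a : (forall i, `|x 0 i| <= a) -> enorm x <= n%:R * a.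
Proof.
move=> xa; have -> : x = \sum_i (x 0 i *: delta_mx 0 i) by rewrite -row_sum_delta.
apply: le_trans (enorm_sum _) _.
rewrite -[n in n%:R]card_ord -sum1_card natr_sum mulr_suml; apply: ler_sum => i _.
rewrite enormZ mul1r.
suff -> : enorm (delta_mx 0 i : 'rV[R]_n) = 1 by rewrite mulr1.
rewrite /enorm /dotv (bigD1 i) //= big1 ?addr0 ?mxE ?eqxx ?mulr1 ?sqrtr1 //.
by move=> j ji; rewrite !mxE (negbTE ji) mulr0.
Qed.

Lemma norm_le_enorm x : `|x| <= enorm x.
Proof.
rewrite [`|x|]mx_normrE; apply/bigmax_leP; split; first exact: enorm_ge0.
by move=> [i j] _ /=; rewrite ord1 coord_le_enorm.
Qed.

Lemma enorm_le_norm x : enorm x <= n%:R * `|x|.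
Proof.
apply: enorm_le_coord => i.
by rewrite [`|x|]mx_normrE; apply/bigmax_geP; right => /=; exists (0, i).
Qed.

Lemma nbhs_enormP x (K : set 'rV[R]_n) :
  nbhs x K <-> exists2 d : R, 0 < d & forall y, enorm (y - x) < d -> K y.
Proof.
split.
  move=> /nbhs_ballP[e /= e0 eK]; exists e => // y xy; apply: eK.
  rewrite -ball_normE /= distrC; exact: le_lt_trans (norm_le_enorm _) xy.
move=> [d d0 dK]; apply/nbhs_ballP; exists (d / n.+1%:R) => /=.
  by rewrite divr_gt0.
move=> y; rewrite -ball_normE /= distrC ltr_pdivlMr // => xy; apply: dK.
apply: le_lt_trans (enorm_le_norm _) _; apply: le_lt_trans xy.
by rewrite mulrC ler_wpM2l // ler_nat.
Qed.

(** Linear functionals are homogeneous, so a first-order comparison near 0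
    is an equality. *)
Lemma dotv_small_eq p q : (forall e : R, 0 < e -> exists2 d : R, 0 < d &
    forall h, enorm h < d -> dotv p h <= dotv q h + e * enorm h) -> p = q.
Proof.
move=> H; apply/eqP; rewrite -subr_eq0 -enorm_eq0; apply/eqP.
apply/eqP; rewrite eq_le enorm_ge0 andbT; apply/ler_addgt0Pr => e e0.
rewrite add0r; have [d d0 dH] := H e e0.
set w := p - q; have [->|w0] := eqVneq w 0; first by rewrite enorm0 ltW.
have w1 : 0 < enorm w by rewrite enorm_gt0.
set a := d / (2 * enorm w).
have a0 : 0 < a by rewrite divr_gt0 // mulr_gt0.
have aw : enorm (a *: w) = d / 2.
  by rewrite enormZ gtr0_norm // /a; field; rewrite gt_eqF.
have := dH (a *: w); rewrite aw => /(_ ltac:(lra)).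
rewrite -lerBlDl -dotvBl -/w dotvZr -sqr_enorm.
have -> : d / 2 = a * enorm w by rewrite /a; field; rewrite gt_eqF.
move=> hw; rewrite -(ler_pM2l a0) -(ler_pM2r w1); lra.
Qed.

End EuclideanNorm.

Section FrechetSemidifferentials.
Context {R : realType} {n : nat}.
Implicit Types (x y p : 'rV[R]_n) (f : 'rV[R]_n -> R).

(** The extended-real limits in the definitions unfold to the usual
    epsilon-delta inequalities, stated at every nearby y including x itself. *)
Lemma superdiffW f x p : superdiff f x p -> forall e : R, 0 < e ->
  exists2 d : R, 0 < d & forall y, enorm (y - x) < d ->
    f y <= f x + dotv p (y - x) + e * enorm (y - x).
Proof.
rewrite /superdiff /= /limf_esup => H e e0.
have /ereal_inf_lt[_ [V xV <-] Ve] : (ereal_inf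
    [set ereal_sup (frechet_quot f x p @` V) | V in x^'] < e%:E)%E.
  by apply: le_lt_trans H _; rewrite lte_fin.
move: xV => /nbhs_enormP[d d0 dV]; exists d => // y xy.
have [->|yx] := eqVneq y x; first by rewrite subrr dotv0r enorm0 mulr0 !addr0.
have yx0 : 0 < enorm (y - x) by rewrite enorm_gt0 subr_eq0.
have : (frechet_quot f x p y < e%:E)%E.
  apply: le_lt_trans Ve; apply: ereal_sup_ubound; exists y => //; exact: dV.
by rewrite lte_fin ltr_pdivrMr //; lra.
Qed.

Lemma subdiffW f x p : subdiff f x p -> forall e : R, 0 < e ->
  exists2 d : R, 0 < d & forall y, enorm (y - x) < d ->
    f x + dotv p (y - x) - e * enorm (y - x) <= f y.
Proof.
move=> H e e0.
have : superdiff (fun y => - f y) x (- p).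
  rewrite /superdiff /=; move: H; rewrite /subdiff /= /limf_einf oppe_ge0.
  congr (limf_esup _ _ <= 0)%E; apply/funext => y.
  by rewrite /frechet_quot /= -mulNr dotvNl; congr ((_ / _)%:E); lra.
move=> /superdiffW/(_ e e0)[d d0 dH]; exists d => // y /dH.
by rewrite dotvNl; lra.
Qed.

End FrechetSemidifferentials.

(** * Absolute continuity and monotonicity *)

Section AbsoluteContinuity.
Context {R : realType}.
Implicit Types (a b s u v : R) (w : R -> R -> R) (g : R -> R).

(** Continuous induction: the supremum of the points satisfying Q is crossed
    by the local step, so it can only be b. *)
Lemma segment_induction a b (Q : R -> Prop) : a <= b -> Q a ->
  (forall s, a <= s <= b -> exists2 e : R, 0 < e &
     forall u v, a <= u -> u <= s -> s <= v -> v <= b -> s - e < u ->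
       v < s + e -> Q u -> Q v) ->
  Q b.
Proof.
move=> ab Qa step.
pose S := [set s | a <= s <= b /\ Q s].
have Sa : S a by split => //; rewrite lexx.
have Sb : ubound S b by move=> s [/andP[]].
have hS : has_sup S by split; [exists a|exists b].
have aS : a <= sup S by apply: ub_le_sup => //; exists b.
have Sb' : sup S <= b by apply: ge_sup => //; exists a.
have [e e0 eQ] := step (sup S) ltac:(by rewrite aS Sb').
have [u [/andP[au ub] Qu] ue] := sup_adherent e0 hS.
have uS : u <= sup S by apply: ub_le_sup; [exists b|split => //; rewrite au ub].
pose v := Num.min b (sup S + e / 2).
have Qv : Q v.
  apply: (eQ u v) => //; rewrite /v.
  - by rewrite le_min Sb'; lra.
  - by rewrite ge_min lexx.
  - by rewrite gt_min; apply/orP; right; lra.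
have vS : v <= sup S.
  apply: ub_le_sup; [by exists b|split => //].
  by rewrite /v le_min ab ge_min lexx /= andbT; lra.
have -> : b = v; last by [].
by apply/esym/min_idPl; move: vS; rewrite /v ge_min => /orP[|]; lra.
Qed.

(** Absolute continuity is phrased for functions w of an interval so that
    vector-valued arcs, scalar functions and sums of oscillations are covered
    at once. *)
Definition abs_cont a b w : Prop :=
  forall eps : R, 0 < eps -> exists2 delta : R, 0 < delta &
    forall (m : nat) (u v : 'I_m -> R),
      (forall i, a <= u i /\ u i <= v i /\ v i <= b) ->
      trivIset setT (fun i => `]u i, v i[%classic) ->
      \sum_(i < m) (v i - u i) < delta ->
      \sum_(i < m) w (u i) (v i) < eps.

Lemma abs_cont_len a b : abs_cont a b (fun u v => v - u).
Proof. by move=> e e0; exists e. Qed.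

Lemma abs_contD a b w1 w2 : abs_cont a b w1 -> abs_cont a b w2 ->
  abs_cont a b (fun u v => w1 u v + w2 u v).
Proof.
move=> h1 h2 e e0; have e20 : 0 < e / 2 by rewrite divr_gt0.
have [d1 d10 H1] := h1 _ e20; have [d2 d20 H2] := h2 _ e20.
exists (Num.min d1 d2); first by rewrite lt_min d10 d20.
move=> m u v uv tI; rewrite lt_min => /andP[l1 l2].
by rewrite big_split /=; have := H1 m u v uv tI l1; have := H2 m u v uv tI l2; lra.
Qed.

Lemma abs_cont_le a b a' b' C w w' : a <= a' -> b' <= b -> 0 <= C ->
  abs_cont a b w ->
  (forall u v, a' <= u -> u <= v -> v <= b' -> w' u v <= C * w u v) ->
  abs_cont a' b' w'.
Proof.
move=> aa bb C0 hw ww e e0.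
have C1 : 0 < C + 1 by rewrite ltr_wpDl.
have [d1 d10 H1] := hw (e / (C + 1)) ltac:(by rewrite divr_gt0).
exists d1 => // m u v uv tI l1.
have uv' i : a <= u i /\ u i <= v i /\ v i <= b.
  by have [h1 [h2 h3]] := uv i; split; [lra|split => //; lra].
have := H1 m u v uv' tI l1; rewrite ltr_pdivlMr // => H.
have HC : \sum_(i < m) w' (u i) (v i) <= C * \sum_(i < m) w (u i) (v i).
  rewrite mulr_sumr; apply: ler_sum => i _.
  by have [h1 [h2 h3]] := uv i; apply: ww.
by nra.
Qed.

(** Only one interval is needed to see that an absolutely continuous
    function is uniformly continuous. *)
Lemma abs_cont_small a b w : abs_cont a b w -> forall e, 0 < e ->
  exists2 d : R, 0 < d &
    forall u v, a <= u -> u <= v -> v <= b -> v - u < d -> w u v < e.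
Proof.
move=> hw e e0; have [d d0 H] := hw e e0; exists d => // u v au uv vb l.
have := H 1%N (fun=> u) (fun=> v).
rewrite !big_ord1; apply => //.
by move=> i j _ _ _; rewrite !ord1.
Qed.

Lemma itv_trivIset m (u v : nat -> R) :
  (forall i j, (i < j < m)%N -> v i <= u j) ->
  trivIset setT (fun i : 'I_m => `]u i, v i[%classic).
Proof.
move=> uv.
have H (i j : 'I_m) z : (i < j)%N -> u j < z -> z < v i -> False.
  move=> ij zu zv; have ijm : (i < j < m)%N by rewrite ij ltn_ord.
  by have := lt_trans zu zv; rewrite ltNge uv.
move=> i j _ _ [z /= []]; rewrite !in_itv /= => /andP[z1 z2] /andP[z3 z4].
case: (ltngtP i j) => [ij|ij|/ord_inj //]; first by case: (H i j z).
by case: (H j i z).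
Qed.

Lemma lebesgue_disjoint_itv (U : set R) m (u v : 'I_m -> R) (d : R) :
  open U -> (lebesgue_measure U < d%:E)%E -> (forall i, u i <= v i) ->
  (forall i, `]u i, v i[%classic `<=` U) ->
  trivIset setT (fun i => `]u i, v i[%classic) ->
  \sum_(i < m) (v i - u i) < d.
Proof.
move=> oU Ud uv UU tI; rewrite -lte_fin -sumEFin; apply: le_lt_trans Ud.
have -> : (\sum_(i < m) (v i - u i)%:E = \sum_(i < m)
    lebesgue_measure (`]u i, v i[%classic : set R))%E.
  apply: eq_bigr => i _; rewrite lebesgue_measure_itv /= lte_fin.
  by have := uv i; rewrite le_eqVlt => /orP[/eqP ->|->];
    rewrite ?ltxx ?subrr // EFinB.
rewrite -measure_semi_additive_ord //; last exact: bigsetU_measurable.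
apply: le_measure; rewrite ?inE; first exact: bigsetU_measurable.
  exact: measurable_realfun.open_measurable.
by elim/big_ind: _ => [//|A B AU BU z [/AU|/BU] //|i _]; exact: UU.
Qed.

Lemma is_derive_approx g s d : is_derive s 1 g d -> forall e, 0 < e ->
  exists2 h0 : R, 0 < h0 & forall h, `|h| < h0 ->
    `|g (s + h) - g s - h * d| <= e * `|h|.
Proof.
move=> [dg <-] e e0.
have /cvgrPdist_le/(_ e e0) := dg; rewrite /derive.
move=> /nbhs_ballP[h0 /= h00 H]; exists h0 => // h hh.
have [->|hN] := eqVneq h 0; first by rewrite addr0 subrr mul0r subrr normr0 mulr0.
have := H h; rewrite -ball_normE /= sub0r normrN => /(_ hh hN).
rewrite /= [h *: 1]mulr1 (addrC h s).
set D := lim _ => HD.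
have -> : g (s + h) - g s - h * D = - (h * (D - h^-1 *: (g (s + h) - g s))).
  rewrite /GRing.scale /=; field; exact: hN.
by rewrite normrN normrM mulrC ler_wpM2r.
Qed.

(** The exceptional null set lies in an open set U of small measure.  Running along [a, b], the function decreases by
    at most eps per unit of length near a point of differentiability, and
    near an exceptional point the step is taken inside U; the steps inside U
    are disjoint intervals of small total length, so absolute continuity
    bounds what is lost there. *)
Lemma abs_cont_ndecr a b g : a <= b ->
  abs_cont a b (fun u v => `|g v - g u|) ->
  {ae (@lebesgue_measure R), forall s, s \in `[a, b] ->
     exists2 d : R, is_derive s 1 g d & 0 <= d} ->
  g a <= g b.
Proof.
move=> ab acg [N [mN N0 NP]].
apply/ler_addgt0Pr => e e0.
pose e1 := e / (2 * (b - a + 1)).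
have ba1 : 0 < 2 * (b - a + 1) by lra.
have e10 : 0 < e1 by rewrite divr_gt0.
have [d d0 Hd] := acg (e / 2) ltac:(by rewrite divr_gt0).
have Nfin : (lebesgue_measure N < +oo)%E by rewrite [X in (X < _)%E]N0 ltry.
have [U [oU NU Ud]] := lebesgue_regularity_outer mN Nfin d0.
have {}Ud : (lebesgue_measure U < d%:E)%E.
  have -> : U = (U `\` N) `|` N by rewrite setUC setDUK.
  apply: le_lt_trans Ud.
  apply: le_trans (measureU2 _ _ _) _ => //.
    apply: measurableD => //; exact: measurable_realfun.open_measurable.
  by rewrite [X in (_ + X)%E]N0 adde0.
pose Q s := exists m (u v : nat -> R),
  [/\ (forall i, (i < m)%N -> [/\ a <= u i, u i <= v i & v i <= s]),
      (forall i, (i < m)%N -> `]u i, v i[%classic `<=` U),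
      (forall i j, (i < j < m)%N -> v i <= u j) &
      g a - e1 * (s - a) - \sum_(i < m) `|g (v i) - g (u i)| <= g s].
have Qstep s' s : s' <= s -> g s' - e1 * (s - s') <= g s -> Q s' -> Q s.
  move=> ss gs [m [u [v [h1 h2 h3 h4]]]]; exists m, u, v; split => //.
    by move=> i im; have [? ? ?] := h1 i im; split => //; lra.
  by lra.
have QstepU s' s : a <= s' -> s' <= s -> `]s', s[%classic `<=` U -> Q s' -> Q s.
  move=> as' ss sU [m [u [v [h1 h2 h3 h4]]]].
  exists m.+1, (fun i => if (i == m)%N then s' else u i),
    (fun i => if (i == m)%N then s else v i); split.
  - move=> i; rewrite ltnS leq_eqVlt; case: eqVneq => //= _ im.
    by have [? ? ?] := h1 i im; split => //; lra.
  - by move=> i; rewrite ltnS leq_eqVlt; case: eqVneq => //= _; exact: h2.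
  - move=> i j /andP[ij]; rewrite ltnS leq_eqVlt.
    case: (eqVneq j m) => /= [jm _|jm jm'].
      rewrite jm in ij; rewrite (ltn_eqF ij).
      by have [? ? ?] := h1 i ij; lra.
    by rewrite (ltn_eqF (ltn_trans ij jm')); apply: h3; rewrite ij.
  - rewrite big_ord_recr /= eqxx.
    under eq_bigr => i _ do rewrite (ltn_eqF (ltn_ord i)).
    have := ler_norm (- (g s - g s')); rewrite normrN => H.
    have : 0 <= e1 * (s - s') by rewrite mulr_ge0 //; lra.
    by lra.
have Qb : Q b.
  apply: (@segment_induction a b) => //.
    exists 0%N, (fun=> 0), (fun=> 0); split => //.
    by rewrite big_ord0 subrr; lra.
  move=> s /andP[as_ sb].
  have [Ns|Ns] := pselect (N s).
    have /nbhs_ballP[h /= h0 hU] : nbhs s U by apply: oU; exact: NU.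
    exists h => // u v au us sv vb su vs Qu.
    apply: (QstepU u) => //; first by lra.
    move=> z /=; rewrite in_itv /= => /andP[uz zv]; apply: hU.
    by rewrite -ball_normE /= ltr_norml; apply/andP; split; lra.
  have [D Dg D0] : exists2 d : R, is_derive s 1 g d & 0 <= d.
    apply: contrapT => h; apply: Ns; apply: NP => /= /(_ _)h'; apply: h.
    by apply: h'; rewrite in_itv /= as_ sb.
  have [h h0 H] := is_derive_approx Dg e10.
  exists h => // u v au us sv vb su vs.
  apply: Qstep; first lra.
  have := H (u - s) ltac:(by rewrite ltr_norml; apply/andP; split; lra).
  have := H (v - s) ltac:(by rewrite ltr_norml; apply/andP; split; lra).
  rewrite !subrKC (@ler0_norm _ (u - s)) ?(@ger0_norm _ (v - s)); [|lra|lra].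
  rewrite !ler_norml => /andP[h1 _] /andP[_ h2].
  have : 0 <= (v - s) * D by rewrite mulr_ge0 //; lra.
  have : 0 <= (s - u) * D by rewrite mulr_ge0 //; lra.
  by lra.
have [m [u [v [h1 h2 h3 h4]]]] := Qb.
have tI := itv_trivIset h3.
have vu (i : 'I_m) : a <= u i /\ u i <= v i /\ v i <= b.
  by case: (h1 i (ltn_ord i)).
have := Hd m (fun i => u i) (fun i => v i) vu tI.
rewrite (lebesgue_disjoint_itv oU Ud) //; first last.
- by move=> i; apply: h2.
- by move=> i; have [_ []] := vu i.
move=> /(_ isT) S1.
have : e1 * (b - a) <= e / 2.
  rewrite /e1 mulrAC ler_pdivrMr //; have : 0 <= e * (b - a) by rewrite mulr_ge0 //; lra.
  by lra.
by lra.
Qed.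

End AbsoluteContinuity.

(** * Arcs *)

Section ScalarAbsCont.
Context {R : realType}.
Implicit Types (a b s u v : R) (f g : R -> R).

Definition ac_fun a b g := abs_cont a b (fun u v => `|g v - g u|).

Lemma ac_fun_bounded a b g : a <= b -> ac_fun a b g ->
  exists2 B : R, 0 <= B & forall s, a <= s <= b -> `|g s| <= B.
Proof.
move=> ab /abs_cont_small/(_ 1 ltr01)[d d0 H].
suff [B HB] : exists B : R, forall s, a <= s <= b -> `|g s| <= B.
  exists B => //; apply: le_trans (HB a _); rewrite ?lexx //.
apply: (@segment_induction R a b
    (fun t => exists B : R, forall s, a <= s <= t -> `|g s| <= B)) => //.
  by exists `|g a| => s /andP[? ?]; have -> : s = a by lra.
move=> s /andP[as_ sb]; exists (d / 2); first by rewrite divr_gt0.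
move=> u v au us sv vb su vs [B HB]; exists (B + 1) => t /andP[at_ tv].
have [tu|ut] := lerP t u; first by rewrite (le_trans (HB t _)) ?at_ //; lra.
have := H u t au (ltW ut) ltac:(lra) ltac:(lra).
have := HB u ltac:(by rewrite au lexx).
move=> h1 h2; have := ler_normD (g t - g u) (g u); rewrite subrK; lra.
Qed.

Lemma ac_funM a b f g : a <= b -> ac_fun a b f -> ac_fun a b g ->
  ac_fun a b (fun s => f s * g s).
Proof.
move=> ab acf acg; have [B B0 HB] := ac_fun_bounded ab acf.
have [C C0 HC] := ac_fun_bounded ab acg.
apply: (abs_cont_le (C := B + C) (lexx a) (lexx b) _ (abs_contD acf acg)).
  by rewrite addr_ge0.
move=> u v au uv vb /=.
have -> : f v * g v - f u * g u = f v * (g v - g u) + g u * (f v - f u) by ring.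
apply: le_trans (ler_normD _ _) _; rewrite !normrM.
have h1 := HB v ltac:(by rewrite (le_trans au uv)).
have h2 := HC u ltac:(by rewrite au (le_trans uv vb)).
rewrite mulrDl !mulrDr.
have := ler_wpM2r (normr_ge0 (g v - g u)) h1.
have := ler_wpM2r (normr_ge0 (f v - f u)) h2.
have := mulr_ge0 B0 (normr_ge0 (f v - f u)).
have := mulr_ge0 C0 (normr_ge0 (g v - g u)).
by lra.
Qed.

Lemma ac_funD a b f g : ac_fun a b f -> ac_fun a b g ->
  ac_fun a b (fun s => f s + g s).
Proof.
move=> acf acg.
apply: (abs_cont_le (lexx a) (lexx b) ler01 (abs_contD acf acg)).
move=> u v _ _ _; rewrite mul1r; apply: le_trans (ler_normD _ _).
by rewrite le_eqVlt; apply/orP; left; apply/eqP; congr `|_|; ring.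
Qed.

Lemma ac_fun_lip a b C g : 0 <= C ->
  (forall u v, a <= u -> u <= v -> v <= b -> `|g v - g u| <= C * (v - u)) ->
  ac_fun a b g.
Proof.
by move=> C0 H; apply: (abs_cont_le (lexx a) (lexx b) C0 (abs_cont_len a b)).
Qed.

Lemma ac_fun_cst a b c : ac_fun a b (fun=> c).
Proof.
by apply: (ac_fun_lip ler01) => u v _ uv _; rewrite subrr normr0 mul1r subr_ge0.
Qed.

Lemma ac_funN a b g : ac_fun a b g -> ac_fun a b (fun s => - g s).
Proof.
move=> acg; apply: (abs_cont_le (lexx a) (lexx b) ler01 acg) => u v _ _ _.
by rewrite mul1r -normrN opprB opprK addrC.
Qed.

Lemma ac_fun_expR a b k : ac_fun a b (fun s => expR (k * s)).
Proof.
pose M := Num.max (expR (k * a)) (expR (k * b)).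
have M0 : 0 <= M by rewrite /M le_max expR_ge0.
have HM s : a <= s -> s <= b -> expR (k * s) <= M.
  move=> as_ sb; rewrite /M le_max !ler_expR.
  have [k0|k0] := lerP 0 k; apply/orP; [right|left].
    by rewrite ler_wpM2l.
  by rewrite ler_nM2l.
have H s t : expR (k * s) - expR (k * t) <= expR (k * s) * (`|k| * `|s - t|).
  have := expR_ge1Dx (k * t - k * s); rewrite expRD expRN.
  have s0 := expR_gt0 (k * s).
  rewrite -(ler_pM2l s0) mulrCA mulfV ?gt_eqF // mulr1 => h.
  rewrite -normrM; apply: (@le_trans _ _ (expR (k * s) * (k * (s - t)))).
    lra.
  by rewrite ler_wpM2l ?(ltW s0) // ler_norm.
apply: (@ac_fun_lip a b (M * `|k|)); first by rewrite mulr_ge0.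
move=> u v au uv vb.
have h1 := H u v; have h2 := H v u.
rewrite distrC (@ger0_norm _ (v - u)) ?subr_ge0 // in h1.
rewrite (@ger0_norm _ (v - u)) ?subr_ge0 // in h2.
have p : 0 <= `|k| * (v - u) by rewrite mulr_ge0 // subr_ge0.
have m1 := ler_wpM2r p (HM u au (le_trans uv vb)).
have m2 := ler_wpM2r p (HM v (le_trans au uv) vb).
by rewrite ler_norml -mulrA; apply/andP; split; lra.
Qed.

Lemma is_derive_expRM k s : is_derive s 1 (fun s => expR (k * s)) (k * expR (k * s)).
Proof.
have h1 : is_derive s 1 (fun s : R => k * s) k.
  have h := is_deriveM (is_derive_cst (k : R^o) s 1) (is_derive_id s (1 : R^o)).
  by apply: (is_derive_eq h); rewrite scaler0 addr0 [LHS]mulr1.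
have h2 := is_derive_expR (k * s).
apply: (is_derive_eq (is_derive1_comp h2 h1)); by rewrite mulrC.
Qed.

End ScalarAbsCont.

Section Arcs.
Context {R : realType} {n : nat}.
Implicit Types (a b c s t : R) (x y z : R -> 'rV[R]_n).

Lemma is_derive_rowP x s (d : 'rV[R]_n) :
  is_derive s 1 x d <-> forall i, is_derive s 1 (fun t => x t 0 i) (d 0 i).
Proof.
split=> [[dx <-] i|H].
  have /derivable_mxP dx' := dx; split; first exact: dx'.
  by rewrite derive_mx // mxE.
have dx : derivable x s 1.
  by apply/derivable_mxP => i j; rewrite ord1; have [] := H j.
split => //; rewrite derive_mx //; apply/rowP => i.
by rewrite mxE; have [] := H i.
Qed.

Lemma is_derive_dotv x y s dx dy : is_derive s 1 x dx -> is_derive s 1 y dy ->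
  is_derive s 1 (fun t => dotv (x t) (y t)) (dotv dx (y s) + dotv (x s) dy).
Proof.
move=> /is_derive_rowP hx /is_derive_rowP hy; rewrite /dotv -big_split /=.
have -> : (fun t => \sum_(i < n) x t 0 i * y t 0 i) =
    \sum_(i < n) ((fun t => x t 0 i) * (fun t => y t 0 i)).
  by apply/funext => t; rewrite fct_sumE.
apply: is_derive_sum => i.
have h := is_deriveM (hx i) (hy i).
by apply: (is_derive_eq h); rewrite /GRing.scale /=; ring.
Qed.

Lemma derive1_is_derive x s : derivable x s 1 -> is_derive s 1 x (derive1 x s).
Proof. by move=> h; rewrite derive1E; exact: DeriveDef. Qed.

Lemma is_arcE a b x : is_arc a b x = abs_cont a b (fun u v => enorm (x v - x u)).
Proof. by []. Qed.

Lemma is_arc_sub a b a' b' x : a <= a' -> b' <= b -> is_arc a b x -> is_arc a' b' x.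
Proof.
by rewrite !is_arcE => aa bb /(abs_cont_le aa bb ler01); apply => u v _ _ _; rewrite mul1r.
Qed.

Lemma is_arcB a b x y : is_arc a b x -> is_arc a b y ->
  is_arc a b (fun s => x s - y s).
Proof.
rewrite !is_arcE => hx hy.
apply: (abs_cont_le (lexx a) (lexx b) ler01 (abs_contD hx hy)).
move=> u v _ _ _; rewrite mul1r -(enormN (y v - y u)).
apply: le_trans (enormD _ _); rewrite le_eqVlt; apply/orP; left; apply/eqP.
by congr enorm; apply/rowP => i; rewrite !mxE; ring.
Qed.

Lemma is_arc_lip a b C x : 0 <= C ->
  (forall u v, a <= u -> u <= v -> v <= b -> enorm (x v - x u) <= C * (v - u)) ->
  is_arc a b x.
Proof.
rewrite is_arcE => C0 H.
exact: (abs_cont_le (lexx a) (lexx b) C0 (abs_cont_len a b)).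
Qed.

Lemma is_arc_cst a b (p : 'rV[R]_n) : is_arc a b (fun=> p).
Proof.
by apply: (is_arc_lip ler01) => u v _ uv _; rewrite subrr enorm0 mul1r subr_ge0.
Qed.

Lemma arc_continuous a b x : is_arc a b x -> forall e, 0 < e ->
  exists2 d : R, 0 < d & forall s t, a <= s <= b -> a <= t <= b ->
    `|s - t| < d -> enorm (x s - x t) < e.
Proof.
rewrite is_arcE => hx e e0; have [d d0 H] := abs_cont_small hx e0.
have W s t : t <= s -> a <= s <= b -> a <= t <= b -> `|s - t| < d ->
    enorm (x s - x t) < e.
  move=> ts /andP[as_ sb] /andP[at_ tb].
  by rewrite ger0_norm ?subr_ge0 // => h; exact: H.
exists d => // s t h1 h2; have [ts|/ltW st] := leP t s; first exact: W.
by rewrite distrC enormB; exact: W.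
Qed.

Lemma ac_fun_coord a b x i : is_arc a b x -> ac_fun a b (fun s => x s 0 i).
Proof.
rewrite is_arcE /ac_fun => /(abs_cont_le (lexx a) (lexx b) ler01); apply => u v _ _ _.
rewrite mul1r.
by have := coord_le_enorm (x v - x u) i; rewrite !mxE.
Qed.

Lemma ac_fun_dotv a b x y : a <= b -> is_arc a b x -> is_arc a b y ->
  ac_fun a b (fun s => dotv (x s) (y s)).
Proof.
move=> ab hx hy; rewrite /dotv.
elim: (index_enum _) => [|i r ih].
  have -> : (fun s => \sum_(i <- [::]) x s 0 i * y s 0 i) = (fun=> 0).
    by apply/funext => s; rewrite big_nil.
  exact: ac_fun_cst.
have -> : (fun s => \sum_(j <- i :: r) x s 0 j * y s 0 j) =
    (fun s => x s 0 i * y s 0 i + \sum_(j <- r) x s 0 j * y s 0 j).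
  by apply/funext => s; rewrite big_cons.
by apply: ac_funD => //; apply: ac_funM => //; apply: ac_fun_coord.
Qed.

Lemma arc_bounded a b x : a <= b -> is_arc a b x ->
  exists2 B : R, 0 <= B & forall s, a <= s <= b -> enorm (x s) <= B.
Proof.
move=> ab hx; have [B B0 H] := ac_fun_bounded ab (ac_fun_dotv ab hx hx).
exists (B + 1); first by rewrite addr_ge0.
move=> s sab; rewrite -ler_sqr ?nnegrE ?enorm_ge0 ?addr_ge0 // sqr_enorm.
have := H s sab; rewrite ger0_norm ?dotvv_ge0 // => h.
by apply: le_trans h _; rewrite expr2; nra.
Qed.

End Arcs.

Section AlmostEverywhere.
Context {R : realType}.
Implicit Types (P Q S : R -> Prop).

Let ae_lebesgue_filter : Filter (almost_everywhere (@lebesgue_measure R)).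
Proof. exact: (ae_filter_ringOfSetsType lebesgue_measure). Qed.

Lemma ae_imp P Q : {ae (@lebesgue_measure R), forall s, P s} ->
  (forall s, P s -> Q s) -> {ae (@lebesgue_measure R), forall s, Q s}.
Proof. by move=> + PQ; apply: (@filterS _ _ ae_lebesgue_filter) => s; exact: PQ. Qed.

Lemma ae_and P Q : {ae (@lebesgue_measure R), forall s, P s} ->
  {ae (@lebesgue_measure R), forall s, Q s} ->
  {ae (@lebesgue_measure R), forall s, P s /\ Q s}.
Proof. by apply: (@filterS2 _ _ ae_lebesgue_filter) => s; split. Qed.

Lemma ae_neq (a : R) : {ae (@lebesgue_measure R), forall s, s <> a}.
Proof.
exists [set a]; split => //; first exact: lebesgue_measure_set1.
by move=> s /= /contrapT.
Qed.

End AlmostEverywhere.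

Section Clamp.
Context {R : realType}.
Implicit Types a b s t : R.

Definition clamp a b s : R := Num.max a (Num.min s b).

Lemma clamp_id a b s : a <= s <= b -> clamp a b s = s.
Proof. by move=> /andP[as_ sb]; rewrite /clamp (min_idPl sb) (max_idPr as_). Qed.

Lemma clamp_itv a b s : a <= b -> a <= clamp a b s <= b.
Proof. by move=> ab; rewrite /clamp le_max lexx ge_max ab ge_min lexx orbT. Qed.

Lemma clamp_lip a b s t : a <= b -> `|clamp a b s - clamp a b t| <= `|s - t|.
Proof.
rewrite /clamp => ab; rewrite ler_norml.
have := ler_norm (s - t); have := ler_norm (- (s - t)); rewrite normrN.
move: `|s - t| => D.
have [s1|s1] := leP s b; have [t1|t1] := leP t b;
  (try have [s2|s2] := leP a s); (try have [t2|t2] := leP a t);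
  (try have [b2|b2] := leP a b) => h1 h2; apply/andP; split; lra.
Qed.

End Clamp.

Section ArcCalculus.
Context {R : realType} {n : nat}.
Implicit Types (a b c s t k : R) (x y z : R -> 'rV[R]_n)
  (P Q S : R -> 'rV[R]_n -> Prop).

Lemma ae_deriv_sub a b a' b' x P : a <= a' -> b' <= b ->
  ae_deriv a b x P -> ae_deriv a' b' x P.
Proof.
move=> aa bb /ae_imp; apply => s h; rewrite in_itv /= => /andP[h1 h2]; apply: h.
by rewrite in_itv /= (le_trans aa h1) (le_trans h2 bb).
Qed.

Lemma ae_derivW a b x P Q :
  (forall s d, a <= s <= b -> is_derive s 1 x d -> P s d -> Q s d) ->
  ae_deriv a b x P -> ae_deriv a b x Q.
Proof.
move=> PQ /ae_imp; apply => s h sab; have [dx Ps] := h sab; split => //.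
by apply: PQ => //; exact: derive1_is_derive.
Qed.

Lemma ae_derivI a b x P Q : ae_deriv a b x P -> ae_deriv a b x Q ->
  ae_deriv a b x (fun s d => P s d /\ Q s d).
Proof.
move=> hP hQ; apply: (ae_imp (ae_and hP hQ)) => s [h1 h2] sab.
by have [? ?] := h1 sab; have [? ?] := h2 sab.
Qed.

Lemma ae_derivB a b x y P Q : ae_deriv a b x P -> ae_deriv a b y Q ->
  ae_deriv a b (fun s => x s - y s)
    (fun s d => exists dx dy, [/\ d = dx - dy, P s dx & Q s dy]).
Proof.
move=> hP hQ; apply: (ae_imp (ae_and hP hQ)) => s [h1 h2] sab.
have [dx Px] := h1 sab; have [dy Qy] := h2 sab.
have [d1 e1] := is_deriveB (derive1_is_derive dx) (derive1_is_derive dy).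
split => //; exists (x^`()%classic s), (y^`()%classic s); split => //.
by rewrite derive1E.
Qed.

(** Form of abs_cont_ndecr for a function g built from three arcs: the
    exceptional null sets of the arcs are merged here once and for all. *)
Lemma arc_ndecr a b x y z P Q S (g : R -> R) : a <= b -> ac_fun a b g ->
  ae_deriv a b x P -> ae_deriv a b y Q -> ae_deriv a b z S ->
  (forall s dx dy dz, a <= s <= b ->
     is_derive s 1 x dx -> is_derive s 1 y dy -> is_derive s 1 z dz ->
     P s dx -> Q s dy -> S s dz ->
     exists2 d : R, is_derive s 1 g d & 0 <= d) ->
  g a <= g b.
Proof.
move=> ab acg hP hQ hS H; apply: abs_cont_ndecr => //.
apply: (ae_imp (ae_and hP (ae_and hQ hS))) => s [h1 [h2 h3]] sab.
have [dx ?] := h1 sab; have [dy ?] := h2 sab; have [dz ?] := h3 sab.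
by apply: H; try exact: derive1_is_derive; rewrite // -in_itv.
Qed.

Lemma arc_dotv_le a b x (p : 'rV[R]_n) c : a <= b -> is_arc a b x ->
  ae_deriv a b x (fun _ d => dotv p d <= c) ->
  dotv p (x b - x a) <= c * (b - a).
Proof.
move=> ab hx h.
suff : c * a - dotv p (x a) <= c * b - dotv p (x b) by rewrite dotvBr; lra.
apply: (arc_ndecr (g := fun s => c * s - dotv p (x s)) ab _ h h h).
  apply: ac_funD.
    apply: (@ac_fun_lip _ a b `|c|) => // u v _ uv _.
    by rewrite -mulrBr normrM (ger0_norm (_ : 0 <= v - u)) // subr_ge0.
  apply: ac_funN; apply: ac_fun_dotv => //; exact: is_arc_cst.
move=> s d _ _ _ hd _ _ dc _ _; exists (c - dotv p d); last by rewrite subr_ge0.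
have h1 := is_deriveM (is_derive_cst (c : R^o) s 1) (is_derive_id s (1 : R^o)).
have h2 := is_derive_dotv (is_derive_cst p s 1) hd.
apply: (is_derive_eq (is_deriveB h1 h2)).
by rewrite scaler0 addr0 dotv0l add0r /GRing.scale /= mulr1.
Qed.

(** Mean value inequality: pairing with the defect p itself reduces it to the
    scalar inequality arc_dotv_le. *)
Lemma arc_mean_velocity a b x (v : 'rV[R]_n) eps : a <= b -> is_arc a b x ->
  ae_deriv a b x (fun _ d => enorm (d - v) <= eps) ->
  enorm (x b - x a - (b - a) *: v) <= eps * (b - a).
Proof.
move=> ab hx h; set p := x b - x a - (b - a) *: v.
have H := arc_dotv_le (p := p) (c := dotv p v + enorm p * eps) ab hx.
have {}H : enorm p ^+ 2 <= enorm p * (eps * (b - a)).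
  have -> : enorm p ^+ 2 = dotv p (x b - x a) - dotv p v * (b - a).
    have -> : enorm p ^+ 2 = dotv p (x b - x a - (b - a) *: v) by rewrite sqr_enorm.
    by rewrite [LHS]dotvBr dotvZr (mulrC _ (b - a)).
  rewrite lerBlDl mulrA -mulrDl; apply: H.
  apply: ae_derivW h => s d _ _ dM; rewrite -lerBlDl -dotvBr.
  by apply: le_trans (dotv_le _ _) _; rewrite ler_wpM2l // enorm_ge0.
have [p0|p0] := eqVneq p 0; last by rewrite expr2 ler_pM2l ?enorm_gt0 in H.
rewrite p0 enorm0; have H0 := arc_dotv_le (p := 0) (c := eps) ab hx.
rewrite dotv0l in H0; apply: H0; apply: ae_derivW h => s d _ _ dM.
by rewrite dotv0l (le_trans (enorm_ge0 _) dM).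
Qed.

Lemma arc_lip a b x M : a <= b -> is_arc a b x ->
  ae_deriv a b x (fun _ d => enorm d <= M) ->
  enorm (x b - x a) <= M * (b - a).
Proof.
move=> ab hx h; have := arc_mean_velocity (v := 0) (eps := M) ab hx.
rewrite scaler0 subr0; apply.
by apply: ae_derivW h => s d _ _; rewrite subr0.
Qed.

(** Gronwall's inequality, as monotonicity of the square of the norm times
    an integrating factor.  The sign sg allows both time directions. *)
Lemma arc_exp_monotone a b z sg k c : a <= b -> is_arc a b z ->
  ae_deriv a b z
    (fun s d => 0 <= sg * (k * (c + enorm (z s) ^+ 2) + dotv (z s) d)) ->
  sg * (expR (2 * k * a) * (c + enorm (z a) ^+ 2)) <=
  sg * (expR (2 * k * b) * (c + enorm (z b) ^+ 2)).
Proof.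
move=> ab hz h.
apply: (arc_ndecr
  (g := fun s => sg * (expR (2 * k * s) * (c + enorm (z s) ^+ 2))) ab _ h h h).
  apply: ac_funM => //; first exact: ac_fun_cst.
  apply: ac_funM => //; first exact: ac_fun_expR.
  apply: ac_funD; first exact: ac_fun_cst.
  have -> : (fun s => enorm (z s) ^+ 2) = (fun s => dotv (z s) (z s)).
    by apply/funext => s; rewrite sqr_enorm.
  exact: ac_fun_dotv.
move=> s d _ _ _ hd _ _ hc _ _.
exists (2 * expR (2 * k * s) *
        (sg * (k * (c + enorm (z s) ^+ 2) + dotv (z s) d))); last first.
  by rewrite mulr_ge0 // mulr_ge0 // expR_ge0.
have -> : (fun s => sg * (expR (2 * k * s) * (c + enorm (z s) ^+ 2))) =
    (cst sg : R -> R) * ((fun s => expR (2 * k * s)) *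
      (cst c + (fun s => dotv (z s) (z s)))).
  by apply/funext => t; rewrite sqr_enorm.
have h1 := is_deriveD (is_derive_cst (c : R^o) s 1) (is_derive_dotv hd hd).
have h2 := is_deriveM (is_derive_expRM (2 * k) s) h1.
apply: (is_derive_eq (is_deriveM (is_derive_cst (sg : R^o) s 1) h2)).
by rewrite sqr_enorm (dotvC d) !fctE /GRing.scale /=; ring.
Qed.

Lemma arc_growth a b z k c : a <= b -> is_arc a b z ->
  ae_deriv a b z (fun s d => dotv (z s) d <= k * (c + enorm (z s) ^+ 2)) ->
  c + enorm (z b) ^+ 2 <= expR (2 * k * (b - a)) * (c + enorm (z a) ^+ 2).
Proof.
move=> ab hz h; have := arc_exp_monotone (sg := -1) (k := - k) (c := c) ab hz.
have H : ae_deriv a b z (fun s d =>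
    0 <= -1 * (- k * (c + enorm (z s) ^+ 2) + dotv (z s) d)).
  by apply: ae_derivW h => s d _ _; lra.
move=> /(_ H); rewrite !mulN1r lerN2 mulrN !mulNr.
rewrite -(ler_pM2l (expR_gt0 (2 * k * b))) !mulrA -!expRD subrr expR0 mul1r.
by rewrite -mulrBr.
Qed.

Lemma arc_growth_rev a b z k : a <= b -> is_arc a b z ->
  ae_deriv a b z (fun s d => - (k * enorm (z s) ^+ 2) <= dotv (z s) d) ->
  enorm (z a) ^+ 2 <= expR (2 * k * (b - a)) * enorm (z b) ^+ 2.
Proof.
move=> ab hz h; have := arc_exp_monotone (sg := 1) (k := k) (c := 0) ab hz.
have H : ae_deriv a b z (fun s d =>
    0 <= 1 * (k * (0 + enorm (z s) ^+ 2) + dotv (z s) d)).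
  by apply: ae_derivW h => s d _ _; lra.
move=> /(_ H); rewrite !mul1r !add0r.
rewrite -(ler_pM2l (expR_gt0 (- (2 * k * a)))) !mulrA -!expRD addNr expR0 mul1r.
by rewrite mulrBr addrC.
Qed.

(** Clamping shortens intervals and keeps them disjoint, so it extends arcs by
    constants beyond their segment. *)
Lemma abs_cont_clamp a b a' b' (w : R -> R -> R) : a' <= b' -> abs_cont a' b' w ->
  abs_cont a b (fun u v => w (clamp a' b' u) (clamp a' b' v)).
Proof.
move=> ab hw e e0; have [d d0 H] := hw e e0; exists d => // m u v uv tI l.
pose q := clamp a' b'.
have qab t : a' <= q t <= b' by exact: clamp_itv.
have qcases t : [\/ t <= a' /\ q t = a', b' <= t /\ q t = b' |
    [/\ a' <= t, t <= b' & q t = t]].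
  rewrite /q /clamp; have [t1|t1] := leP t b'; last first.
    by constructor 2; split; [exact: ltW|exact/max_idPr].
  have [t2|t2] := leP a' t; first by constructor 3.
  by constructor 1; split => //; exact: ltW.
have qmono s t : s <= t -> q s <= q t.
  move=> st; case: (qcases s) => [[? ->]|[? ->]|[? ? ->]];
    case: (qcases t) => [[? ->]|[? ->]|[? ? ->]]; lra.
have qlip s t : s <= t -> q t - q s <= t - s.
  move=> st; case: (qcases s) => [[? ->]|[? ->]|[? ? ->]];
    case: (qcases t) => [[? ->]|[? ->]|[? ? ->]]; lra.
have sub s t : `]q s, q t[%classic `<=` `]s, t[%classic.
  move=> r /=; rewrite !in_itv /= => /andP[].
  case: (qcases s) => [[? ->]|[? ->]|[? ? ->]];
    case: (qcases t) => [[? ->]|[? ->]|[? ? ->]] => ? ?; apply/andP; split; lra.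
apply: (H m (fun i => q (u i)) (fun i => q (v i))).
- move=> i; have [_ [uvi _]] := uv i.
  have [/andP[p1 _] /andP[_ p2]] := (qab (u i), qab (v i)).
  by split => //; split => //; exact: qmono.
- move=> i j _ _ [t []] /= /sub ti /sub tj; apply: (tI i j) => //.
  by exists t; split.
- apply: le_lt_trans l; apply: ler_sum => i _; apply: qlip; apply: (proj1 (proj2 (uv i))).
Qed.

Lemma is_arc_clamp a b a' b' x : a' <= b' -> is_arc a' b' x ->
  is_arc a b (fun s => x (clamp a' b' s)).
Proof. by rewrite !is_arcE => ab /(abs_cont_clamp a b ab). Qed.

(** On [a, c] the concatenation is the sum of the two clamped extensions, up
    to the constant x b. *)
Lemma is_arc_concat a b c x y : a <= b -> b <= c -> x b = y b ->
  is_arc a b x -> is_arc b c y ->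
  is_arc a c (fun s => if s <= b then x s else y s).
Proof.
move=> ab bc xy /(is_arc_clamp a c ab) hx /(is_arc_clamp a c bc) hy.
rewrite is_arcE in hx; rewrite is_arcE in hy; rewrite is_arcE.
have hxy := abs_contD hx hy.
apply: (abs_cont_le (lexx a) (lexx c) ler01 hxy) => u v au uv vc.
rewrite mul1r /=.
have X t : a <= t -> (if t <= b then x t else y t) =
    x (clamp a b t) + y (clamp b c t) - x b \/ c < t.
  move=> at_; rewrite /clamp; have [tc|tc] := leP t c; [left|by right].
  have [tb|tb] := leP t b.
    by rewrite (max_idPr at_) xy addrK.
  by rewrite (max_idPr ab) [x b + _]addrC addrK.
have [->|] := X v (le_trans au uv); last by rewrite ltNge vc.
have [->|] := X u au; last by rewrite ltNge (le_trans uv vc).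
apply: le_trans (enormD _ _); rewrite le_eqVlt; apply/orP; left; apply/eqP.
by congr enorm; apply/rowP => i; rewrite !mxE; ring.
Qed.

Lemma ae_deriv_concat a b c x y (G : R -> 'rV[R]_n -> 'rV[R]_n -> Prop) :
  ae_deriv a b x (fun s d => G s (x s) d) ->
  ae_deriv b c y (fun s d => G s (y s) d) ->
  ae_deriv a c (fun s => if s <= b then x s else y s)
   (fun s d => G s (if s <= b then x s else y s) d).
Proof.
move=> hx hy; apply: (ae_imp (ae_and (ae_neq b) (ae_and hx hy))).
move=> s [sb [h1 h2]]; rewrite in_itv /= => /andP[as_ sc].
have W z dz : is_derive s 1 z dz -> (\near s, z s = if s <= b then x s else y s) ->
    G s (if s <= b then x s else y s) dz ->
    derivable (fun s => if s <= b then x s else y s) s 1 /\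
    G s (if s <= b then x s else y s)
      (derive1 (fun s => if s <= b then x s else y s) s).
  move=> hz nz Pz; have [d1 e1] := near_eq_is_derive nz hz.
  by split => //; rewrite derive1E e1.
have [s1|s1] : s < b \/ b < s by apply/orP; rewrite -neq_lt; apply/eqP.
  have [dx Px] := h1 ltac:(by rewrite in_itv /= as_ ltW).
  apply: (W x (derive1 x s)); first exact: derive1_is_derive.
    near=> t; suff -> : t <= b by [].
    by apply: ltW; near: t; apply: lt_nbhsl.
  by rewrite (ltW s1).
have [dy Py] := h2 ltac:(by rewrite in_itv /= sc ltW).
apply: (W y (derive1 y s)); first exact: derive1_is_derive.
  near=> t; suff -> : (t <= b) = false by [].
  apply: negbTE; rewrite -ltNge; near: t; exact: lt_nbhsr.
by rewrite leNgt s1.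
Unshelve. all: by end_near. Qed.

End ArcCalculus.

(** * Differentials in Euclidean form *)

Section Differentials.
Context {R : realType} {n : nat}.
Implicit Types (x y p v h : 'rV[R]_n) (f : 'rV[R]_n -> R).

Fact dotv_is_linear p : linear (dotv p : 'rV[R]_n -> R).
Proof. by move=> a u v; rewrite dotvDr dotvZr. Qed.

HB.instance Definition _ p := GRing.isLinear.Build R 'rV[R]_n R *%R (dotv p)
  (dotv_is_linear p).

Lemma dotv_continuous p : continuous (dotv p : 'rV[R]_n -> R).
Proof.
move=> x; apply/(@cvgrPdist_le _ _ _ (nbhs x) (nbhs_filter x)) => e e0.
apply/nbhs_enormP.
have p1 : 0 < enorm p + 1 by rewrite ltr_wpDl ?enorm_ge0.
exists (e / (enorm p + 1)); first by rewrite divr_gt0.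
move=> y; rewrite ltr_pdivlMr // => yx /=.
rewrite -dotvBr; apply: le_trans (norm_dotv_le _ _) _; rewrite enormB.
apply: le_trans (ltW yx); rewrite mulrC ler_wpM2l ?enorm_ge0 //; lra.
Qed.

Lemma differentiable_expand (V : normedModType R) (f : V -> R) (x : V)
    (l : {linear V -> R}) : continuous l ->
  (forall e : R, 0 < e -> exists2 d : R, 0 < d & forall h : V, `|h| < d ->
     `|f (x + h) - f x - l h| <= e * `|h|) ->
  differentiable f x /\ 'd f x = l :> (V -> R).
Proof.
move=> lc H.
have o : f \o shift x = cst (f x) + l +o_ 0 id.
  apply/eqaddoP => e e0; have [d d0 Hd] := H e e0.
  apply/nbhs_ballP; exists d => //= h; rewrite -ball_normE /= sub0r normrN => hd.
  by have := Hd h hd; rewrite !fctE /= (addrC h x) opprD addrA.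
have e := diff_unique lc o; split => //.
by apply/diff_locallyP; rewrite e.
Qed.

(** Differentiability refers to the max norm; these two lemmas restate it with
    the Euclidean norm and the dot product. *)
Lemma grad_expand f x : differentiable f x -> forall e : R, 0 < e ->
  exists2 d : R, 0 < d & forall h, enorm h < d ->
    `|f (x + h) - f x - dotv (grad f x) h| <= e * enorm h.
Proof.
move=> df e e0; have := diff_locally df => /eqaddoP/(_ e e0).
move=> /nbhs_enormP[d d0 H]; exists d => // h hd.
have := H h; rewrite subr0 => /(_ hd) /=; rewrite !fctE /= (addrC h x).
have -> : 'd f x h = dotv (grad f x) h.
  rewrite [h in LHS]row_sum_delta linear_sum /dotv; apply: eq_bigr => i _.
  by rewrite linearZ mxE /= mulrC.
rewrite opprD addrA => /le_trans; apply.
by rewrite ler_wpM2l ?norm_le_enorm // ltW.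
Qed.

Lemma grad_of_expand f x p : (forall e : R, 0 < e ->
    exists2 d : R, 0 < d & forall h, enorm h < d ->
      `|f (x + h) - f x - dotv p h| <= e * enorm h) ->
  differentiable f x /\ grad f x = p.
Proof.
move=> H; have [|df dE] := @differentiable_expand _ f x (dotv p) (@dotv_continuous p).
  move=> e e0; have n0 : 0 < n.+1%:R :> R by [].
  have [d d0 Hd] := H (e / n.+1%:R) ltac:(by rewrite divr_gt0).
  exists (d / n.+1%:R); first by rewrite divr_gt0.
  have nn h : enorm h <= n.+1%:R * `|h|.
    by apply: le_trans (enorm_le_norm h) _; rewrite ler_wpM2r // ler_nat.
  move=> h; rewrite ltr_pdivlMr // mulrC => hd.
  apply: le_trans (Hd h (le_lt_trans (nn h) hd)) _.
  by rewrite -mulrA ler_wpM2l ?(ltW e0) // mulrC ler_pdivrMr // mulrC.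
split => //; apply/rowP => i.
rewrite mxE dE -[LHS]/(dotv p (delta_mx 0 i)) /dotv (bigD1 i) //= big1.
  by rewrite mxE !eqxx mulr1 addr0.
by move=> j ji; rewrite mxE (negbTE ji) mulr0.
Qed.

End Differentials.

(** * The Hamiltonian *)

Section Hamiltonian.
Context {R : realType} {n : nat} (F : 'rV[R]_n -> set 'rV[R]_n).
Hypothesis hSH : assumption_SH F.
Implicit Types (x y p q v h xi : 'rV[R]_n).
Local Notation H := (hamiltonian F).

Lemma velocity_ball r : 0 < r -> exists2 M : R, 0 <= M &
  forall x v, enorm x <= r -> F x v -> enorm v <= M.
Proof.
move=> r0; have [_ _ [g g0 Hg]] := hSH; exists (g * (1 + r)).
  by rewrite mulr_ge0 ?addr_ge0 ?ltW.
move=> x v xr /Hg /le_trans; apply; rewrite ler_wpM2l ?(ltW g0) //; lra.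
Qed.

Lemma ham_has_sup x p : has_sup [set dotv v p | v in F x].
Proof.
have [/(_ x)[[v Fv] _ _] _ [g g0 Hg]] := hSH.
split; first by exists (dotv v p), v.
exists (g * (1 + enorm x) * enorm p) => _ [w Fw <-].
apply: le_trans (dotv_le _ _) _; rewrite ler_wpM2r ?enorm_ge0 //; exact: Hg.
Qed.

Lemma ham_ge x p v : F x v -> dotv v p <= H x p.
Proof.
by move=> Fv; apply: ub_le_sup; [exact: (ham_has_sup x p).2|exists v].
Qed.

Lemma ham_le x p (c : R) : (forall v, F x v -> dotv v p <= c) -> H x p <= c.
Proof.
move=> Hc; apply: ge_sup; first exact: (ham_has_sup x p).1.
by move=> _ [v Fv <-]; exact: Hc.
Qed.

Lemma ham_max x p : exists2 v, F x v & dotv v p = H x p.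
Proof.
have [/(_ x)[F0 _ cF] _ _] := hSH.
have cd : {within F x, continuous (dotv p : 'rV[R]_n -> R)}.
  exact/continuous_subspaceT/dotv_continuous.
have [v /set_mem Fv vmax] := compact_EVT_max F0 cF cd.
exists v => //; apply/eqP; rewrite eq_le ham_ge //=.
by apply: ham_le => w Fw; rewrite !(dotvC _ p); apply: vmax; exact: mem_set.
Qed.

Lemma ham_scale x p (a : R) : 0 <= a -> H x (a *: p) = a * H x p.
Proof.
move=> a0; have [v Fv vE] := ham_max x p; have [w Fw wE] := ham_max x (a *: p).
apply/eqP; rewrite eq_le -{2}vE -dotvZr ham_ge // andbT -wE dotvZr.
by rewrite ler_wpM2l // ham_ge.
Qed.

Lemma ham0 x : H x 0 = 0.
Proof. by rewrite -(scale0r 0) ham_scale // mul0r. Qed.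

Lemma ham_lip_p x p q (M : R) : (forall v, F x v -> enorm v <= M) ->
  H x p <= H x q + M * enorm (p - q).
Proof.
move=> HM; apply: ham_le => v Fv; rewrite -[p in dotv v p](subrK q) dotvDr addrC.
apply: lerD; first exact: ham_ge.
apply: le_trans (dotv_le _ _) _; rewrite ler_wpM2r ?enorm_ge0 //; exact: HM.
Qed.

(** The Hamiltonian is positively homogeneous in p, so Euler's identity holds
    for every Frechet subgradient: compare p with (1 + s) p and (1 - s) p. *)
Lemma subdiff_ham_euler x p v : subdiff (H x) p v -> dotv v p = H x p.
Proof.
move=> sv.
have K : forall sg : R, `|sg| = 1 -> sg * dotv v p <= sg * H x p.
  move=> sg sg1; apply/ler_addgt0Pr => e e0.
  have p1 : 0 < enorm p + 1 by rewrite ltr_wpDl ?enorm_ge0.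
  have [d d0 Hd] := subdiffW sv (divr_gt0 e0 p1).
  pose a := Num.min (1/2) (d / (2 * (enorm p + 1))).
  have a0 : 0 < a by rewrite /a lt_min divr_gt0 //= divr_gt0 // mulr_gt0.
  have a12 : a <= 1/2 by rewrite /a ge_min lexx.
  have ad : a * (2 * (enorm p + 1)) <= d.
    by rewrite -ler_pdivlMr ?mulr_gt0 // /a ge_min lexx orbT.
  have := Hd ((1 + sg * a) *: p).
  have -> : (1 + sg * a) *: p - p = (sg * a) *: p.
    by rewrite scalerDl scale1r addrC addKr.
  rewrite enormZ normrM sg1 mul1r (gtr0_norm a0) => /(_ _)h.
  have apd : a * enorm p < d.
    apply: lt_le_trans ad; rewrite ltr_pM2l //; have := enorm_ge0 p; lra.
  have {h} := h apd.
  have sga : 0 <= 1 + sg * a.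
    have := ler_norm (- (sg * a)); rewrite normrN normrM sg1 mul1r (gtr0_norm a0).
    by lra.
  rewrite ham_scale // dotvZr => h.
  have : e / (enorm p + 1) * (a * enorm p) <= a * e.
    rewrite mulrCA ler_pM2l // mulrAC ler_pdivrMr // ler_pM2l //; lra.
  by move=> h2; rewrite -(ler_pM2l a0); lra.
have := K 1 (normr1 _); have := K (-1) (normrN1 _); lra.
Qed.

Lemma ham_ge_sub x p q v : F x v -> dotv v p = H x p ->
  H x p + dotv v (q - p) <= H x q.
Proof. by move=> Fv vE; rewrite -vE -dotvDr addrC subrK; exact: ham_ge. Qed.

Lemma subdiff_grad (f : 'rV[R]_n -> R) p v : differentiable f p ->
  (forall e : R, 0 < e -> exists2 d : R, 0 < d & forall q, enorm (q - p) < d ->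
     f p + dotv v (q - p) - e * enorm (q - p) <= f q) ->
  v = grad f p.
Proof.
move=> df Hv; apply: dotv_small_eq => e e0.
have e20 : 0 < e / 2 by rewrite divr_gt0.
have [d1 d10 H1] := grad_expand df e20; have [d2 d20 H2] := Hv _ e20.
exists (Num.min d1 d2); first by rewrite lt_min d10.
move=> h; rewrite lt_min => /andP[hd1 hd2].
have := H1 h hd1; rewrite ler_norml => /andP[_ h1].
by have := H2 (p + h); rewrite addrC addKr addrC => /(_ hd2) h2; lra.
Qed.

Lemma ham_argmax_grad x p v : differentiable (H x) p -> F x v ->
  dotv v p = H x p -> v = grad (H x) p.
Proof.
move=> df Fv vE; apply: subdiff_grad => // e e0; exists 1 => // q _.
have := ham_ge_sub q Fv vE; have := mulr_ge0 (ltW e0) (enorm_ge0 (q - p)); lra.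
Qed.

(** A maximizing velocity exists by compactness and is a subgradient of
    H(x, .), so it can only be the gradient. *)
Lemma ham_grad_argmax x p : differentiable (H x) p ->
  F x (grad (H x) p) /\ dotv (grad (H x) p) p = H x p.
Proof.
by move=> df; have [v Fv vE] := ham_max x p; rewrite -(ham_argmax_grad df Fv vE).
Qed.

(** Continuity of the gradient in p, from convexity of the Hamiltonian: the
    gradient at a nearby p' is bounded in each direction by a difference
    quotient of fixed length, which compares with the one at p. *)
Lemma ham_grad_continuous x p : differentiable (H x) p ->
  forall e : R, 0 < e -> exists2 d : R, 0 < d &
    forall q, enorm (q - p) < d -> differentiable (H x) q ->
      enorm (grad (H x) q - grad (H x) p) <= e.
Proof.
move=> df e e0.
have [M M0 HM] : exists2 M : R, 0 <= M & forall v, F x v -> enorm v <= M.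
  have [|M M0 HM] := @velocity_ball (enorm x + 1); first by rewrite ltr_wpDl ?enorm_ge0.
  exists M => // v; apply: HM; lra.
have [eta eta0 Heta] := grad_expand df (divr_gt0 e0 (ltr0n R 2)).
pose rho := eta / 2.
have rho0 : 0 < rho by rewrite divr_gt0.
have M1 : 0 < 2 * M + 1 by lra.
exists (e * rho / 2 / (2 * M + 1)); first by rewrite !(divr_gt0, mulr_gt0).
move=> q; rewrite ltr_pdivlMr // => qp dq.
have [Fv vE] := ham_grad_argmax dq.
move: (grad (H x) p) Heta (grad (H x) q) Fv vE => w Heta v Fv vE.
have [->|vw] := eqVneq v w; first by rewrite subrr enorm0 ltW.
have vw0 : 0 < enorm (v - w) by rewrite enorm_gt0 subr_eq0.
pose u := (rho / enorm (v - w)) *: (v - w).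
have uE : enorm u = rho by rewrite enormZ gtr0_norm ?divr_gt0 // divfK ?gt_eqF.
have du z : dotv z u = rho / enorm (v - w) * dotv z (v - w) by rewrite dotvZr.
clearbody u.
have h1 : H x q + dotv v u <= H x (q + u) by rewrite -vE -dotvDr; exact: ham_ge.
have ueta : enorm u < eta by rewrite uE /rho ltr_pdivrMr // mulrDr mulr1 ltrDl.
have := Heta u ueta; rewrite ler_norml uE => /andP[_ h2].
have h3 : H x (q + u) <= H x (p + u) + M * enorm (q - p).
  apply: le_trans (ham_lip_p (q + u) (p + u) HM) _.
  by rewrite lerD2l ler_wpM2l // opprD addrACA subrr addr0.
have h4 : H x p <= H x q + M * enorm (q - p).
  by rewrite (enormB q p); exact: ham_lip_p.
have h5 : dotv (v - w) u <= e * rho.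
  rewrite dotvBl; have := enorm_ge0 (q - p); lra.
move: h5; rewrite du -sqr_enorm expr2 mulrA divfK ?gt_eqF // mulrC ler_pM2r //.
Qed.

(** Euler's identity turns a Lipschitz bound on the gradient in p into one on
    H itself. *)
Lemma ham_lip_x k x y p : differentiable (H x) p -> differentiable (H y) p ->
  enorm (grad (H x) p - grad (H y) p) <= k ->
  H x p - H y p <= k * enorm p.
Proof.
move=> dx dy xy.
have [Fx Ex] := ham_grad_argmax dx; have [Fy Ey] := ham_grad_argmax dy.
move: (grad (H x) p) (grad (H y) p) xy Ex Ey => v w xy <- <-.
rewrite -dotvBl.
apply: le_trans (dotv_le _ _) _; by rewrite ler_wpM2r ?enorm_ge0.
Qed.

End Hamiltonian.

Section SemiconvexSubgradient.
Context {R : realType} {n : nat}.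
Implicit Types (x y z xi h d : 'rV[R]_n) (f : 'rV[R]_n -> R).

Lemma eball_convex r x y (t : R) : eball 0 r x -> eball 0 r y -> 0 <= t <= 1 ->
  eball 0 r (x + t *: (y - x)).
Proof.
rewrite /eball /= !subr0 => xr yr /andP[t0 t1].
have -> : x + t *: (y - x) = (1 - t) *: x + t *: y.
  by apply/rowP => i; rewrite !mxE; ring.
apply: le_trans (enormD _ _) _; rewrite !enormZ (ger0_norm t0) ger0_norm ?subr_ge0 //.
have := ler_wpM2l t0 yr; have t1' : 0 <= 1 - t by lra.
have := ler_wpM2l t1' xr; lra.
Qed.

(** Halving the step repeatedly turns the midpoint inequality into an
    inequality between the difference quotients at scales 2^-j and 1. *)
Lemma midpoint_quotients (g : R -> R) (a : R) : 
  (forall t, 0 <= t <= 1 -> 2 * g (t / 2) <= g 0 + g t + a * t ^+ 2 / 2) ->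
  forall j, g (2^-1 ^+ j) - g 0 + a * (2^-1 ^+ j) ^+ 2
            <= 2^-1 ^+ j * (g 1 - g 0 + a).
Proof.
move=> gm; elim=> [|j ih]; first by rewrite !expr0 mul1r expr1n mulr1.
have t01 : 0 <= (2^-1 : R) ^+ j <= 1.
  by rewrite exprn_ge0 ?invr_ge0 //= exprn_ile1 ?invr_ge0 // invf_le1 // ler1n.
rewrite exprSr; have := gm _ t01; move: ih t01.
by set t := 2^-1 ^+ j => ih t01; lra.
Qed.

(** Adding c / 2 |y - x|^2 makes f midpoint convex along the segment from x to
    y.  The quotient at scale 1 then dominates those at scale 2^-j, which the
    subgradient bounds below in the limit. *)
Lemma semiconvex_subgradient f r c x y xi : 0 <= c ->
  (forall x h, (forall t : R, -1 <= t <= 1 -> eball 0 r (x + t *: h)) ->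
    2 * f x - f (x + h) - f (x - h) <= c * enorm h ^+ 2) ->
  eball 0 r x -> eball 0 r y -> subdiff f x xi ->
  f x + dotv xi (y - x) - c / 2 * enorm (y - x) ^+ 2 <= f y.
Proof.
move=> c0 sc xr yr sx; set d := y - x.
pose g t := f (x + t *: d).
have gm (t : R) : 0 <= t <= 1 ->
    2 * g (t / 2) <= g 0 + g t + (c / 2 * enorm d ^+ 2) * t ^+ 2 / 2.
  move=> /andP[t0 t1].
  have := sc (x + (t / 2) *: d) ((t / 2) *: d).
  have -> : x + (t / 2) *: d + (t / 2) *: d = x + t *: d.
    by apply/rowP => i; rewrite !mxE; field.
  have -> : x + (t / 2) *: d - (t / 2) *: d = x by rewrite addrK.
  have h : forall s : R, -1 <= s <= 1 ->
      eball 0 r (x + (t / 2) *: d + s *: ((t / 2) *: d)).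
    move=> s /andP[s1 s2].
    have -> : x + (t / 2) *: d + s *: ((t / 2) *: d) = x + ((1 + s) * (t / 2)) *: d.
      by apply/rowP => i; rewrite !mxE; field.
    by apply: eball_convex => //; apply/andP; split; nra.
  move=> /(_ h); rewrite enormZ ger0_norm ?divr_ge0 // exprMn /g scale0r addr0.
  by rewrite exprMn exprVn; lra.
have Q := midpoint_quotients gm.
apply/ler_addgt0Pr => e e0.
have d1 : 0 < enorm d + 1 by rewrite ltr_wpDl ?enorm_ge0.
have [eta eta0 Heta] := subdiffW sx (divr_gt0 e0 d1).
have [j Hj] : exists j, (2^-1 : R) ^+ j * (enorm d + 1) < eta.
  have q0 : 0 < eta / (enorm d + 1) by rewrite divr_gt0.
  have [j _ /(_ j (leqnn j))] := near_infty_natSinv_expn_lt (PosNum q0).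
  by rewrite /= div1r -exprVn ltr_pdivlMr //; exists j.
have {Q} := Q j; have t0 : 0 < (2^-1 : R) ^+ j by rewrite exprn_gt0.
move: (2^-1 ^+ j) t0 Hj => t t0 Hj Q.
have := Heta (x + t *: d).
have E : x + t *: d - x = t *: d by rewrite addrC addKr.
rewrite E enormZ (gtr0_norm t0) dotvZr => /(_ _)h.
have td : t * enorm d < eta by apply: le_lt_trans Hj; rewrite ler_pM2l //; lra.
have {h} := h td; rewrite -/(g t) => h.
have xd : g 1 = f y by rewrite /g scale1r /d addrC subrK.
have x0 : g 0 = f x by rewrite /g scale0r addr0.
rewrite xd x0 in Q.
have b : e / (enorm d + 1) * (t * enorm d) <= t * e.
  rewrite mulrCA ler_pM2l // mulrAC ler_pdivrMr // ler_pM2l //; lra.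
have A0 : 0 <= c / 2 * enorm d ^+ 2 * t ^+ 2.
  by rewrite mulr_ge0 ?sqr_ge0 // mulr_ge0 ?sqr_ge0 // divr_ge0.
rewrite -(ler_pM2l t0); lra.
Qed.

End SemiconvexSubgradient.

(** What the control problem provides on the ball of radius r, for an abstract
    Hamiltonian H with argmax selection G.  Keeping H and G abstract separates
    the trajectory estimates from the supremum that defines H.  The constants
    are: k for Lipschitz continuity in x, c for semiconvexity in x (hd_xsub),
    and M for the speed. *)
Record ham_data {R : realType} {n : nat} (F : 'rV[R]_n -> set 'rV[R]_n)
    (H : 'rV[R]_n -> 'rV[R]_n -> R) (G : 'rV[R]_n -> 'rV[R]_n -> 'rV[R]_n)
    (r k c M : R) : Prop := HamData {
  hd_k : 0 <= k;
  hd_c : 0 <= c;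
  hd_M : 0 <= M;
  hd_H0 : forall x, H x 0 = 0;
  hd_nonempty : forall x, F x !=set0;
  hd_convex : forall x u v (t : R), F x u -> F x v -> 0 <= t <= 1 ->
    F x (u + t *: (v - u));
  hd_bound : forall x v, enorm x <= r -> F x v -> enorm v <= M;
  hd_ub : forall x v p, F x v -> dotv v p <= H x p;
  hd_arg : forall x p, enorm x <= r -> p != 0 ->
    F x (G x p) /\ dotv (G x p) p = H x p;
  hd_Glip : forall x y p, enorm x <= r -> enorm y <= r -> p != 0 ->
    enorm (G x p - G y p) <= k * enorm (x - y);
  hd_Gcont : forall x p, enorm x <= r -> p != 0 -> forall e : R, 0 < e ->
    exists2 d : R, 0 < d & forall q, q != 0 -> enorm (q - p) < d ->
      enorm (G x q - G x p) <= e;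
  hd_Hlip : forall x y p, enorm x <= r -> enorm y <= r ->
    H x p - H y p <= k * enorm p * enorm (x - y);
  hd_Hlip_p : forall x p q, enorm x <= r -> H x p <= H x q + M * enorm (p - q);
  hd_xsub : forall x y p xi, enorm x <= r -> enorm y <= r ->
    subdiff (fun z => H z p) x xi ->
    H x p + dotv xi (y - x) - c * enorm p * enorm (y - x) ^+ 2 <= H y p;
  hd_xsub_bound : forall x p xi, enorm x < r ->
    subdiff (fun z => H z p) x xi -> enorm xi <= k * enorm p;
  hd_euler : forall x p v, subdiff (H x) p v -> dotv v p = H x p;
  hd_psub : forall x p v, enorm x <= r -> p != 0 -> subdiff (H x) p v ->
    v = G x p }.

Section HamiltonianData.
Context {R : realType} {n : nat} (F : 'rV[R]_n -> set 'rV[R]_n).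
Hypothesis hSH : assumption_SH F.
Hypothesis hH : assumption_H F.
Implicit Types (x y p q v h xi : 'rV[R]_n).
Local Notation H := (hamiltonian F).

Lemma SH_convex x u v (t : R) : F x u -> F x v -> 0 <= t <= 1 ->
  F x (u + t *: (v - u)).
Proof.
move=> Fu Fv /andP[t0 t1]; have [/(_ x)[_ cF _] _ _] := hSH.
have := cF v u (Itv01 t0 t1) (mem_set Fv) (mem_set Fu) => /set_mem.
suff -> : conv (Itv01 t0 t1) (v : convex_lmodType 'rV[R]_n) u = u + t *: (v - u) by [].
by apply/rowP => i; rewrite !mxE /= /unstable.onem; ring.
Qed.

(** Positive homogeneity carries semiconvexity from the unit sphere to all p,
    with a constant proportional to |p|. *)
Lemma ham_semiconvex r c p : 0 < r -> 0 <= c ->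
  (forall q, enorm q = 1 -> semiconvex_on (eball 0 r) c (fun x => H x q)) ->
  forall x h, (forall t : R, -1 <= t <= 1 -> eball 0 r (x + t *: h)) ->
    2 * H x p - H (x + h) p - H (x - h) p <= c * enorm p * enorm h ^+ 2.
Proof.
move=> r0 c0 Hc x h xh.
have [->|p0] := eqVneq p 0; first by rewrite !ham0 // enorm0 !(mulr0, mul0r) !subr0.
have p1 : 0 < enorm p by rewrite enorm_gt0.
have pE : p = enorm p *: ((enorm p)^-1 *: p).
  by rewrite scalerA mulfV ?scale1r // gt_eqF.
have q1 : enorm ((enorm p)^-1 *: p) = 1.
  by rewrite enormZ gtr0_norm ?invr_gt0 // mulVf // gt_eqF.
have [_ /(_ x h xh) Hq] := Hc _ q1.
rewrite {1 2 3}pE; move: ((enorm p)^-1 *: p) Hq => q /= Hq.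
rewrite !(ham_scale hSH _ _ (ltW p1)); move: (H x q) (H (x + h) q) (H (x - h) q) Hq => a b d Hq.
rewrite -(ler_pM2l p1) in Hq; lra.
Qed.

(** Test the subgradient in its own direction. *)
Lemma subdiff_bound (f : 'rV[R]_n -> R) r (k : R) x xi : 0 <= k -> enorm x < r ->
  (forall y, enorm y <= r -> f y - f x <= k * enorm (y - x)) ->
  subdiff f x xi -> enorm xi <= k.
Proof.
move=> k0 xr fk sx; apply/ler_addgt0Pr => e e0.
have [->|x0] := eqVneq xi 0; first by rewrite enorm0 addr_ge0 // ltW.
have x1 : 0 < enorm xi by rewrite enorm_gt0.
have [d d0 Hd] := subdiffW sx e0.
pose m := Num.min d (r - enorm x).
have m0 : 0 < m by rewrite lt_min d0 subr_gt0.
have [md mr] : m <= d /\ m <= r - enorm x by rewrite /m !ge_min !lexx orbT.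
clearbody m; pose t := m / (2 * enorm xi).
have t0 : 0 < t by rewrite divr_gt0 // mulr_gt0.
have tE : t * enorm xi = m / 2 by rewrite /t; field; rewrite gt_eqF.
clearbody t.
have E : x + t *: xi - x = t *: xi by rewrite addrC addKr.
have nE : enorm (t *: xi) = m / 2 by rewrite enormZ gtr0_norm.
have := Hd (x + t *: xi); rewrite E nE dotvZr -sqr_enorm expr2 mulrA tE => /(_ ltac:(lra)) h1.
have := fk (x + t *: xi); rewrite E nE => /(_ _)h2.
have xr' : enorm (x + t *: xi) <= r.
  by apply: le_trans (enormD _ _) _; rewrite nE; lra.
have {h2} := h2 xr'; move: (f (x + t *: xi)) (f x) h1 => a b h1 h2.
have m2 : 0 < m / 2 by rewrite divr_gt0.
rewrite -(ler_pM2l m2); lra.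
Qed.

Lemma ham_data_ball r : 0 < r -> exists k c M : R,
  ham_data F H (fun x p => grad (H x) p) r k c M.
Proof.
move=> r0; have [[c c0 Hc] [Hd [k0 Hk0]]] := hH r0.
have [M M0 HM] := velocity_ball hSH r0.
pose k : R := `|k0|; have k0' : 0 <= k by exact: normr_ge0.
have Hk p : p != 0 -> forall x y, enorm x <= r -> enorm y <= r ->
    enorm (grad (H x) p - grad (H y) p) <= k * enorm (x - y).
  move=> p0 x y xr yr; have := Hk0 p p0 x y; rewrite /eball /= !subr0.
  move=> /(_ xr yr) /le_trans; apply; rewrite ler_wpM2r ?enorm_ge0 //.
  exact: ler_norm.
have {}Hd x p : enorm x <= r -> p != 0 -> differentiable (H x) p.
  by move=> xr p0; apply: Hd => //; rewrite /eball /= subr0.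
have Hlip x y p : enorm x <= r -> enorm y <= r ->
    H x p - H y p <= k * enorm p * enorm (x - y).
  move=> xr yr; have [->|p0] := eqVneq p 0.
    by rewrite !ham0 // subrr enorm0 mulr0 mul0r.
  rewrite mulrAC; apply: ham_lip_x => //; [exact: Hd|exact: Hd|exact: Hk].
have c20 p : 0 <= c * enorm p by rewrite mulr_ge0 // enorm_ge0.
exists k, c, M; split => //.
- by move=> x; exact: ham0.
- by move=> x; have [/(_ x)[]] := hSH.
- exact: SH_convex.
- by move=> x v p; exact: ham_ge.
- by move=> x p xr p0; apply: ham_grad_argmax => //; exact: Hd.
- by move=> x y p xr yr p0; exact: Hk.
- move=> x p xr p0 e e0.
  have [d d0 H1] := ham_grad_continuous hSH (Hd x p xr p0) e0.
  by exists d => // q q0 qp; apply: H1 => //; exact: Hd.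
- by move=> x p q xr; apply: ham_lip_p => // v; exact: HM.
- move=> x y p xi xr yr sx.
  have xr' : eball 0 r x by rewrite /eball /= subr0.
  have yr' : eball 0 r y by rewrite /eball /= subr0.
  have := semiconvex_subgradient (c20 p) (ham_semiconvex p r0 c0 Hc) xr' yr' sx.
  apply: le_trans; rewrite lerD2l lerN2 ler_wpM2r ?sqr_ge0 //.
  by have := c20 p; lra.
- move=> x p xi xr sx; apply: (subdiff_bound (f := fun z => H z p) _ xr _ sx).
    by rewrite mulr_ge0 // enorm_ge0.
  by move=> y yr; apply: Hlip => //; exact: ltW.
- by move=> x p v; exact: subdiff_ham_euler.
- move=> x p v xr p0 sv; apply: subdiff_grad; first exact: Hd.
  exact: subdiffW.
Qed.

End HamiltonianData.

(** * Ordinary differential equations *)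

Section Picard.
Context {R : realType} {n : nat}.
Implicit Types (a b s t : R) (y z G g : R -> 'rV[R]_n).

(** Continuity measured in the Euclidean norm, in which the Lipschitz bounds
    are given. *)
Definition econt y := forall s (e : R), 0 < e ->
  exists2 d : R, 0 < d & forall t, `|t - s| < d -> enorm (y t - y s) <= e.

Lemma continuousP_eps (g : R -> R) : continuous g <-> forall s (e : R), 0 < e ->
  exists2 d : R, 0 < d & forall t, `|t - s| < d -> `|g t - g s| <= e.
Proof.
split=> H s.
  move=> e e0; have /cvgrPdist_le/(_ e e0)/nbhs_ballP[d /= d0 Hd] := H s.
  exists d => // t ts; rewrite distrC; apply: Hd.
  by rewrite -ball_normE /= distrC.
apply/cvgrPdist_le => e e0; have [d d0 Hd] := H s e e0.
apply/nbhs_ballP; exists d => //= t; rewrite /ball_ /= distrC => ts.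
by rewrite distrC; exact: Hd.
Qed.

Lemma econt_coord y i : econt y -> continuous (fun s => y s 0 i).
Proof.
move=> cy; apply/continuousP_eps => s e e0; have [d d0 H] := cy s e e0.
exists d => // t /H; apply: le_trans.
by have := coord_le_enorm (y t - y s) i; rewrite !mxE.
Qed.

Lemma econt_dotv y (p : 'rV[R]_n) : econt y -> continuous (fun s => dotv p (y s)).
Proof.
move=> cy; apply/continuousP_eps => s e e0.
have p1 : 0 < enorm p + 1 by rewrite ltr_wpDl ?enorm_ge0.
have [d d0 H] := cy s (e / (enorm p + 1)) ltac:(by rewrite divr_gt0).
exists d => // t /H h; rewrite -dotvBr; apply: le_trans (norm_dotv_le _ _) _.
rewrite ler_pdivlMr // in h; apply: le_trans h; rewrite mulrC.
by rewrite ler_wpM2l ?enorm_ge0 //; lra.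
Qed.

(** Project on the direction u of the increment and use monotonicity of
    |u| phi - <u, G>. *)
Lemma mean_value_vec G g (phi dphi : R -> R) a b : a <= b ->
  econt G -> continuous phi ->
  (forall s, a < s < b -> [/\ is_derive s 1 G (g s), is_derive s 1 phi (dphi s) &
     enorm (g s) <= dphi s]) ->
  enorm (G b - G a) <= phi b - phi a.
Proof.
move=> ab cG cphi H; set u := G b - G a.
pose h s := enorm u * phi s - dotv u (G s).
have dh s : a < s < b -> is_derive s 1 h (enorm u * dphi s - dotv u (g s)).
  move=> /H[d1 d2 _].
  have h1 := is_deriveM (is_derive_cst (enorm u : R^o) s 1) d2.
  have h2 := is_derive_dotv (is_derive_cst u s 1) d1.
  apply: (is_derive_eq (is_deriveB h1 h2)).
  by rewrite scaler0 addr0 dotv0l add0r.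
have hab : h a <= h b.
  apply: (@ger0_derive1_le_cc R h a b) => //; rewrite ?in_itv /= ?lexx ?ab //.
  - by move=> s; rewrite in_itv /= => /dh[].
  - move=> s; rewrite in_itv /= => /[dup] /dh[_ e] /H[_ _ gs].
    rewrite derive1E e subr_ge0; apply: le_trans (dotv_le _ _) _.
    by rewrite ler_wpM2l ?enorm_ge0.
  - apply: continuous_subspaceT => s; apply: cvgB; last exact: econt_dotv.
    by apply: cvgM; [exact: cvg_cst|exact: cphi].
have [->|u0] := eqVneq u 0.
  rewrite enorm0.
  have : phi a <= phi b.
    apply: (@ger0_derive1_le_cc R phi a b) => //; rewrite ?in_itv /= ?lexx ?ab //.
    - by move=> s; rewrite in_itv /= => /H[_ []].
    - move=> s; rewrite in_itv /= => /H[_ [_ e] gs].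
      by rewrite derive1E e (le_trans (enorm_ge0 (g s))).
    - exact: continuous_subspaceT.
  by rewrite subr_ge0.
have u1 : 0 < enorm u by rewrite enorm_gt0.
have : enorm u ^+ 2 <= enorm u * (phi b - phi a).
  by rewrite sqr_enorm {2}/u dotvBr; rewrite /h in hab; lra.
by rewrite expr2 ler_pM2l.
Qed.

(** The integral starts at a - 1, so that it is differentiable on both sides
    of a; clamping then makes the primitive continuous on the whole line. *)
Lemma primitive_exists (g : R -> R) a b : a < b -> continuous g ->
  exists G : R -> R, [/\ continuous G, G a = 0 &
    forall s, a < s < b -> is_derive s 1 G (g s)].
Proof.
move=> ab cg.
pose I s : R := (\int[lebesgue_measure]_(t in [set` `[a - 1, s]]) g t)%R.
have dI s : a <= s <= b -> derivable I s 1 /\ derive1 I s = g s.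
  move=> /andP[as_ sb].
  apply: (@continuous_FTC1_closed R g (a - 1) s (b + 1)); last exact: cg.
  - by lra.
  - apply: continuous_compact_integrable; first exact: segment_compact.
    exact: continuous_subspaceT.
  - by lra.
exists (fun s => I (clamp a b s) - I a); split.
- apply/continuousP_eps => s e e0.
  have [dc _] := dI _ (clamp_itv s (ltW ab)).
  have cI : {for clamp a b s, continuous I}.
    by apply: differentiable_continuous; apply/derivable1_diffP.
  have /cvgrPdist_le/(_ e e0)/nbhs_ballP[d /= d0 Hd] := cI.
  exists d => // t ts; rewrite opprB addrA subrK distrC; apply: Hd.
  rewrite -ball_normE /= distrC; apply: le_lt_trans ts; apply: clamp_lip; exact: ltW.
- by rewrite clamp_id ?subrr // lexx ltW.
- move=> s /andP[as_ sb].
  have [dc <-] := dI s ltac:(by rewrite !ltW).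
  have hI : is_derive s 1 (fun t => I t - I a) (derive1 I s).
    have hd : is_derive s 1 I (derive1 I s) by rewrite derive1E; exact: DeriveDef.
    by apply: (is_derive_eq (is_deriveB hd (is_derive_cst (I a : R^o) s 1))); rewrite subr0.
  apply: near_eq_is_derive hI; near=> t; rewrite clamp_id //.
  by apply/andP; split; apply: ltW; near: t; [exact: lt_nbhsr|exact: lt_nbhsl].
Unshelve. all: by end_near. Qed.

Lemma primitive_vec_exists g a b : a < b -> econt g ->
  exists G, [/\ econt G, G a = 0 &
    forall s, a < s < b -> is_derive s 1 G (g s)].
Proof.
move=> ab cg.
have /choice[G HG] : forall i : 'I_n, exists Gi : R -> R, [/\ continuous Gi, Gi a = 0 &
    forall s, a < s < b -> is_derive s 1 Gi (g s 0 i)].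
  by move=> i; apply: primitive_exists => //; exact: econt_coord.
exists (fun s => \row_i G i s); split.
- move=> s e e0.
  have n0 : 0 < n.+1%:R :> R by [].
  have /choice[d Hd] : forall i : 'I_n, exists d : R, 0 < d /\ forall t, `|t - s| < d ->
      `|G i t - G i s| <= e / n.+1%:R.
    move=> i; have [/continuousP_eps/(_ s (e / n.+1%:R))H _ _] := HG i.
    by have [|d d0 Hd] := H; [rewrite divr_gt0|exists d].
  exists (\big[Num.min/1]_i d i).
    by elim/big_ind: _ => // [x y x0 y0|i _]; [rewrite lt_min x0|case: (Hd i)].
  move=> t td; apply: le_trans (@enorm_le_coord _ _ _ (e / n.+1%:R) _) _.
    move=> i; rewrite !mxE; apply: (Hd i).2; apply: lt_le_trans td _.
    exact: bigmin_le_cond.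
  rewrite mulrC -mulrA ger_pMr // mulrC ler_pdivrMr // mul1r ler_nat //.
- by apply/rowP => i; rewrite !mxE; case: (HG i).
- move=> s sab; apply/is_derive_rowP => i.
  have -> : (fun t => (\row_i G i t) 0 i) = G i by apply/funext => t; rewrite mxE.
  by have [_ _ /(_ s sab)] := HG i.
Qed.

(** The intervals of center u_k and radius 2 A 2^-k are nested. *)
Lemma geometric_limit (u : nat -> R) (A : R) :
  (forall k, `|u k.+1 - u k| <= A * 2^-1 ^+ k) ->
  exists l, forall k, `|u k - l| <= 2 * A * 2^-1 ^+ k.
Proof.
move=> H.
have A0 : 0 <= A by have := H 0%N; rewrite expr0 mulr1; apply: le_trans.
have H2 k j : `|u (k + j)%N - u k| <= 2 * A * 2^-1 ^+ k - 2 * A * 2^-1 ^+ (k + j).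
  elim: j => [|j ih]; first by rewrite addn0 !subrr normr0.
  rewrite addnS exprSr; have := H (k + j)%N.
  have := ler_normD (u (k + j).+1 - u (k + j)%N) (u (k + j)%N - u k).
  by rewrite addrA subrK; lra.
have p0 k : 0 <= A * 2^-1 ^+ k by rewrite mulr_ge0 // exprn_ge0.
pose S := [set u k - 2 * A * 2^-1 ^+ k | k in [set: nat]].
have Sub k : ubound S (u k + 2 * A * 2^-1 ^+ k).
  move=> _ [j _ <-]; have [jk|kj] := leqP j k.
    have := H2 j (k - j)%N; rewrite subnKC // ler_norml => /andP[h _].
    by have := p0 j; have := p0 k; lra.
  have := H2 k (j - k)%N; rewrite subnKC ?(ltnW kj) // ler_norml => /andP[_ h].
  by have := p0 j; have := p0 k; lra.
have hS : has_sup S.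
  split; last by exists (u 0%N + 2 * A * 2^-1 ^+ 0).
  by exists (u 0%N - 2 * A * 2^-1 ^+ 0); exists 0%N.
exists (sup S) => k.
have h1 : u k - 2 * A * 2^-1 ^+ k <= sup S.
  by apply: ub_le_sup; [exact: hS.2|exists k].
have h2 : sup S <= u k + 2 * A * 2^-1 ^+ k by apply: ge_sup => //; exact: hS.1.
by rewrite ler_norml; apply/andP; split; lra.
Qed.

End Picard.

Section PicardLindelof.
Context {R : realType} {n : nat}.
Implicit Types (a b s t : R) (y z G g : R -> 'rV[R]_n).

Lemma econtB y z : econt y -> econt z -> econt (fun s => y s - z s).
Proof.
move=> cy cz s e e0; have e2 : 0 < e / 2 by rewrite divr_gt0.
have [d d0 H] := cy s _ e2; have [d' d'0 H'] := cz s _ e2.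
exists (Num.min d d'); first by rewrite lt_min d0.
move=> t; rewrite lt_min => /andP[/H h1 /H' h2].
have -> : y t - z t - (y s - z s) = (y t - y s) - (z t - z s).
  by apply/rowP => i; rewrite !mxE; ring.
by apply: le_trans (enormD _ _) _; rewrite enormN; lra.
Qed.

Lemma econt_bounded y a b : a <= b -> econt y ->
  exists2 C : R, 0 <= C & forall s, a <= s <= b -> enorm (y s) <= C.
Proof.
move=> ab cy.
have cn : continuous (fun s => enorm (y s)).
  apply/continuousP_eps => s e e0; have [d d0 H] := cy s e e0.
  exists d => // t /H ts; rewrite ler_norml; apply/andP; split.
    by have := enormD (y s - y t) (y t); rewrite subrK enormB; lra.
  by have := enormD (y t - y s) (y s); rewrite subrK; lra.
have [c _ Hc] := @EVT_max R _ a b ab (continuous_subspaceT cn).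
by exists (enorm (y c)); [exact: enorm_ge0|move=> s sab; apply: Hc; rewrite in_itv].
Qed.

Lemma econt_comp_lip (f : R -> 'rV[R]_n -> 'rV[R]_n) (K : R) y : 0 <= K ->
  (forall s (x w : 'rV[R]_n), enorm (f s x - f s w) <= K * enorm (x - w)) ->
  (forall x, econt (fun s => f s x)) -> econt y -> econt (fun s => f s (y s)).
Proof.
move=> K0 fK cf cy s e e0; have e2 : 0 < e / 2 by rewrite divr_gt0.
have K1 : 0 < K + 1 by lra.
have [d d0 H] := cf (y s) s _ e2; have [d' d'0 H'] := cy s _ (divr_gt0 e2 K1).
exists (Num.min d d'); first by rewrite lt_min d0.
move=> t; rewrite lt_min => /andP[/H h1 /H' h2].
apply: le_trans (enorm_triangle _ (f t (y s)) _) _.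
have h3 := fK t (y t) (y s).
rewrite ler_pdivlMr // in h2.
have := enorm_ge0 (y t - y s); lra.
Qed.

Lemma le0_of_geometric (q C : R) : (forall k, q <= C * 2^-1 ^+ k) -> q <= 0.
Proof.
move=> H; rewrite leNgt; apply/negP => q0.
have C0 : 0 < C by have := H 0%N; rewrite expr0 mulr1; apply: lt_le_trans.
have [j _ /(_ j (leqnn j))] := near_infty_natSinv_expn_lt (PosNum (divr_gt0 q0 C0)).
rewrite /= div1r -exprVn ltr_pdivlMr // mulrC => h; have := H j; lra.
Qed.

(** Picard iteration for a globally Lipschitz right-hand side.  Weighted by
    exp (2 K s), each iterate is at most half as far from the next one, so the
    iterates converge geometrically on the whole segment. *)
Lemma picard (f : R -> 'rV[R]_n -> 'rV[R]_n) (K a b : R) (y0 : 'rV[R]_n) :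
  a < b -> 0 <= K ->
  (forall s (x w : 'rV[R]_n), enorm (f s x - f s w) <= K * enorm (x - w)) ->
  (forall x, econt (fun s => f s x)) ->
  exists y, [/\ econt y, y a = y0 &
    forall s, a < s < b -> is_derive s 1 y (f s (y s))].
Proof.
move=> ab K0 fK cf; have ab' := ltW ab.
have cfy y := econt_comp_lip (y := y) K0 fK cf.
have /choice[Phi HPhi] : forall y, exists z, econt y -> [/\ econt z, z a = y0 &
    forall s, a < s < b -> is_derive s 1 z (f s (y s))].
  move=> y; have [cy|ncy] := pselect (econt y); last by exists y.
  have [G [cG Ga dG]] := primitive_vec_exists ab (cfy y cy).
  exists (fun s => G s - - y0) => _; split.
  - by apply: econtB => // s e e0; exists 1 => // t _; rewrite subrr enorm0 ltW.
  - by rewrite Ga sub0r opprK.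
  - move=> s sab.
    apply: (is_derive_eq (is_deriveB (dG s sab) (is_derive_cst (- y0) s 1))).
    by rewrite subr0.
pose Y k := iter k Phi (fun=> y0).
have cY k : econt (Y k).
  elim: k => [|k ih] /=; last by have [] := HPhi _ ih.
  by move=> s e e0; exists 1 => // t _; rewrite subrr enorm0 ltW.
have dPhi y z (A : R) : econt y -> econt z -> 0 <= A ->
    (forall t, a <= t <= b -> enorm (y t - z t) <= A * expR (2 * K * t)) ->
    forall s, a <= s <= b ->
      enorm (Phi y s - Phi z s) <= A / 2 * expR (2 * K * s).
  move=> cy cz A0 yz s /andP[as_ sb].
  have [cPy Pya dPy] := HPhi y cy; have [cPz Pza dPz] := HPhi z cz.
  have := @mean_value_vec R n (fun t => Phi y t - Phi z t)
    (fun t => f t (y t) - f t (z t)) (fun t => A / 2 * expR (2 * K * t))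
    (fun t => A / 2 * (2 * K * expR (2 * K * t))) a s as_ (econtB cPy cPz).
  rewrite Pya Pza subrr subr0 => /(_ _ _)h.
  apply: le_trans (h _ _) _.
  - move=> t; apply: cvgM; first exact: cvg_cst.
    have [dt _] := is_derive_expRM (2 * K) t.
    have dft : differentiable (fun t => expR (2 * K * t)) t by apply/derivable1_diffP.
    exact: (differentiable_continuous dft).
  - move=> t /andP[at_ ts].
    have tab : a < t < b by rewrite at_ (lt_le_trans ts sb).
    split; first exact: (is_deriveB (dPy t tab) (dPz t tab)).
      have h1 := is_deriveM (is_derive_cst (A / 2 : R^o) t 1) (is_derive_expRM (2 * K) t).
      by apply: (is_derive_eq h1); rewrite scaler0 addr0.
    apply: le_trans (fK _ _ _) _.
    have -> : A / 2 * (2 * K * expR (2 * K * t)) = K * (A * expR (2 * K * t)) by field.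
    rewrite ler_wpM2l // yz //; case/andP: tab => h1 h2; by rewrite !ltW.
  - by rewrite gerBl mulr_ge0 ?expR_ge0 // divr_ge0.
have [C C0 HC] : exists2 C : R, 0 <= C & forall s, a <= s <= b ->
    enorm (Y 1%N s - Y 0%N s) <= C.
  exact: (econt_bounded ab' (econtB (cY 1%N) (cY 0%N))).
pose A := C * expR (- (2 * K * a)).
have A0 : 0 <= A by rewrite mulr_ge0 // expR_ge0.
have D k s : a <= s <= b ->
    enorm (Y k.+1 s - Y k s) <= A * 2^-1 ^+ k * expR (2 * K * s).
  elim: k s => [|k ih] s sab.
    apply: le_trans (HC s sab) _; rewrite expr0 mulr1 /A -mulrA -expRD.
    rewrite ler_peMr // -expR0 ler_expR addrC subr_ge0 ler_wpM2l ?mulr_ge0 //.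
    by case/andP: sab.
  rewrite exprSr mulrA; apply: (dPhi (Y k.+1) (Y k) (A * 2^-1 ^+ k)).
  - exact: (cY k.+1).
  - exact: cY.
  - by rewrite mulr_ge0 // exprn_ge0.
  - exact: ih.
  - exact: sab.
pose B := A * expR (2 * K * b).
have B0 : 0 <= B by rewrite mulr_ge0 // expR_ge0.
have D' k s i : `|Y k.+1 (clamp a b s) 0 i - Y k (clamp a b s) 0 i| <= B * 2^-1 ^+ k.
  have sab := clamp_itv s ab'.
  have := coord_le_enorm (Y k.+1 (clamp a b s) - Y k (clamp a b s)) i.
  rewrite !mxE => /le_trans; apply; apply: le_trans (D k _ sab) _.
  rewrite /B mulrAC ler_wpM2r ?exprn_ge0 // ler_wpM2l // ler_expR.
  by rewrite ler_wpM2l ?mulr_ge0 //; case/andP: sab.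
have /choice[l Hl] : forall si : R * 'I_n, exists l, forall k,
    `|Y k (clamp a b si.1) 0 si.2 - l| <= 2 * B * 2^-1 ^+ k.
  by move=> [s i] /=; apply: (@geometric_limit R (fun k => Y k (clamp a b s) 0 i)).
pose y s := \row_i l (s, i).
pose E := n%:R * (2 * B).
have yE k s : enorm (Y k (clamp a b s) - y s) <= E * 2^-1 ^+ k.
  rewrite /E -mulrA; apply: enorm_le_coord => i; rewrite !mxE.
  exact: (Hl (s, i) k).
have cy : econt y.
  move=> s e e0.
  have [k Hk] : exists k, E * 2^-1 ^+ k <= e / 3.
    apply: contrapT => h; have : e / 3 <= 0.
      apply: (@le0_of_geometric _ E) => k; rewrite leNgt; apply/negP => h2.
      by apply: h; exists k; exact: ltW.
    by lra.
  have [d d0 Hd] := cY k (clamp a b s) (e / 3) ltac:(by rewrite divr_gt0).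
  exists d => // t ts.
  have h1 := yE k s; have h2 := yE k t.
  have h3 := Hd (clamp a b t) (le_lt_trans (clamp_lip _ _ ab') ts).
  have h4 := enorm_triangle (y t) (Y k (clamp a b t)) (y s).
  have h5 := enorm_triangle (Y k (clamp a b t)) (Y k (clamp a b s)) (y s).
  rewrite (enormB (y t) (Y k _)) in h4; lra.
have [cPy Pya dPy] := HPhi y cy.
have Pyy s : a <= s <= b -> Phi y s = y s.
  move=> sab; apply/eqP; rewrite -subr_eq0 -enorm_eq0 eq_le enorm_ge0 andbT.
  pose E' := E * expR (- (2 * K * a)).
  apply: (@le0_of_geometric _ (E' / 2 * expR (2 * K * s) + E / 2)) => k.
  apply: le_trans (enorm_triangle _ (Y k.+1 s) _) _.
  have h1 := yE k.+1 s; rewrite clamp_id // exprSr in h1.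
  have : enorm (Phi y s - Y k.+1 s) <= E' * 2^-1 ^+ k / 2 * expR (2 * K * s).
    apply: (dPhi y (Y k)); [exact: cy|exact: cY| | |exact: sab].
      by rewrite mulr_ge0 ?exprn_ge0 // mulr_ge0 ?expR_ge0 // mulr_ge0 // mulr_ge0.
    move=> t tab; have := yE k t; rewrite clamp_id // enormB => /le_trans; apply.
    have -> : E' * 2^-1 ^+ k * expR (2 * K * t) =
        E * 2^-1 ^+ k * expR (- (2 * K * a) + 2 * K * t).
      by rewrite expRD /E'; ring.
    rewrite ler_peMr //.
      by rewrite mulr_ge0 ?exprn_ge0 // mulr_ge0 // mulr_ge0.
    rewrite -expR0 ler_expR addrC subr_ge0 ler_wpM2l ?mulr_ge0 //.
    by case/andP: tab.
  by lra.
exists (Phi y); split => // s sab; rewrite Pyy; first exact: dPy.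
by case/andP: sab => h1 h2; rewrite !ltW.
Qed.

End PicardLindelof.

(** * Trajectories and truncated flows *)

Section Trajectories.
Context {R : realType} {n : nat} (F : 'rV[R]_n -> set 'rV[R]_n).
Implicit Types (a b c s t : R) (x y z : R -> 'rV[R]_n).

Definition traj a b y : Prop :=
  is_arc a b y /\ ae_deriv a b y (fun s d => F (y s) d).

(** Trajectories enter the value function only through their endpoints, and
    concatenation is the transitivity of this relation. *)
Definition joined a (ya : 'rV[R]_n) b (yb : 'rV[R]_n) : Prop :=
  exists y, [/\ traj a b y, y a = ya & y b = yb].

Lemma traj_sub a b a' b' y : a <= a' -> b' <= b -> traj a b y -> traj a' b' y.
Proof.
by move=> aa bb [h1 h2]; split; [exact: is_arc_sub h1|exact: ae_deriv_sub h2].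
Qed.

Lemma ae_deriv_interior a b y (P : R -> 'rV[R]_n -> Prop) :
  (forall s, a < s < b -> exists2 d, is_derive s 1 y d & P s d) ->
  ae_deriv a b y P.
Proof.
move=> H; apply: (ae_imp (ae_and (ae_neq a) (ae_neq b))) => s [sa sb].
rewrite in_itv /= => /andP[as_ sb'].
have [|d [dy e] Pd] := H s.
  by rewrite !lt_neqAle as_ sb' !andbT; apply/andP; split; apply/eqP => // e; exact: sa.
by split => //; rewrite derive1E e.
Qed.

Lemma traj_point a y : traj a a y.
Proof.
split; last by apply: ae_deriv_interior => s /andP[h1 /(lt_trans h1)]; rewrite ltxx.
apply: (is_arc_lip ler01) => u v au uv va.
have -> : u = v by apply/eqP; rewrite eq_le uv (le_trans va au).
by rewrite !subrr enorm0 mulr0.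
Qed.

Lemma traj_concat a b c x y : a <= b -> b <= c -> x b = y b ->
  traj a b x -> traj b c y -> traj a c (fun s => if s <= b then x s else y s).
Proof.
move=> ab bc xy [h1 h2] [h3 h4]; split; first exact: is_arc_concat.
exact: (ae_deriv_concat (G := fun _ => F)).
Qed.

Lemma joined_refl a ya : joined a ya a ya.
Proof. by exists (fun=> ya); split => //; exact: traj_point. Qed.

Lemma joined_trans a ya b yb c yc : a <= b -> b <= c ->
  joined a ya b yb -> joined b yb c yc -> joined a ya c yc.
Proof.
move=> ab bc [x [hx xa xb]] [y [hy ya' yb']].
exists (fun s => if s <= b then x s else y s); split.
- by apply: traj_concat => //; rewrite xb.
- by rewrite ab.
- have [cb|//] := leP c b.
  have e : b = c by apply/eqP; rewrite eq_le bc.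
  by rewrite -e xb -ya' -yb' e.
Qed.

Lemma traj_joined a b y : traj a b y -> joined a (y a) b (y b).
Proof. by exists y. Qed.

Lemma traj_lip a b M y : a <= b -> traj a b y ->
  (forall s, a <= s <= b -> forall v, F (y s) v -> enorm v <= M) ->
  forall u v, a <= u -> u <= v -> v <= b -> enorm (y v - y u) <= M * (v - u).
Proof.
move=> ab ty HM u v au uv vb; have [hy dy] := traj_sub au vb ty.
apply: (arc_lip uv hy); apply: ae_derivW dy => s d /andP[us sv] _.
by apply: HM; rewrite (le_trans au us) (le_trans sv vb).
Qed.

End Trajectories.

Section TruncatedFlow.
Context {R : realType} {n : nat}.
Implicit Types (a b s t rho : R) (x z : 'rV[R]_n) (y : R -> 'rV[R]_n).

(** Composing with this truncation makes a field that is Lipschitz on a ball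
    globally Lipschitz: componentwise clamping is nonexpansive and its image,
    a cube, lies in the ball of radius n rho. *)
Definition clampv rho x : 'rV[R]_n := \row_i clamp (- rho) rho (x 0 i).

Lemma enorm_mono x z : (forall i, `|x 0 i| <= `|z 0 i|) -> enorm x <= enorm z.
Proof.
move=> xz; rewrite ler_sqrt ?dotvv_ge0 //; apply: ler_sum => i _.
rewrite -!expr2 -(real_normK (num_real (x 0 i))) -(real_normK (num_real (z 0 i))).
by rewrite ler_sqr ?nnegrE.
Qed.

Lemma clampv_lip rho x z : 0 <= rho ->
  enorm (clampv rho x - clampv rho z) <= enorm (x - z).
Proof.
move=> r0; apply: enorm_mono => i; rewrite !mxE; apply: clamp_lip; lra.
Qed.

Lemma clampv_id rho x : enorm x <= rho -> clampv rho x = x.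
Proof.
move=> xr; apply/rowP => i; rewrite mxE clamp_id //.
by have := le_trans (coord_le_enorm x i) xr; rewrite ler_norml.
Qed.

Lemma clampv_ball rho x : 0 <= rho -> enorm (clampv rho x) <= n.+1%:R * rho.
Proof.
move=> r0; apply: (@le_trans _ _ (n%:R * rho)).
  apply: enorm_le_coord => i; rewrite mxE ler_norml; apply: clamp_itv; lra.
by rewrite ler_wpM2r // ler_nat.
Qed.

Variables (F : 'rV[R]_n -> set 'rV[R]_n) (rho k M : R)
  (g : R -> 'rV[R]_n -> 'rV[R]_n).
Hypotheses (rho0 : 0 <= rho) (k0 : 0 <= k).
Let r := n.+1%:R * rho.
Hypothesis HM : forall x v, enorm x <= r -> F x v -> enorm v <= M.
Hypothesis gF : forall s x, enorm x <= r -> F x (g s x).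
Hypothesis gk : forall s x z, enorm x <= r -> enorm z <= r ->
  enorm (g s x - g s z) <= k * enorm (x - z).
Hypothesis gc : forall x, enorm x <= r -> econt (fun s => g s x).

(** A solution of the truncated equation is a trajectory of F as long as it
    stays in the ball of radius rho (flow_line_traj). *)
Definition flow_line a b y : Prop :=
  (exists2 L : R, 0 <= L & forall u v, a <= u -> u <= v -> v <= b ->
     enorm (y v - y u) <= L * (v - u)) /\
  (forall s, a < s < b -> is_derive s 1 y (g s (clampv rho (y s)))).

Lemma flow_forward a b x : a <= b -> exists2 y, flow_line a b y & y a = x.
Proof.
rewrite le_eqVlt => /orP[/eqP <-|ab].
  exists (fun=> x) => //; split.
    by exists 0 => // u v *; rewrite subrr enorm0 mul0r.
  by move=> s /andP[h1 /(lt_trans h1)]; rewrite ltxx.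
have [|x' cx|y [cy ya dy]] := @picard R n (fun s x => g s (clampv rho x)) k a b x ab k0.
- move=> s x1 x2; apply: le_trans (gk _ _ _) _; try exact: clampv_ball.
  by rewrite ler_wpM2l // clampv_lip.
- by apply: gc; exact: clampv_ball.
exists y => //; split => //.
exists (Num.max M 0); first by rewrite le_max lexx orbT.
move=> u v au uv vb; rewrite mulrBr.
apply: (mean_value_vec (g := fun s => g s (clampv rho (y s)))
  (phi := fun s => Num.max M 0 * s) (dphi := fun=> Num.max M 0) uv cy).
  move=> s; apply: cvgM; [exact: cvg_cst|exact: cvg_id].
move=> s /andP[us sv]; split.
- by apply: dy; rewrite (le_lt_trans au us) (lt_le_trans sv vb).
- have h := is_deriveM (is_derive_cst (Num.max M 0 : R^o) s 1) (is_derive_id s (1 : R^o)).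
  by apply: (is_derive_eq h); rewrite scaler0 addr0 [LHS]mulr1.
- rewrite le_max (HM (x := clampv rho (y s))) //; first exact: clampv_ball.
  by apply: gF; exact: clampv_ball.
Qed.

Lemma flow_line_arc a b y : flow_line a b y -> is_arc a b y.
Proof. by move=> [[L L0 HL] _]; exact: is_arc_lip HL. Qed.

Lemma flow_line_traj a b y : flow_line a b y ->
  (forall s, a <= s <= b -> enorm (y s) <= rho) -> traj F a b y.
Proof.
move=> fy yr; split; first exact: flow_line_arc fy.
have [_ dy] := fy; apply: ae_deriv_interior => s sab.
have ys : enorm (y s) <= rho by apply: yr; case/andP: sab => h1 h2; rewrite !ltW.
have := dy s sab; rewrite clampv_id // => d; exists (g s (y s)) => //.
apply: gF; apply: le_trans ys _; rewrite /r -natr1 mulrDl mul1r lerDr mulr_ge0 //.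
Qed.

Lemma flow_line_ae a b y : flow_line a b y ->
  ae_deriv a b y (fun s d => d = g s (clampv rho (y s))).
Proof.
by move=> [_ dy]; apply: ae_deriv_interior => s /dy d; exists (g s (clampv rho (y s))).
Qed.

End TruncatedFlow.

Section BackwardFlow.
Context {R : realType} {n : nat}.
Implicit Types (a b s t rho : R) (x z : 'rV[R]_n) (y : R -> 'rV[R]_n).

Lemma is_derive_reverse (c : R) y s d : is_derive (c - s) 1 y d ->
  is_derive s 1 (fun t => y (c - t)) (- d).
Proof.
move=> /is_derive_rowP dy; apply/is_derive_rowP => i.
have h : is_derive s 1 (fun t : R => c - t) (-1).
  have h1 := is_deriveB (is_derive_cst (c : R^o) s 1) (is_derive_id s (1 : R^o)).
  by apply: (is_derive_eq h1); rewrite sub0r.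
have hc := is_derive1_comp (f := fun t => y t 0 i) (g := fun t => c - t) (dy i) h.
apply: (is_derive_eq hc).
by rewrite mxE mulrN1.
Qed.

(** Reverse time: the reflected field - g(a + b - s, .) takes its values in
    - F. *)
Lemma flow_backward (F : 'rV[R]_n -> set 'rV[R]_n) rho k M g a b x :
  0 <= rho -> 0 <= k ->
  (forall x v, enorm x <= n.+1%:R * rho -> F x v -> enorm v <= M) ->
  (forall s x, enorm x <= n.+1%:R * rho -> F x (g s x)) ->
  (forall s x z, enorm x <= n.+1%:R * rho -> enorm z <= n.+1%:R * rho ->
     enorm (g s x - g s z) <= k * enorm (x - z)) ->
  (forall x, enorm x <= n.+1%:R * rho -> econt (fun s => g s x)) ->
  a <= b -> exists2 y, flow_line rho g a b y & y b = x.
Proof.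
move=> rho0 k0 HM gF gk gc ab.
have [||||z [[L L0 HL] dz] za] := @flow_forward R n (fun x => [set - v | v in F x]) rho k M
  (fun s x => - g (a + b - s) x) rho0 k0 _ _ _ _ a b x ab.
- by move=> x1 _ xr [v Fv <-]; rewrite enormN; exact: (HM _ _ xr Fv).
- by move=> s x1 xr; exists (g (a + b - s) x1) => //; exact: gF.
- by move=> s x1 x2 h1 h2; rewrite -opprD enormN; exact: gk.
- move=> x1 xr s e e0; have [d d0 H] := gc x1 xr (a + b - s) e e0.
  exists d => // t ts; rewrite -opprD enormN; apply: H.
  by rewrite (_ : _ - _ = - (t - s)) ?normrN //; ring.
exists (fun s => z (a + b - s)); last by rewrite addrK.
split.
  exists L => // u v au uv vb; rewrite enormB.
  apply: le_trans (HL _ _ _ _ _) _; [lra|lra|lra|].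
  by rewrite le_eqVlt; apply/orP; left; apply/eqP; ring.
move=> s /andP[as_ sb].
have d := dz (a + b - s) ltac:(by apply/andP; split; lra).
apply: (is_derive_eq (is_derive_reverse d)).
by rewrite opprK (_ : a + b - (a + b - s) = s) //; ring.
Qed.

End BackwardFlow.

(** * Lipschitz selections of the velocity map *)

Section Selections.
Context {R : realType} {n : nat} (F : 'rV[R]_n -> set 'rV[R]_n)
  (H : 'rV[R]_n -> 'rV[R]_n -> R) (G : 'rV[R]_n -> 'rV[R]_n -> 'rV[R]_n).
Variables (rho k c M : R).
Hypothesis rho0 : 0 < rho.
Let r := n.+1%:R * rho.
Hypothesis hd : ham_data F H G r k c M.
Implicit Types (x w p : 'rV[R]_n) (g : 'rV[R]_n -> 'rV[R]_n).

(** Lipschitz selections of F on the ball, with the Lipschitz constant of the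
    gradients G(., p).  They form a convex set. *)
Definition selection g : Prop :=
  (forall x, enorm x <= r -> F x (g x)) /\
  (forall x z, enorm x <= r -> enorm z <= r ->
     enorm (g x - g z) <= k * enorm (x - z)).

Lemma selection_arg p : p != 0 -> selection (G ^~ p).
Proof.
move=> p0; split; first by move=> x xr; have [] := hd_arg hd xr p0.
by move=> x z xr zr; exact: (hd_Glip hd).
Qed.

Lemma selection_convex g1 g2 (t : R) : 0 <= t <= 1 -> selection g1 ->
  selection g2 -> selection (fun x => g1 x + t *: (g2 x - g1 x)).
Proof.
move=> /[dup] t01 /andP[t0 t1] [F1 L1] [F2 L2]; split.
  by move=> x xr; apply: (hd_convex hd) => //; [exact: F1|exact: F2].
move=> x z xr zr.
have -> : g1 x + t *: (g2 x - g1 x) - (g1 z + t *: (g2 z - g1 z)) =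
    (1 - t) *: (g1 x - g1 z) + t *: (g2 x - g2 z).
  by apply/rowP => i; rewrite !mxE; ring.
apply: le_trans (enormD _ _) _; rewrite !enormZ (ger0_norm t0) ger0_norm ?subr_ge0 //.
have h1 := ler_wpM2l t0 (L2 x z xr zr).
have t1' : 0 <= 1 - t by rewrite subr_ge0.
have h2 := ler_wpM2l t1' (L1 x z xr zr).
lra.
Qed.

Lemma selection_exists : exists g, selection g.
Proof.
have [[p p0]|Np] := pselect (exists p : 'rV[R]_n, p != 0).
  by exists (G ^~ p); exact: selection_arg.
have all0 p : p = 0 by apply/eqP/negPn/negP => p0; apply: Np; exists p.
exists (fun=> 0); split.
  by move=> x _; have [v Fv] := hd_nonempty hd x; rewrite -(all0 v).
by move=> x z _ _; rewrite (all0 (x - z)) subrr enorm0 mulr0.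
Qed.

Lemma selection_max p : exists2 g, selection g &
  forall x, enorm x <= r -> dotv (g x) p = H x p.
Proof.
have [->|p0] := eqVneq p 0.
  have [g sg] := selection_exists; exists g => // x _.
  by rewrite dotv0r (hd_H0 hd).
exists (G ^~ p); first exact: selection_arg.
by move=> x xr; have [] := hd_arg hd xr p0.
Qed.

(** Frank-Wolfe descent: if g(x0) is farther than e from w, moving from
    g towards the selection that maximizes the pairing with w - g(x0)
    decreases the distance by a definite amount. *)
Lemma selection_approx x0 w (e d : R) : enorm x0 <= r -> 0 <= e -> 0 < d ->
  (forall p, dotv w p <= H x0 p + e * enorm p) ->
  exists2 g, selection g & enorm (g x0 - w) <= e + d.
Proof.
move=> xr e0 d0 Hw; apply: contrapT => Ng.
have far g : selection g -> e + d < enorm (w - g x0).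
  move=> sg; rewrite ltNge; apply/negP => h; apply: Ng.
  by exists g => //; rewrite enormB.
pose S := [set enorm (w - g x0) ^+ 2 | g in selection].
have [g0 sg0] := selection_exists.
have hS : has_inf S.
  split; first by exists (enorm (w - g0 x0) ^+ 2), g0.
  by exists 0 => _ [g _ <-]; exact: sqr_ge0.
have D1 : 0 < 4 * M ^+ 2 + d ^+ 2.
  by rewrite ltr_wpDl ?exprn_gt0 // mulr_ge0 // sqr_ge0.
pose t := d ^+ 2 / (4 * M ^+ 2 + d ^+ 2).
have t0 : 0 < t by rewrite divr_gt0 // exprn_gt0.
have tM : t * (4 * M ^+ 2 + d ^+ 2) = d ^+ 2 by rewrite divfK // gt_eqF.
have t1 : t <= 1.
  by rewrite ler_pdivrMr // mul1r lerDr mulr_ge0 // sqr_ge0.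
have td0 : 0 < t * d ^+ 2 by rewrite mulr_gt0 // exprn_gt0.
have [_ [g sg <-] gS] := inf_adherent td0 hS.
set p := w - g x0 in gS.
have pd : e + d < enorm p by exact: far.
have p0 : p != 0 by rewrite -enorm_gt0; lra.
have t01 : 0 <= t <= 1 by rewrite ltW.
have sg2 := selection_convex t01 sg (selection_arg p0).
have : inf S <= enorm (w - (g x0 + t *: (G x0 p - g x0))) ^+ 2.
  by apply: ge_inf; [exact: hS.2|exists (fun x => g x + t *: (G x p - g x))].
rewrite opprD addrA -/p; set q := G x0 p - g x0.
have [Fq Eq] := hd_arg hd xr p0.
have pq : enorm p * (enorm p - e) <= dotv p q.
  have := Hw p; rewrite -Eq (dotvC p) /q dotvBl => h.
  have : enorm p ^+ 2 = dotv w p - dotv (g x0) p by rewrite sqr_enorm {1}/p dotvBl.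
  by rewrite expr2; lra.
have q2M : enorm q <= 2 * M.
  apply: le_trans (enormD _ _) _; rewrite enormN.
  have := hd_bound hd xr Fq; have := hd_bound hd xr (sg.1 x0 xr); lra.
clearbody q; clearbody p.
have -> : enorm (p - t *: q) ^+ 2 =
    enorm p ^+ 2 - 2 * t * dotv p q + t ^+ 2 * enorm q ^+ 2.
  by rewrite !sqr_enorm dotvBl !dotvBr !dotvZr !dotvZl (dotvC q p); ring.
have qq : enorm q ^+ 2 <= 4 * M ^+ 2.
  have -> : 4 * M ^+ 2 = (2 * M) ^+ 2 by ring.
  by rewrite ler_sqr ?nnegrE ?enorm_ge0 // (le_trans (enorm_ge0 q)).
have pp : d ^+ 2 <= enorm p * (enorm p - e).
  by rewrite expr2 ler_pM //; lra.
have h3 : t ^+ 2 * enorm q ^+ 2 <= t * d ^+ 2.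
  rewrite expr2 -mulrA ler_pM2l // -tM ler_pM2l //.
  by apply: le_trans qq _; rewrite lerDl sqr_ge0.
have h4 := ler_wpM2l (ltW t0) (le_trans pp pq).
move: gS; clearbody t; lra.
Qed.

(** The bound on |x| + M (b - a) keeps the solution in the ball where the
    truncation is the identity. *)
Lemma selection_flow g x a b (dir : bool) : selection g -> a <= b ->
  enorm x + M * (b - a) <= rho ->
  exists y, [/\ traj F a b y, (if dir then y a = x else y b = x),
    forall s, a <= s <= b -> enorm (y s - x) <= M * (b - a) /\ enorm (y s) <= rho &
    ae_deriv a b y (fun s d => d = g (y s))].
Proof.
move=> [gF gk] ab xab.
have k0 := hd_k hd; have M0 := hd_M hd.
have HM x' v : enorm x' <= r -> F x' v -> enorm v <= M by exact: (hd_bound hd).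
have gc x' : enorm x' <= r -> econt (fun _ : R => g x').
  by move=> _ s e e0; exists 1 => // t _; rewrite subrr enorm0 ltW.
have [y fy yx] : exists2 y, flow_line rho (fun=> g) a b y &
    (if dir then y a = x else y b = x).
  case: dir; first exact: (flow_forward (ltW rho0) k0 HM (fun=> gF) (fun=> gk) gc x ab).
  exact: (flow_backward x (ltW rho0) k0 HM (fun=> gF) (fun=> gk) gc ab).
have fa := flow_line_ae fy; have hy := flow_line_arc fy.
have lipy u v : a <= u -> u <= v -> v <= b -> enorm (y v - y u) <= M * (v - u).
  move=> au uv vb; apply: arc_lip => //; first exact: is_arc_sub hy.
  apply: ae_derivW (ae_deriv_sub au vb fa) => s d _ _ ->.
  have cr := clampv_ball (y s) (ltW rho0).
  exact: (HM _ _ cr (gF _ cr)).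
have yx' s : a <= s <= b -> enorm (y s - x) <= M * (b - a).
  move=> /andP[as_ sb]; case: dir yx => <-.
    by apply: le_trans (lipy a s _ _ _) _ => //; rewrite ler_wpM2l //; lra.
  rewrite enormB.
  by apply: le_trans (lipy s b _ _ _) _ => //; rewrite ler_wpM2l //; lra.
have yr s : a <= s <= b -> enorm (y s) <= rho.
  by move=> /yx' h; have := enormD (y s - x) x; rewrite subrK; lra.
exists y; split => //.
- exact: (flow_line_traj (ltW rho0) (fun=> gF) fy yr).
- by move=> s sab; split; [exact: yx'|exact: yr].
- by apply: ae_derivW fa => s d sab _ ->; rewrite clampv_id // yr.
Qed.

End Selections.

(** * Tracking a trajectory *)

Section Filippov.
Context {R : realType} {n : nat} (F : 'rV[R]_n -> set 'rV[R]_n)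
  (H : 'rV[R]_n -> 'rV[R]_n -> R) (G : 'rV[R]_n -> 'rV[R]_n -> 'rV[R]_n).
Variables (rho k c M : R).
Hypothesis rho0 : 0 < rho.
Let r := n.+1%:R * rho.
Hypothesis hd : ham_data F H G r k c M.
Implicit Types (x y w p : 'rV[R]_n).

Lemma rho_le_r x : enorm x <= rho -> enorm x <= r.
Proof.
move=> /le_trans; apply.
by rewrite /r -natr1 mulrDl mul1r lerDr mulr_ge0 // ltW.
Qed.

(** The direction dir of time is a parameter, so that one Euler scheme serves
    for both: forward in time when dir is true, backward otherwise. *)
Definition joined_dir (dir : bool) s1 y1 s2 y2 : Prop :=
  if dir then joined F s1 y1 s2 y2 else joined F s2 y2 s1 y1.

(** The mean velocity of xb need not belong to F(xb(s)), but its pairings are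
    averages of pairings with velocities at nearby states. *)
Lemma mean_velocity_ham a b xb s : a < b -> traj F a b xb ->
  (forall s, a <= s <= b -> enorm (xb s) <= rho) -> a <= s <= b ->
  forall p, dotv ((b - a)^-1 *: (xb b - xb a)) p <=
            H (xb s) p + k * M * (b - a) * enorm p.
Proof.
move=> ab tx xr sab p.
have ba : 0 < b - a by rewrite subr_gt0.
have HMx t : a <= t <= b -> forall v, F (xb t) v -> enorm v <= M.
  by move=> tab v; apply: (hd_bound hd); apply: rho_le_r; exact: xr.
have lipx := traj_lip (ltW ab) tx HMx.
have h : dotv p (xb b - xb a) <=
    (H (xb s) p + k * M * (b - a) * enorm p) * (b - a).
  apply: arc_dotv_le (ltW ab) tx.1 _; apply: ae_derivW tx.2 => t d tab _ Fd.
  rewrite dotvC; apply: le_trans (hd_ub hd p Fd) _.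
  have h1 := hd_Hlip hd p (rho_le_r (xr t tab)) (rho_le_r (xr s sab)).
  have h2 : enorm (xb t - xb s) <= M * (b - a).
    move: tab sab => /andP[at_ tb] /andP[as_ sb].
    have M0 := hd_M hd; have [ts|/ltW st] := leP t s.
      rewrite enormB; apply: le_trans (lipx t s at_ ts sb) _.
      by rewrite ler_wpM2l //; lra.
    apply: le_trans (lipx s t as_ st tb) _; by rewrite ler_wpM2l //; lra.
  have kp : 0 <= k * enorm p by rewrite mulr_ge0 ?(hd_k hd) ?enorm_ge0.
  have := ler_wpM2l kp h2; lra.
by rewrite dotvC dotvZr mulrC ler_pdivrMr.
Qed.

(** One step of the Euler scheme that tracks the trajectory xb: on a short
    interval, follow a Lipschitz selection whose value at the starting point
    is close to the mean velocity of xb. *)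
Lemma filippov_step a b xb (dir : bool) y : a < b -> traj F a b xb ->
  (forall s, a <= s <= b -> enorm (xb s) <= rho - 1) ->
  enorm (y - xb (if dir then a else b)) <= 1 / 2 -> M * (b - a) <= 1 / 2 ->
  exists2 y2, joined_dir dir (if dir then a else b) y (if dir then b else a) y2 &
    enorm (y2 - xb (if dir then b else a)) <=
      (1 + k * (b - a)) * enorm (y - xb (if dir then a else b)) +
      (2 * k * M + 1) * (b - a) ^+ 2.
Proof.
move=> ab tx xr.
have s1ab : a <= (if dir then a else b) <= b by case: (dir); rewrite lexx (ltW ab).
move: s1ab; set s1 := (if dir then a else b).
set s2 := (if dir then b else a) => s1ab yx Mba.
have ba : 0 < b - a by rewrite subr_gt0.
have k0 := hd_k hd; have M0 := hd_M hd.
have xr' s : a <= s <= b -> enorm (xb s) <= rho by move=> /xr; lra.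
have yr : enorm y <= rho - 1 / 2.
  by have := enormD (y - xb s1) (xb s1); have := xr s1 s1ab; rewrite subrK; lra.
have yr' : enorm y <= r by apply: rho_le_r; lra.
set w := (b - a)^-1 *: (xb b - xb a).
have e0 : 0 <= k * enorm (y - xb s1) + k * M * (b - a).
  by rewrite addr_ge0 // mulr_ge0 ?enorm_ge0 // ?mulr_ge0 // ltW.
have Hw p : dotv w p <= H y p + (k * enorm (y - xb s1) + k * M * (b - a)) * enorm p.
  have := mean_velocity_ham ab tx xr' s1ab p; rewrite -/w.
  have := hd_Hlip hd p (rho_le_r (xr' s1 s1ab)) yr'.
  rewrite (enormB (xb s1)); lra.
have [g sg gw] := selection_approx hd yr' e0 ba Hw.
have ybr : enorm y + M * (b - a) <= rho by lra.
have [z [tz zy zr dz]] := selection_flow rho0 hd dir sg (ltW ab) ybr.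
have hz : enorm (z b - z a - (b - a) *: g y) <= k * M * (b - a) * (b - a).
  apply: arc_mean_velocity (ltW ab) tz.1 _; apply: ae_derivW dz => s d sab _ ->.
  have [h1 h2] := zr s sab.
  apply: le_trans (sg.2 _ _ (rho_le_r h2) yr') _.
  by rewrite -mulrA ler_wpM2l.
have wE : (b - a) *: w = xb b - xb a by rewrite scalerA mulfV ?scale1r // gt_eqF.
exists (z s2).
  by rewrite /joined_dir /s1 /s2; move: zy; case: (dir) => <-; exact: traj_joined.
have -> : (1 + k * (b - a)) * enorm (y - xb s1) + (2 * k * M + 1) * (b - a) ^+ 2 =
    enorm (y - xb s1) + k * M * (b - a) * (b - a) + (b - a) *
      (k * enorm (y - xb s1) + k * M * (b - a) + (b - a)) by ring.
have gw' : enorm ((b - a) *: (g y - w)) <= (b - a) *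
      (k * enorm (y - xb s1) + k * M * (b - a) + (b - a)).
  by rewrite enormZ (gtr0_norm ba) ler_pM2l.
move: hz gw'; set A := z b - z a - (b - a) *: g y; set B := (b - a) *: (g y - w).
move=> hA hB.
have AB : A + B = z b - z a - (xb b - xb a).
  by rewrite /A /B scalerBr wE addrA subrK.
have [sg1 sgn E] : exists2 sg1 : R, `|sg1| = 1 & z s2 - xb s2 = y - xb s1 + sg1 *: (A + B).
  rewrite AB /s1 /s2; move: zy; case: (dir) => <-; [exists 1|exists (-1)];
    rewrite ?normr1 ?normrN1 //; apply/rowP => i; rewrite !mxE; ring.
rewrite E; apply: le_trans (enormD _ _) _; rewrite enormZ sgn mul1r.
have := enormD A B; clearbody A B; lra.
Qed.

Definition before (dir : bool) (s t : R) : bool := if dir then s <= t else t <= s.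

Lemma joined_dir_trans dir s1 y1 s2 y2 s3 y3 : before dir s1 s2 -> before dir s2 s3 ->
  joined_dir dir s1 y1 s2 y2 -> joined_dir dir s2 y2 s3 y3 ->
  joined_dir dir s1 y1 s3 y3.
Proof.
rewrite /before /joined_dir; case: dir => h1 h2 j1 j2; first exact: joined_trans j2.
exact: joined_trans j1.
Qed.

Lemma filippov_step_dir xb (dir : bool) (s1 s2 d : R) y : 0 < d ->
  s2 = s1 + (if dir then 1 else -1) * d ->
  traj F (Num.min s1 s2) (Num.max s1 s2) xb ->
  (forall s, Num.min s1 s2 <= s <= Num.max s1 s2 -> enorm (xb s) <= rho - 1) ->
  enorm (y - xb s1) <= 1 / 2 -> M * d <= 1 / 2 ->
  exists2 y2, joined_dir dir s1 y s2 y2 &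
    enorm (y2 - xb s2) <= (1 + k * d) * enorm (y - xb s1) + (2 * k * M + 1) * d ^+ 2.
Proof.
move=> d0; case: dir => [|] /= s2E.
  have s12 : s1 < s2 by lra.
  rewrite (min_idPl (ltW s12)) (max_idPr (ltW s12)) => tx xr y1 Md.
  have dE : d = s2 - s1 by lra.
  by rewrite dE in Md *; exact: (filippov_step (dir := true) s12 tx xr y1 Md).
have s12 : s2 < s1 by lra.
rewrite (min_idPr (ltW s12)) (max_idPl (ltW s12)) => tx xr y1 Md.
have dE : d = s1 - s2 by lra.
by rewrite dE in Md *; exact: (filippov_step (dir := false) s12 tx xr y1 Md).
Qed.

(** Iteration of the step, with the bound of the discrete Gronwall lemma. *)
Lemma filippov_steps a b xb (dir : bool) (s1 d : R) h N : 0 < d ->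
  traj F a b xb -> (forall s, a <= s <= b -> enorm (xb s) <= rho - 1) ->
  (forall j, (j <= N)%N -> a <= s1 + (if dir then 1 else -1) * (j%:R * d) <= b) ->
  M * d <= 1 / 2 ->
  (1 + k * d) ^+ N * (enorm h + N%:R * ((2 * k * M + 1) * d ^+ 2)) <= 1 / 2 ->
  forall j, (j <= N)%N ->
  exists2 y, joined_dir dir s1 (xb s1 + h) (s1 + (if dir then 1 else -1) * (j%:R * d)) y &
    enorm (y - xb (s1 + (if dir then 1 else -1) * (j%:R * d))) <=
      (1 + k * d) ^+ j * (enorm h + j%:R * ((2 * k * M + 1) * d ^+ 2)).
Proof.
move=> d0 tx xr sab Md small; set sg : R := (if dir then 1 else -1).
have k0 := hd_k hd; have M0 := hd_M hd.
set D := (2 * k * M + 1) * d ^+ 2.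
have D0 : 0 <= D by rewrite mulr_ge0 ?sqr_ge0 // addr_ge0 // mulr_ge0 // mulr_ge0.
have q1 : 1 <= 1 + k * d by rewrite lerDl mulr_ge0 // ltW.
move: small; rewrite -/D; set q := 1 + k * d => small.
elim=> [_|j ih jN].
  exists (xb s1 + h).
    by rewrite mul0r mulr0 addr0 /joined_dir; case: (dir); exact: joined_refl.
  by rewrite mul0r mulr0 !addr0 expr0 mul1r addrC addKr mul0r addr0.
have [y jy yx] := ih (ltnW jN).
have tau : s1 + sg * (j.+1%:R * d) = (s1 + sg * (j%:R * d)) + sg * d.
  by rewrite -natr1; ring.
have sj := sab j (ltnW jN); have sj1 := sab j.+1 jN.
rewrite -/sg in sj sj1.
have pos i : (i <= N)%N -> q ^+ i * (enorm h + i%:R * D) <= 1 / 2.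
  move=> iN; apply: le_trans small; apply: ler_pM.
  - by rewrite exprn_ge0 // (le_trans ler01).
  - by rewrite addr_ge0 ?enorm_ge0 // mulr_ge0.
  - exact: ler_weXn2l.
  - by rewrite lerD2l ler_wpM2r // ler_nat.
have [s2 s2E] : exists s2, s2 = s1 + sg * (j.+1%:R * d) by eexists.
rewrite -s2E in tau sj1 *.
have [s1' s1E] : exists s1', s1' = s1 + sg * (j%:R * d) by eexists.
rewrite -s1E in jy yx sj tau.
have tx' : traj F (Num.min s1' s2) (Num.max s1' s2) xb.
  apply: traj_sub tx; rewrite ?le_min ?ge_max.
    by case/andP: sj => -> _; case/andP: sj1.
  by case/andP: sj => _ ->; case/andP: sj1.
have xr' s : Num.min s1' s2 <= s <= Num.max s1' s2 -> enorm (xb s) <= rho - 1.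
  case/andP: sj => p1 p2; case/andP: sj1 => p3 p4 /andP[p5 p6]; apply: xr.
  apply/andP; split; [apply: le_trans p5|apply: le_trans p6 _].
    by rewrite le_min p1.
  by rewrite ge_max p2.
have [y2 jy2 y2x] := filippov_step_dir d0 tau tx' xr' (le_trans yx (pos j (ltnW jN))) Md.
exists y2.
  apply: joined_dir_trans jy jy2.
    have : 0 <= j%:R * d by rewrite mulr_ge0 // ltW.
    by rewrite s1E /before /sg; case: (dir); lra.
  by rewrite tau /before /sg; case: (dir); lra.
apply: le_trans y2x _; rewrite -/D -/q.
have q0 : 0 <= q by exact: le_trans ler01 q1.
have := ler_wpM2l q0 yx; rewrite mulrA -exprS.
have q2 : 1 <= q ^+ j.+1 by exact: exprn_ege1.
have := ler_wpM2r D0 q2; rewrite -natr1; lra.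
Qed.

(** Approximate form of Filippov's theorem.  The Euler error tends to 0 with the step, so it can be
    made smaller than the displacement h itself. *)
Lemma filippov_tracking a b xb (dir : bool) (s1 s2 : R) h :
  traj F a b xb -> (forall s, a <= s <= b -> enorm (xb s) <= rho - 1) ->
  a <= s1 <= b -> a <= s2 <= b -> before dir s1 s2 ->
  4 * expR (k * (b - a)) * enorm h <= 1 ->
  exists2 y, joined_dir dir s1 (xb s1 + h) s2 y &
    enorm (y - xb s2) <= 2 * expR (k * (b - a)) * enorm h.
Proof.
move=> tx xr sab1 sab2 s12 hsmall.
have k0 := hd_k hd; have M0 := hd_M hd.
have joinx : joined_dir dir s1 (xb s1) s2 (xb s2).
  move: s12 sab1 sab2; rewrite /joined_dir /before.
  by case: (dir) => s12 /andP[? ?] /andP[? ?]; apply: traj_joined; exact: traj_sub tx.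
have [->|h0] := eqVneq h 0.
  by exists (xb s2); rewrite ?addr0 // subrr enorm0 mulr0.
have h1 : 0 < enorm h by rewrite enorm_gt0.
pose L := `|s2 - s1|.
have LE : s2 = s1 + (if dir then 1 else -1) * L.
  rewrite /L; move: s12; rewrite /before; case: (dir) => s12.
    by rewrite ger0_norm; lra.
  by rewrite ler0_norm; lra.
have [s12'|s12'] := eqVneq s1 s2.
  rewrite -s12'; exists (xb s1 + h).
    by rewrite /joined_dir; case: (dir); exact: joined_refl.
  rewrite addrC addKr ler_peMl ?enorm_ge0 //.
  have : 1 <= expR (k * (b - a)).
    rewrite -expR0 ler_expR mulr_ge0 // subr_ge0; by case/andP: sab1 => /le_trans; apply.
  lra.
have L0 : 0 < L by rewrite normr_gt0 subr_eq0 eq_sym.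
have Lba : L <= b - a.
  by move: sab1 sab2 => /andP[? ?] /andP[? ?]; rewrite /L ler_norml; apply/andP; split; lra.
clearbody L.
(* N is large enough for the total Euler error to be at most |h| and for the
   step L / N to be admissible *)
pose C := 2 * k * M + 1.
have C0 : 0 <= C by rewrite addr_ge0 // mulr_ge0 // mulr_ge0.
have CL0 : 0 <= C * L ^+ 2 / enorm h.
  by rewrite divr_ge0 ?enorm_ge0 // mulr_ge0 // exprn_ge0 // ltW.
have ML0 : 0 <= 2 * M * L by rewrite !mulr_ge0 // ltW.
have [N N0 [N1 N2]] : exists2 N : nat, (0 < N)%N &
    C * L ^+ 2 <= N%:R * enorm h /\ 2 * M * L <= N%:R.
  pose q := C * L ^+ 2 / enorm h + 2 * M * L.
  have := archi_boundP (addr_ge0 CL0 ML0); rewrite -/q => Hq.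
  exists (Num.bound q).+1 => //; rewrite -natr1; split.
    rewrite -ler_pdivrMr //; rewrite /q in Hq; lra.
  rewrite /q in Hq; lra.
have NR : 0 < N%:R :> R by rewrite ltr0n.
pose d := L / N%:R.
have d0 : 0 < d by rewrite divr_gt0.
have dN : N%:R * d = L by rewrite mulrC divfK // gt_eqF.
have Md : M * d <= 1 / 2 by rewrite mulrA ler_pdivrMr //; lra.
have q0 : 0 <= 1 + k * d by rewrite addr_ge0 // mulr_ge0 // ltW.
have qN : (1 + k * d) ^+ N <= expR (k * (b - a)).
  apply: (@le_trans _ _ (expR (k * d) ^+ N)).
    by apply: lerXn2r; rewrite ?nnegrE ?expR_ge0 // expR_ge1Dx.
  by rewrite -expRM_natl ler_expR mulrCA dN ler_wpM2l.
have Dh : N%:R * (C * d ^+ 2) <= enorm h.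
  have -> : N%:R * (C * d ^+ 2) = C * L ^+ 2 / N%:R.
    by rewrite /d; field; rewrite gt_eqF.
  by rewrite ler_pdivrMr // (mulrC (enorm h)).
have Dh0 : 0 <= N%:R * (C * d ^+ 2) by rewrite mulr_ge0 // mulr_ge0 // sqr_ge0.
have E0 : 0 < expR (k * (b - a)) by exact: expR_gt0.
have bound : (1 + k * d) ^+ N * (enorm h + N%:R * (C * d ^+ 2)) <=
    2 * expR (k * (b - a)) * enorm h.
  apply: (@le_trans _ _ (expR (k * (b - a)) * (2 * enorm h))); last by rewrite mulrCA mulrA.
  apply: ler_pM => //; [|by rewrite addr_ge0 // enorm_ge0|lra].
  exact: exprn_ge0.
have Hj j : (j <= N)%N -> a <= s1 + (if dir then 1 else -1) * (j%:R * d) <= b.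
  move=> jN; have : j%:R * d <= L by rewrite -dN ler_wpM2r ?(ltW d0) // ler_nat.
  have : 0 <= j%:R * d by rewrite mulr_ge0 // ltW.
  move: (j%:R * d) => t t0 tL; move: s12 LE sab1 sab2; rewrite /before.
  by case: (dir) => s12 LE /andP[? ?] /andP[? ?]; apply/andP; split; lra.
have Hb : (1 + k * d) ^+ N * (enorm h + N%:R * (C * d ^+ 2)) <= 1 / 2.
  apply: le_trans bound _; lra.
have [y] := filippov_steps d0 tx xr Hj Md Hb (leqnn N).
by rewrite dN -LE => jy yx; exists y => //; exact: le_trans yx bound.
Qed.

End Filippov.

(** * Trajectories near an extremal *)

Section Tube.
Context {R : realType} {n : nat} (F : 'rV[R]_n -> set 'rV[R]_n)
  (H : 'rV[R]_n -> 'rV[R]_n -> R) (G : 'rV[R]_n -> 'rV[R]_n -> 'rV[R]_n).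
Variables (rho k c M : R).
Hypothesis rho0 : 0 < rho.
Let r := n.+1%:R * rho.
Hypothesis hd : ham_data F H G r k c M.
Variables (t0 T : R) (xb pb : R -> 'rV[R]_n).
Hypothesis t0T : t0 <= T.
Hypothesis tx : traj F t0 T xb.
Hypothesis xr : forall s, t0 <= s <= T -> enorm (xb s) <= rho - 1.
Hypothesis pa : is_arc t0 T pb.
Hypothesis dx : ae_deriv t0 T xb (fun s d => subdiff (H (xb s)) (pb s) d).
Hypothesis dp : ae_deriv t0 T pb
  (fun s d => subdiff (fun x => H x (pb s)) (xb s) (- d)).
Implicit Types (s t : R) (h : 'rV[R]_n) (dir : bool).

Let E := expR (k * (T - t0)).

Lemma xb_in_ball s : t0 <= s <= T -> enorm (xb s) <= r.
Proof. by move=> /xr h; apply: (rho_le_r rho0); lra. Qed.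

Lemma costate_velocity : ae_deriv t0 T pb (fun s d => enorm d <= k * enorm (pb s)).
Proof.
apply: ae_derivW dp => s d sT _ sd; rewrite -(enormN d).
apply: (hd_xsub_bound hd) sd; apply: (@lt_le_trans _ _ rho).
  by have := xr sT; lra.
by rewrite /r ler_peMl ?(ltW rho0) // ler1n.
Qed.

(** The costate solves a linear differential inequality, so it vanishes
    identically as soon as it vanishes somewhere. *)
Lemma costate_dichotomy : (forall s, t0 <= s <= T -> pb s = 0) \/
  (forall s, t0 <= s <= T -> pb s != 0).
Proof.
have [[s [sT ps]]|Np] := pselect (exists s, t0 <= s <= T /\ pb s = 0); last first.
  by right=> s sT; apply/eqP => ps; apply: Np; exists s.
left=> t tT; apply/eqP; rewrite -enorm_eq0 -sqrf_eq0 eq_le sqr_ge0 andbT.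
move: sT tT => /andP[s0 sT] /andP[t0' tT].
have k0 := hd_k hd.
have V a b : t0 <= a -> b <= T ->
    ae_deriv a b pb (fun u d => `|dotv (pb u) d| <= k * enorm (pb u) ^+ 2).
  move=> a0 bT; apply: ae_derivW (ae_deriv_sub a0 bT costate_velocity) => u d _ _ h.
  apply: le_trans (norm_dotv_le _ _) _.
  by have := ler_wpM2l (enorm_ge0 (pb u)) h; rewrite expr2; lra.
have [st|/ltW ts] := leP s t.
  have := arc_growth (c := 0) (k := k) st (is_arc_sub s0 tT pa).
  rewrite ps enorm0 expr0n /= !add0r mulr0; apply.
  apply: ae_derivW (V s t s0 tT) => u d _ _; rewrite ler_norml add0r => /andP[_].
  by [].
have := arc_growth_rev (k := k) ts (is_arc_sub t0' sT pa).
rewrite ps enorm0 expr0n /= mulr0; apply.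
by apply: ae_derivW (V t s t0' sT) => u d _ _; rewrite ler_norml => /andP[].
Qed.

Definition endpoint dir : R := if dir then T else t0.

(** The property of the endpoint y reached from xb(s1) + h that the
    sensitivity relations rest on: the pairing of the costate with the
    displacement can decrease only by a multiple of |h|^2 in forward time. *)
Definition tracks dir s1 h (C : R) (y : 'rV[R]_n) : Prop :=
  [/\ joined_dir F dir s1 (xb s1 + h) (endpoint dir) y,
      enorm (y - xb (endpoint dir)) <= C * enorm h &
      if dir then dotv (pb s1) h - C * enorm h ^+ 2 <= dotv (pb T) (y - xb T)
      else dotv (pb t0) (y - xb t0) - C * enorm h ^+ 2 <= dotv (pb s1) h].

(** With a zero costate only the distance to xb matters. *)
Lemma tracks_zero dir s1 h : (forall s, t0 <= s <= T -> pb s = 0) ->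
  t0 <= s1 <= T -> 4 * E * enorm h <= 1 -> exists y, tracks dir s1 h (2 * E) y.
Proof.
move=> p0 s1T hE.
have eT : t0 <= endpoint dir <= T by rewrite /endpoint; case: (dir); rewrite lexx t0T.
have bf : before dir s1 (endpoint dir).
  by rewrite /before /endpoint; case: (dir); case/andP: s1T.
have [y jy yx] := filippov_tracking rho0 hd tx xr s1T eT bf hE.
exists y; split => //.
have E0 : 0 <= 2 * E * enorm h ^+ 2 by rewrite mulr_ge0 ?sqr_ge0 // mulr_ge0 ?expR_ge0.
rewrite !(p0 s1) // !(p0 t0, p0 T) ?lexx ?t0T // !dotv0l.
by case: (dir); lra.
Qed.

Section NonzeroCostate.
Hypothesis p0 : forall s, t0 <= s <= T -> pb s != 0.

Let g s x := G x (pb (clamp t0 T s)).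

Let gF s x : enorm x <= r -> F x (g s x).
Proof.
by move=> xr'; have [] := hd_arg hd xr' (p0 (clamp_itv s t0T)).
Qed.

Let gH s x : enorm x <= r -> dotv (g s x) (pb (clamp t0 T s)) = H x (pb (clamp t0 T s)).
Proof.
by move=> xr'; have [] := hd_arg hd xr' (p0 (clamp_itv s t0T)).
Qed.

Let gk s x z : enorm x <= r -> enorm z <= r ->
  enorm (g s x - g s z) <= k * enorm (x - z).
Proof. by move=> h1 h2; apply: (hd_Glip hd) => //; apply: p0; exact: clamp_itv. Qed.

Let gc x : enorm x <= r -> econt (fun s => g s x).
Proof.
move=> xr' s e e0.
have [d d0 Hd] := hd_Gcont hd xr' (p0 (clamp_itv s t0T)) e0.
have [d' d'0 Hd'] := arc_continuous pa d0.
exists d' => // t ts; apply: Hd; first by apply: p0; exact: clamp_itv.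
apply: Hd'; try exact: clamp_itv.
by apply: le_lt_trans ts; exact: clamp_lip.
Qed.

Let xb_flow : ae_deriv t0 T xb (fun s d => d = g s (xb s)).
Proof.
apply: ae_derivW dx => s d sT _ sd; rewrite /g clamp_id //.
by apply: (hd_psub hd) => //; [exact: xb_in_ball|exact: p0].
Qed.

(** The reference xb is itself a flow line of the field grad_p H(., pb(s)),
    because pb(s) <> 0 makes grad_p H the only subgradient; Gronwall's
    inequality then compares the two flow lines. *)
Lemma flow_close dir s1 h a b y : t0 <= a -> a <= b -> b <= T ->
  flow_line rho g a b y -> (if dir then a else b) = s1 -> y s1 = xb s1 + h ->
  forall s, a <= s <= b -> enorm (y s - xb s) <= E * enorm h.
Proof.
move=> t0a ab bT fy s1E ys1 s /andP[as_ sb].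
have k0 := hd_k hd.
have V u v : a <= u -> v <= b ->
    ae_deriv u v (fun t => y t - xb t) (fun t d =>
      `|dotv (y t - xb t) d| <= k * enorm (y t - xb t) ^+ 2).
  move=> au vb.
  have A1 := ae_deriv_sub au vb (flow_line_ae fy).
  have A2 := ae_deriv_sub (le_trans t0a au) (le_trans vb bT) xb_flow.
  apply: ae_derivW (ae_derivB A1 A2) => t _ /andP[ut tv] _ [d1 [d2 [-> -> ->]]].
  have tT : t0 <= t <= T.
    by rewrite (le_trans t0a (le_trans au ut)) (le_trans tv (le_trans vb bT)).
  apply: le_trans (norm_dotv_le _ _) _.
  have h1 := gk t (clampv_ball (y t) (ltW rho0)) (xb_in_ball tT).
  have xbr : enorm (xb t) <= rho by have := xr tT; lra.
  have h2 := clampv_lip (y t) (xb t) (ltW rho0).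
  rewrite (clampv_id xbr) in h2.
  have h3 := ler_wpM2l k0 h2.
  have := ler_wpM2l (enorm_ge0 (y t - xb t)) (le_trans h1 h3).
  by rewrite expr2; lra.
have arcz u v : a <= u -> v <= b -> is_arc u v (fun t => y t - xb t).
  move=> au vb; apply: is_arcB.
    exact: is_arc_sub (flow_line_arc fy).
  exact: is_arc_sub (le_trans t0a au) (le_trans vb bT) tx.1.
have z1 : y s1 - xb s1 = h by rewrite ys1 addrC addKr.
have sq (D : R) : 0 <= D -> D <= T - t0 ->
    enorm (y s - xb s) ^+ 2 <= expR (2 * k * D) * enorm h ^+ 2 ->
    enorm (y s - xb s) <= E * enorm h.
  move=> D0 DT hz.
  have Eh0 : 0 <= E * enorm h by rewrite mulr_ge0 ?expR_ge0 ?enorm_ge0.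
  rewrite -ler_sqr ?nnegrE ?enorm_ge0 //; apply: le_trans hz _.
  rewrite exprMn ler_wpM2r ?sqr_ge0 // /E -expRM_natl ler_expR.
  have := ler_wpM2l k0 DT; lra.
case: dir s1E => s1E; subst s1.
  have := arc_growth (c := 0) (k := k) as_ (arcz a s (lexx a) sb).
  rewrite z1 !add0r => hz; apply: (sq (s - a)); [lra|lra|apply: hz].
  apply: ae_derivW (V a s (lexx a) sb) => u d _ _.
  by rewrite add0r ler_norml => /andP[].
have := arc_growth_rev (k := k) sb (arcz s b as_ (lexx b)).
rewrite z1 => hz; apply: (sq (b - s)); [lra|lra|apply: hz].
by apply: ae_derivW (V s b as_ (lexx b)) => u d _ _; rewrite ler_norml => /andP[].
Qed.

(** Along two solutions of the state equation driven by the same costate, the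
    pairing of the costate with the difference of the states has derivative
    H(y, p) - H(xb, p) + <p', y - xb>, which semiconvexity bounds below. *)
Lemma pairing_growth a b y D : t0 <= a -> a <= b -> b <= T ->
  flow_line rho g a b y -> (forall s, a <= s <= b -> enorm (y s) <= rho) ->
  (forall s, a <= s <= b -> enorm (y s - xb s) <= D) ->
  forall B : R, (forall s, t0 <= s <= T -> enorm (pb s) <= B) ->
  dotv (pb a) (y a - xb a) - c * B * D ^+ 2 * (T - t0) <=
    dotv (pb b) (y b - xb b).
Proof.
move=> t0a ab bT fy yr yD B HB.
have c0 := hd_c hd.
have A1 := flow_line_ae fy.
have A2 := ae_deriv_sub t0a bT xb_flow.
have A3 := ae_deriv_sub t0a bT dp.
pose W := c * B * D ^+ 2.
have B0 : 0 <= B by apply: le_trans (enorm_ge0 (pb t0)) (HB t0 _); rewrite lexx t0T.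
have W0 : 0 <= W by rewrite mulr_ge0 ?sqr_ge0 // mulr_ge0.
suff : W * a + dotv (pb a) (y a - xb a) <= W * b + dotv (pb b) (y b - xb b).
  have : W * (b - a) <= W * (T - t0) by rewrite ler_wpM2l //; lra.
  by rewrite /W; lra.
apply: (arc_ndecr (g := fun s => W * s + dotv (pb s) (y s - xb s)) ab _ A1 A2 A3).
  apply: ac_funD.
    apply: (ac_fun_lip W0) => u v _ uv _.
    by rewrite -mulrBr ger0_norm // mulr_ge0 // subr_ge0.
  apply: ac_fun_dotv => //; first exact: is_arc_sub pa.
  by apply: is_arcB; [exact: flow_line_arc fy|exact: is_arc_sub tx.1].
move=> s dy dxb dpb sab iy ix ip ey ex sp; subst dy dxb.
have sT : t0 <= s <= T.
  by case/andP: sab => h1 h2; rewrite (le_trans t0a h1) (le_trans h2 bT).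
have ysr := yr s sab; have yr' := rho_le_r rho0 ysr; have xr' := xb_in_ball sT.
exists (W + (dotv dpb (y s - xb s) + dotv (pb s) (g s (y s) - g s (xb s)))).
  have h1 := is_deriveM (is_derive_cst (W : R^o) s 1) (is_derive_id s (1 : R^o)).
  have h2 := is_derive_dotv ip (is_deriveB iy ix).
  rewrite clampv_id // in h2.
  apply: (is_derive_eq (is_deriveD h1 h2)).
  by rewrite scaler0 addr0 /GRing.scale /= mulr1.
have gHs x : enorm x <= r -> dotv (pb s) (g s x) = H x (pb s).
  by move=> xr''; have := gH s xr''; rewrite clamp_id // dotvC.
rewrite [dotv (pb s) _]dotvBr (gHs _ yr') (gHs _ xr').
have := hd_xsub hd xr' yr' sp; rewrite dotvNl => h1.
have h2 : c * enorm (pb s) * enorm (y s - xb s) ^+ 2 <= W.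
  rewrite /W; apply: ler_pM; rewrite ?sqr_ge0 // ?mulr_ge0 ?enorm_ge0 //.
    by rewrite ler_wpM2l // HB.
  rewrite ler_sqr ?nnegrE ?enorm_ge0 ?yD //.
  by apply: le_trans (enorm_ge0 _) (yD s sab).
lra.
Qed.

Lemma tracks_nonzero dir s1 h (B : R) :
  (forall s, t0 <= s <= T -> enorm (pb s) <= B) ->
  t0 <= s1 <= T -> E * enorm h <= 1 ->
  exists y, tracks dir s1 h (E + c * B * E ^+ 2 * (T - t0)) y.
Proof.
move=> HB s1T hE.
have [s10 s1T'] := andP s1T.
have HM x v : enorm x <= r -> F x v -> enorm v <= M by exact: (hd_bound hd).
pose a := if dir then s1 else t0; pose b := if dir then T else s1.
have t0a : t0 <= a by rewrite /a; case: (dir).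
have bT : b <= T by rewrite /b; case: (dir).
have ab : a <= b by rewrite /a /b; case: (dir).
have s1E : (if dir then a else b) = s1 by rewrite /a /b; case: (dir).
have [y fy ys1] : exists2 y, flow_line rho g a b y & y s1 = xb s1 + h.
  rewrite -{1}s1E; case: (dir).
    exact: (flow_forward (ltW rho0) (hd_k hd) HM gF gk gc _ ab).
  exact: (flow_backward _ (ltW rho0) (hd_k hd) HM gF gk gc ab).
have yx := flow_close t0a ab bT fy s1E ys1.
have yr s : a <= s <= b -> enorm (y s) <= rho.
  move=> sab; have := enormD (y s - xb s) (xb s); rewrite subrK.
  have := yx s sab; have := xr (s := s) ltac:(case/andP: sab => h1 h2;
    by rewrite (le_trans t0a h1) (le_trans h2 bT)).
  lra.
have ty := flow_line_traj (ltW rho0) gF fy yr.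
have pair := pairing_growth t0a ab bT fy yr yx HB.
have C0 : 0 <= c * B * E ^+ 2 * (T - t0).
  rewrite mulr_ge0 ?subr_ge0 // mulr_ge0 ?sqr_ge0 // mulr_ge0 ?(hd_c hd) //.
  by apply: le_trans (enorm_ge0 (pb s1)) (HB s1 s1T).
have z1 : y s1 - xb s1 = h by rewrite ys1 addrC addKr.
have E0 : 0 <= E by exact: expR_ge0.
have CE : c * B * (E * enorm h) ^+ 2 * (T - t0) <=
    (E + c * B * E ^+ 2 * (T - t0)) * enorm h ^+ 2.
  have := mulr_ge0 E0 (sqr_ge0 (enorm h)); rewrite exprMn; lra.
have ends : endpoint dir = (if dir then b else a) by rewrite /endpoint /a /b; case: (dir).
exists (y (endpoint dir)); split.
- rewrite -ys1 ends -{1 2}s1E /joined_dir; case: (dir); exact: traj_joined.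
- rewrite ends; apply: le_trans (yx _ _) _.
    by case: (dir); rewrite lexx ab.
  by rewrite ler_wpM2r ?enorm_ge0 // lerDl.
- move: z1 pair; rewrite -{1 2}s1E /a /b /endpoint /=.
  case: (dir) => /= -> ; rewrite ?z1; lra.
Qed.

End NonzeroCostate.

(** The costate vanishes nowhere or everywhere.  In the first case follow the
    flow of grad_p H(., pb(s)); in the second the pairings are zero and tracking
    xb is enough. *)
Lemma tube : exists2 C : R, 0 < C & exists2 d : R, 0 < d &
  forall dir s1 h, t0 <= s1 <= T -> enorm h <= d -> exists y, tracks dir s1 h C y.
Proof.
have [B B0 HB] := arc_bounded t0T pa.
have E0 : 0 < E by exact: expR_gt0.
have E40 : 0 < 4 * E by rewrite mulr_gt0.
have C0 : 0 <= c * B * E ^+ 2 * (T - t0).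
  by rewrite mulr_ge0 ?subr_ge0 // mulr_ge0 ?sqr_ge0 // mulr_ge0 ?(hd_c hd).
case: costate_dichotomy => p0.
  exists (2 * E); first by rewrite mulr_gt0.
  exists (1 / (4 * E)); first by rewrite divr_gt0.
  move=> dir s1 h s1T hE; apply: tracks_zero => //.
  by rewrite mulrC -ler_pdivlMr.
exists (E + c * B * E ^+ 2 * (T - t0)); first by rewrite ltr_wpDr.
exists (1 / E); first by rewrite divr_gt0.
move=> dir s1 h s1T hE; apply: tracks_nonzero => //.
by rewrite mulrC -ler_pdivlMr.
Qed.

End Tube.

(** * The value function *)

Section Value.
Context {R : realType} {n : nat} (F : 'rV[R]_n -> set 'rV[R]_n)
  (phi : 'rV[R]_n -> R) (T gamma : R).
Hypothesis gamma0 : 0 < gamma.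
Hypothesis Hgamma : forall x v, F x v -> enorm v <= gamma * (1 + enorm x).
Hypothesis hphi : lipschitz_near_pts phi.
Implicit Types (s t : R) (x y z : 'rV[R]_n).
Local Notation V := (value F phi T).

Lemma admissibleE t x (y : R -> 'rV[R]_n) : admissible F T t x y <-> traj F t T y /\ y t = x.
Proof. by split=> [[h1 h2 h3]|[[h1 h2] h3]]. Qed.

(** Under linear growth 1 + |y|^2 satisfies a linear differential inequality. *)
Lemma traj_growth s t (y : R -> 'rV[R]_n) : s <= t -> traj F s t y ->
  1 + enorm (y t) ^+ 2 <= expR (4 * gamma * (t - s)) * (1 + enorm (y s) ^+ 2).
Proof.
move=> st [ay dy].
have := arc_growth (c := 1) (k := 2 * gamma) st ay.
rewrite (_ : 2 * (2 * gamma) = 4 * gamma); last by ring.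
apply; apply: ae_derivW dy => u d _ _ /Hgamma h; apply: le_trans (dotv_le _ _) _.
move: (enorm (y u)) (enorm_ge0 (y u)) h => m m0 h.
have h1 := ler_wpM2l m0 h; apply: le_trans h1 _.
have : 0 <= gamma * (m - 1) ^+ 2 by rewrite mulr_ge0 ?sqr_ge0 // ltW.
have : 0 <= gamma * m ^+ 2 by rewrite mulr_ge0 ?sqr_ge0 // ltW.
have : 0 <= gamma by exact: ltW.
lra.
Qed.

Lemma lipschitz_continuous : continuous phi.
Proof.
move=> x; have [K xK [c Hc]] := hphi x.
apply/(@cvgrPdist_le _ _ _ (nbhs x) (nbhs_filter x)) => e e0.
have [d d0 Hd] := (nbhs_enormP x K).1 xK.
have c1 : 0 < `|c| + 1 by rewrite ltr_wpDl.
apply/nbhs_enormP; exists (Num.min d (e / (`|c| + 1))).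
  by rewrite lt_min d0 divr_gt0.
move=> y; rewrite lt_min ltr_pdivlMr // => /andP[yd ye] /=.
have Kx : K x by apply: Hd; rewrite subrr enorm0.
apply: le_trans (Hc y x (Hd y yd) Kx) _; apply: le_trans (ltW ye).
rewrite (enormB x) mulrC ler_wpM2l ?enorm_ge0 //.
by apply: le_trans (ler_norm c) _; rewrite lerDl.
Qed.

Lemma phi_lbound (B : R) : exists m : R, forall z, enorm z <= B -> m <= phi z.
Proof.
have [B0|B0] := ltP B 0.
  by exists 0 => z /(le_trans (enorm_ge0 z)); rewrite leNgt B0.
pose A := [set v : 'rV[R]_n | forall i, `[- B, B]%classic (v ord0 i)].
have cA : compact A.
  apply: (@rV_compact _ _ (fun=> `[- B, B]%classic)) => _; exact: segment_compact.
have A0 : A !=set0.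
  by exists 0 => i; rewrite /= mxE in_itv /= oppr_le0 B0.
have cphi : {within A, continuous phi}.
  exact/continuous_subspaceT/lipschitz_continuous.
have [v _ Hv] := EVT_min_rV A0 cA cphi.
exists (phi v) => z zB; apply: Hv; apply: mem_set => i /=.
by rewrite in_itv /= -ler_norml; exact: le_trans (coord_le_enorm z i) zB.
Qed.

(** The reachable set is bounded and phi is bounded below on balls, so the
    real infimum defining V is a genuine one. *)
Lemma value_has_lbound t x : t <= T -> has_lbound [set phi (y T) | y in admissible F T t x].
Proof.
move=> tT; pose B := expR (4 * gamma * (T - t)) * (1 + enorm x ^+ 2).
have [m Hm] := phi_lbound (1 + B).
exists m => _ [y /admissibleE[ty yt] <-]; apply: Hm.
have := traj_growth tT ty; rewrite yt -/B.
move: (enorm (y T)) => q h.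
have : 0 <= (q - 1) ^+ 2 by exact: sqr_ge0.
have : 0 <= q ^+ 2 by exact: sqr_ge0.
lra.
Qed.

Lemma value_le t x z : t <= T -> joined F t x T z -> V t x <= phi z.
Proof.
move=> tT [y [ty yt yT]]; apply: ge_inf; first exact: value_has_lbound.
by exists y; rewrite ?yT //; apply/admissibleE.
Qed.

Lemma value_ge t x m : (exists z, joined F t x T z) ->
  (forall z, joined F t x T z -> m <= phi z) -> m <= V t x.
Proof.
move=> [z [y [ty yt yT]]] H; apply: lb_le_inf.
  by exists (phi (y T)), y => //; apply/admissibleE.
move=> _ [w /admissibleE[tw wt] <-]; apply: H; rewrite -wt; exact: traj_joined.
Qed.

Lemma value_dpp s t x y : s <= t -> t <= T -> joined F s x t y ->
  (exists z, joined F t y T z) -> V s x <= V t y.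
Proof.
move=> st tT jxy ey; apply: value_ge => // z jyz; apply: value_le.
  exact: le_trans st tT.
exact: joined_trans jxy jyz.
Qed.

(** A better competitor from (t, xb(t)), preceded by xb on [t0, t], would be a
    better competitor from (t0, x0). *)
Lemma value_optimal t0 x0 xb : optimal F phi T t0 x0 xb ->
  forall t, t0 <= t <= T -> V t (xb t) = phi (xb T).
Proof.
move=> [/admissibleE[tx x0E] opt] t /andP[t0t tT].
have jx : joined F t (xb t) T (xb T).
  apply: traj_joined; exact: traj_sub tx.
apply/eqP; rewrite eq_le value_le //=; apply: value_ge; first by exists (xb T).
move=> z jz.
have j0 : joined F t0 (xb t0) t (xb t) by apply: traj_joined; exact: traj_sub tx.
have [y [ty yt yT]] := joined_trans t0t tT j0 jz.
by rewrite -yT; apply: opt; apply/admissibleE; rewrite yt.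
Qed.

End Value.

(** * Sensitivity relations *)

Section Sensitivity.
Context {R : realType} {n : nat} (F : 'rV[R]_n -> set 'rV[R]_n)
  (phi : 'rV[R]_n -> R)
  (H : 'rV[R]_n -> 'rV[R]_n -> R) (G : 'rV[R]_n -> 'rV[R]_n -> 'rV[R]_n).
Variables (rho k c M gamma : R).
Hypothesis rho0 : 0 < rho.
Let r := n.+1%:R * rho.
Hypothesis hd : ham_data F H G r k c M.
Hypothesis gamma0 : 0 < gamma.
Hypothesis Hgamma : forall x v, F x v -> enorm v <= gamma * (1 + enorm x).
Hypothesis hphi : lipschitz_near_pts phi.
Variables (t0 T : R) (xb pb : R -> 'rV[R]_n) (x0 : 'rV[R]_n).
Hypothesis t0T : t0 <= T.
Hypothesis opt : optimal F phi T t0 x0 xb.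
(* The constants k, c and M are valid only in a ball, which no trajectory that
   starts near xb, possibly before t0, may leave. *)
Hypothesis reach_rho : forall s t y, t0 - 1 <= s -> s <= t -> t <= T ->
  (exists2 t', t0 <= t' <= T & enorm (y s - xb t') <= 1) ->
  traj F s t y -> enorm (y t) <= rho.
Hypothesis xr : forall s, t0 <= s <= T -> enorm (xb s) <= rho - 1.
Hypothesis pa : is_arc t0 T pb.
Hypothesis dx : ae_deriv t0 T xb (fun s d => subdiff (H (xb s)) (pb s) d).
Hypothesis dp : ae_deriv t0 T pb
  (fun s d => subdiff (fun x => H x (pb s)) (xb s) (- d)).
Hypothesis pT : superdiff phi (xb T) (- pb T).
Implicit Types (s t e tau : R) (h q : 'rV[R]_n).
Local Notation V := (value F phi T).

Let tx : traj F t0 T xb.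
Proof. by have [/admissibleE[]] := opt. Qed.

Let xb0 : xb t0 = x0.
Proof. by have [/admissibleE[]] := opt. Qed.

Let Vopt t : t0 <= t <= T -> V t (xb t) = phi (xb T).
Proof. exact: value_optimal gamma0 Hgamma hphi _ _ _ opt t. Qed.

(** Shrinking the neighbourhood absorbs quadratic terms and constants. *)
Lemma small_radius (C d e : R) : 0 < C -> 0 < d -> 0 < e ->
  exists2 m : R, 0 < m & [/\ m <= d, C * m <= e & m <= 1].
Proof.
move=> C0 d0 e0; exists (Num.min 1 (Num.min d (e / C))).
  by rewrite !lt_min ltr01 d0 divr_gt0.
split; rewrite ?ge_min ?lexx ?orbT //.
by rewrite mulrC -ler_pdivlMr // !ge_min lexx !orbT.
Qed.

(** The supergradient of phi at xb(T) is carried back to every time s: the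
    trajectory from xb(s) + h given by the tube is a competitor. *)
Lemma value_upper e : 0 < e -> exists2 m : R, 0 < m & forall s h,
  t0 <= s <= T -> enorm h <= m ->
  (exists z, joined F s (xb s + h) T z) /\
  V s (xb s + h) <= phi (xb T) - dotv (pb s) h + e * enorm h.
Proof.
move=> e0; have [C C0 [d d0 Hd]] := tube rho0 hd t0T tx xr pa dx dp.
have C20 : 0 < 2 * C by rewrite mulr_gt0.
have [d' d'0 Hphi] := superdiffW pT (divr_gt0 e0 C20).
have [m m0 [md mC _]] := small_radius C0 d0 (divr_gt0 e0 (ltr0n R 2)).
have [m' m'0 [m'm m'd _]] := small_radius C20 m0 d'0.
exists m' => // s h sT hm.
have hmm : enorm h <= m by exact: le_trans hm m'm.
have [y [jy yx py]] := Hd true s h sT (le_trans hmm md).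
rewrite /joined_dir /endpoint in jy yx py.
split; first by exists y.
have sT' : s <= T by case/andP: sT.
apply: le_trans (value_le gamma0 Hgamma hphi sT' jy) _.
have h0 := enorm_ge0 h.
have Chd' : C * enorm h < d'.
  have : C * enorm h <= C * m' by rewrite ler_pM2l.
  have : 0 < C * m' by rewrite mulr_gt0.
  lra.
apply: le_trans (Hphi y (le_lt_trans yx Chd')) _.
rewrite dotvNl.
have h1 : e / (2 * C) * enorm (y - xb T) <= e / 2 * enorm h.
  have -> : e / 2 * enorm h = e / (2 * C) * (C * enorm h).
    by field; rewrite gt_eqF.
  by rewrite ler_wpM2l // divr_ge0 // ltW.
have h2 : C * enorm h ^+ 2 <= e / 2 * enorm h.
  rewrite expr2 mulrA ler_wpM2r //; apply: le_trans mC.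
  by rewrite ler_pM2l.
lra.
Qed.

(** A subgradient of V(t0, .) must be the supergradient just found, and it
    propagates forward along backward trajectories, by dynamic programming. *)
Lemma value_lower e : subdiff (V t0) x0 !=set0 -> 0 < e ->
  exists2 m : R, 0 < m & forall s h, t0 <= s <= T -> enorm h <= m ->
  phi (xb T) - dotv (pb s) h - e * enorm h <= V s (xb s + h).
Proof.
move=> [q sq] e0; have t00 : t0 <= t0 <= T by rewrite lexx.
have V0 := Vopt t00; rewrite xb0 in V0.
have qE : q = - pb t0.
  apply: dotv_small_eq => e1 e10; have e12 : 0 < e1 / 2 by rewrite divr_gt0.
  have [m1 m10 H1] := value_upper e12.
  have [m2 m20 H2] := subdiffW sq e12.
  exists (Num.min m1 m2); first by rewrite lt_min m10.
  move=> h; rewrite lt_min => /andP[/ltW h1 h2].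
  have [_] := H1 t0 h t00 h1; rewrite xb0 => h3.
  have := H2 (x0 + h); rewrite (_ : x0 + h - x0 = h); last by rewrite addrC addKr.
  by move=> /(_ h2); rewrite V0 dotvNl; lra.
have [C C0 [d d0 Hd]] := tube rho0 hd t0T tx xr pa dx dp.
have C20 : 0 < 2 * C by rewrite mulr_gt0.
have [d' d'0 Hsub] := subdiffW sq (divr_gt0 e0 C20).
have [m3 m30 Hup] := value_upper ltr01.
have dm0 : 0 < Num.min d m3 by rewrite lt_min d0.
have [m m0 [md mC _]] := small_radius C0 dm0 (divr_gt0 e0 (ltr0n R 2)).
have [m' m'0 [m'm m'd _]] := small_radius C20 m0 d'0.
exists m' => // s h sT hm.
have hmm : enorm h <= m by exact: le_trans hm m'm.
have [hd1 hd3] : enorm h <= d /\ enorm h <= m3.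
  by have := le_trans hmm md; rewrite le_min => /andP.
have [y [jy yx py]] := Hd false s h sT hd1.
rewrite /joined_dir /endpoint in jy yx py.
have [ez _] := Hup s h sT hd3.
have [t0s sT'] := andP sT.
apply: le_trans (value_dpp gamma0 Hgamma hphi t0s sT' jy ez).
have h0 := enorm_ge0 h.
have Chd' : C * enorm h < d'.
  have : C * enorm h <= C * m' by rewrite ler_pM2l.
  have : 0 < C * m' by rewrite mulr_gt0.
  lra.
rewrite xb0 in yx py.
have := Hsub y (le_lt_trans yx Chd'); rewrite V0 qE dotvNl => h3.
have h1 : e / (2 * C) * enorm (y - x0) <= e / 2 * enorm h.
  have -> : e / 2 * enorm h = e / (2 * C) * (C * enorm h).
    by field; rewrite gt_eqF.
  by rewrite ler_wpM2l // divr_ge0 // ltW.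
have h2 : C * enorm h ^+ 2 <= e / 2 * enorm h.
  rewrite expr2 mulrA ler_wpM2r //; apply: le_trans mC.
  by rewrite ler_pM2l.
lra.
Qed.

Section Regular.
Hypothesis sub0 : subdiff (V t0) x0 !=set0.

Lemma value_expand e : 0 < e -> exists2 m : R, 0 < m & forall s h,
  t0 <= s <= T -> enorm h <= m ->
  (exists z, joined F s (xb s + h) T z) /\
  `|V s (xb s + h) - phi (xb T) + dotv (pb s) h| <= e * enorm h.
Proof.
move=> e0; have [m1 m10 H1] := value_upper e0.
have [m2 m20 H2] := value_lower sub0 e0.
exists (Num.min m1 m2); first by rewrite lt_min m10.
move=> s h sT; rewrite le_min => /andP[h1 h2].
have [ez u] := H1 s h sT h1; have l := H2 s h sT h2; split => //.
by rewrite ler_norml; apply/andP; split; lra.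
Qed.

Lemma value_differentiable_x t : t0 <= t <= T ->
  differentiable (V t) (xb t) /\ grad (V t) (xb t) = - pb t.
Proof.
move=> tT; apply: grad_of_expand => e e0; have [m m0 Hm] := value_expand e0.
exists m => // h /ltW hm; have [_] := Hm t h tT hm.
by rewrite Vopt // dotvNl opprK.
Qed.

Let HMxb s : t0 <= s <= T -> forall v, F (xb s) v -> enorm v <= M.
Proof. by move=> sT v; apply: (hd_bound hd); exact: (xb_in_ball rho0 xr sT). Qed.

Let xb_lip s u : t0 <= s -> s <= u -> u <= T -> enorm (xb u - xb s) <= M * (u - s).
Proof. exact: (traj_lip t0T tx HMxb). Qed.

(** The rate at which the pairing with the frozen costate grows along xb is
    the Hamiltonian, because xb maximizes the pairing with pb at almost every
    time and pb is continuous. *)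
Lemma pairing_rate t e : t0 <= t <= T -> 0 < e ->
  exists2 m : R, 0 < m & forall tau, 0 <= tau -> tau <= m -> t + tau <= T ->
    `|dotv (pb t) (xb (t + tau) - xb t) - tau * H (xb t) (pb t)| <= e * tau.
Proof.
move=> tT e0; have k0 := hd_k hd; have M0 := hd_M hd.
pose C1 := 2 * k * enorm (pb t) * M + 1; pose C2 := 4 * M + 1.
have kpM : 0 <= k * enorm (pb t) * M by rewrite !mulr_ge0 // enorm_ge0.
have C10 : 0 < C1 by rewrite /C1; lra.
have C20 : 0 < C2 by rewrite /C2; lra.
have [d d0 Hd] := arc_continuous pa (divr_gt0 e0 C20).
have [m m0 [md mC _]] := small_radius C10 d0 e0.
exists (m / 2); first by rewrite divr_gt0.
move=> tau tau0 taum ttau; have [t0t _] := andP tT.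
have tt : t <= t + tau by lra.
have P : ae_deriv t (t + tau) xb (fun s v =>
    H (xb t) (pb t) - e <= dotv (pb t) v /\ dotv (pb t) v <= H (xb t) (pb t) + e).
  have A := ae_derivI (ae_deriv_sub t0t ttau dx) (ae_deriv_sub t0t ttau tx.2).
  apply: ae_derivW A => s v /andP[ts st] _ [sv Fv].
  have sT : t0 <= s <= T by rewrite (le_trans t0t ts) (le_trans st ttau).
  have xs := xb_in_ball rho0 xr sT; have xt := xb_in_ball rho0 xr tT.
  have E := hd_euler hd sv; rewrite dotvC in E.
  have ub := hd_ub hd (pb t) Fv; rewrite dotvC in ub.
  have vM := HMxb sT Fv.
  have L1 := hd_Hlip hd (pb t) xs xt; have L2 := hd_Hlip hd (pb t) xt xs.
  rewrite (enormB (xb t)) in L2.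
  have L3 := hd_Hlip_p hd (pb t) (pb s) xs.
  have L4 := xb_lip t0t ts ltac:(by case/andP: sT).
  have L5 : k * enorm (pb t) * enorm (xb s - xb t) <= e / 2.
    have L6 : M * (s - t) <= M * m by rewrite ler_wpM2l //; lra.
    have kp : 0 <= k * enorm (pb t) by rewrite mulr_ge0 // enorm_ge0.
    have := ler_wpM2l kp (le_trans L4 L6); rewrite /C1 in mC; lra.
  have L7 : 2 * M * enorm (pb t - pb s) <= e / 2.
    have pp : enorm (pb t - pb s) < e / C2.
      apply: Hd => //; rewrite distrC ger0_norm; lra.
    rewrite ltr_pdivlMr // /C2 in pp; have := enorm_ge0 (pb t - pb s); lra.
  have L8 : dotv (pb s) v - M * enorm (pb t - pb s) <= dotv (pb t) v.
    have := ndotv_le (pb t - pb s) v; rewrite dotvBl.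
    have := ler_wpM2l (enorm_ge0 (pb t - pb s)) vM; lra.
  by split; lra.
have ax : is_arc t (t + tau) xb by exact: is_arc_sub tx.1.
have U := arc_dotv_le (p := pb t) (c := H (xb t) (pb t) + e) tt ax.
have L := arc_dotv_le (p := - pb t) (c := - H (xb t) (pb t) + e) tt ax.
have {}U := U ltac:(by apply: ae_derivW P => s v _ _ []).
have {}L := L ltac:(by apply: ae_derivW P => s v _ _ [+ _]; rewrite dotvNl; lra).
rewrite dotvNl in L; rewrite (_ : t + tau - t = tau) in U L; last by ring.
by rewrite ler_norml; apply/andP; split; lra.
Qed.

(** The uniform expansion is centred at xb(t + tau); pairing_rate accounts for
    the displacement xb(t + tau) - xb(t). *)
Lemma value_expand_later t e : t0 <= t <= T -> 0 < e ->
  exists2 m : R, 0 < m & forall tau h, 0 <= tau -> tau <= m -> t + tau <= T ->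
    enorm h <= m ->
    `|V (t + tau) (xb t + h) - phi (xb T) - tau * H (xb t) (pb t) + dotv (pb t) h|
      <= e * (tau + enorm h).
Proof.
move=> tT e0; have M0 := hd_M hd.
have M1 : 0 < 4 * (M + 1) by lra.
have [m1 m10 H1] := value_expand (divr_gt0 e0 M1).
have [d2 d20 H2] := arc_continuous pa (divr_gt0 e0 M1).
have [m3 m30 H3] := pairing_rate tT (divr_gt0 e0 (ltr0n R 2)).
have M10 : 0 < M + 1 by lra.
have mm : 0 < Num.min d2 m3 by rewrite lt_min d20.
have [m m0 [md mC _]] := small_radius M10 mm m10.
have [md2 md3] : m <= d2 /\ m <= m3 by move: md; rewrite le_min => /andP.
exists (m / 2); first by rewrite divr_gt0.
move=> tau h tau0 taum ttau hm; have [t0t _] := andP tT.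
have sT : t0 <= t + tau <= T by rewrite ttau andbT; lra.
have L4 := xb_lip t0t (ltac:(lra) : t <= t + tau) ttau.
rewrite (_ : t + tau - t = tau) in L4; last by ring.
have Mtau : M * tau <= M * (m / 2) by rewrite ler_wpM2l.
set q := xb t + h - xb (t + tau).
have xq : xb t + h = xb (t + tau) + q by rewrite /q subrKC.
have qE : q = h - (xb (t + tau) - xb t).
  by rewrite /q; apply/rowP => i; rewrite !mxE; ring.
have qn : enorm q <= enorm h + M * tau.
  by rewrite qE; apply: le_trans (enormD _ _) _; rewrite enormN; lra.
have qm : enorm q <= m1 by apply: le_trans mC; have := mulr_ge0 M0 (ltW m0); lra.
have [_ V1] := H1 (t + tau) q sT qm.
rewrite -xq in V1.
have pp : enorm (pb (t + tau) - pb t) <= e / (4 * (M + 1)).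
  apply/ltW/H2 => //; rewrite (_ : t + tau - t = tau); last by ring.
  rewrite ger0_norm //; lra.
have V2 : `|dotv (pb (t + tau) - pb t) q| <= e / (4 * (M + 1)) * enorm q.
  by apply: le_trans (norm_dotv_le _ _) _; rewrite ler_wpM2r // enorm_ge0.
rewrite dotvBl in V2.
have V3 := H3 tau tau0 ltac:(lra) ttau.
have V4 : dotv (pb t) q = dotv (pb t) h - dotv (pb t) (xb (t + tau) - xb t).
  by rewrite qE dotvBr.
have V5 : e / (4 * (M + 1)) * enorm q <= e / 4 * (enorm h + tau).
  apply: (@le_trans _ _ (e / (4 * (M + 1)) * ((M + 1) * (enorm h + tau)))).
    rewrite ler_wpM2l //; first by rewrite divr_ge0 // ltW.
    by have := enorm_ge0 h; have := mulr_ge0 M0 (enorm_ge0 h); lra.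
  rewrite le_eqVlt; apply/orP; left; apply/eqP; field; rewrite gt_eqF //; lra.
have eh : 0 <= e * enorm h by rewrite mulr_ge0 ?enorm_ge0 // ltW.
move: V1 V2 V3; rewrite !ler_norml V4 => /andP[a1 a2] /andP[a3 a4] /andP[a5 a6].
apply/andP; split; lra.
Qed.

(** The velocity pairs with q to at most H(w(s), q), which differs from H(x, q)
    by the Lipschitz error k |q| D. *)
Lemma pairing_le_ham a b w x q D : a <= b -> traj F a b w -> enorm x <= rho ->
  (forall s, a <= s <= b -> enorm (w s) <= rho /\ enorm (w s - x) <= D) ->
  dotv q (w b - w a) <= (H x q + k * enorm q * D) * (b - a).
Proof.
move=> ab tw xrho wD; have kq : 0 <= k * enorm q.
  by rewrite mulr_ge0 ?(hd_k hd) ?enorm_ge0.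
apply: arc_dotv_le ab tw.1 _; apply: ae_derivW tw.2 => s d sab _ Fd.
have [ws wx] := wD s sab; rewrite dotvC.
have := hd_ub hd q Fd; have := ler_wpM2l kq wx.
have := hd_Hlip hd q (rho_le_r rho0 ws) (rho_le_r rho0 xrho).
by lra.
Qed.

(** Equality H(w(s), q) along the selection g turns the previous bound around. *)
Lemma pairing_ge_ham a b w g x q D : a <= b -> is_arc a b w -> enorm x <= rho ->
  ae_deriv a b w (fun s d => d = g (w s)) ->
  (forall z, enorm z <= r -> dotv (g z) q = H z q) ->
  (forall s, a <= s <= b -> enorm (w s) <= rho /\ enorm (w s - x) <= D) ->
  (H x q - k * enorm q * D) * (b - a) <= dotv q (w b - w a).
Proof.
move=> ab aw xrho dw gq wD; have kq : 0 <= k * enorm q.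
  by rewrite mulr_ge0 ?(hd_k hd) ?enorm_ge0.
have : dotv (- q) (w b - w a) <= (- H x q + k * enorm q * D) * (b - a).
  apply: arc_dotv_le ab aw _; apply: ae_derivW dw => s d sab _ ->.
  have [ws wx] := wD s sab; rewrite dotvNl dotvC gq; last exact: (rho_le_r rho0).
  have := hd_Hlip hd q (rho_le_r rho0 xrho) (rho_le_r rho0 ws).
  have := ler_wpM2l kq wx; rewrite (enormB x).
  by lra.
by rewrite dotvNl; lra.
Qed.

(** Starting from xb(t) + h at time t - tau, the state at time t is within
    D = |h| + M tau of xb(t), where the expansion of V(t, .) applies. *)
Lemma earlier_radius t e : t0 <= t <= T -> 0 < e ->
  exists2 m : R, 0 < m & forall tau h, 0 <= tau -> tau <= m -> enorm h <= m ->
    [/\ tau <= 1, enorm h + M * tau <= 1,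
        k * enorm (pb t) * (enorm h + M * tau) <= e / 2 &
        forall z, enorm (z - xb t) <= enorm h + M * tau ->
          (exists z', joined F t z T z') /\
          `|V t z - phi (xb T) + dotv (pb t) (z - xb t)| <= e / 2 * (tau + enorm h)].
Proof.
move=> tT e0; have M0 := hd_M hd.
have M1 : 0 < M + 1 by rewrite ltr_wpDl.
have M21 : 0 < 2 * (M + 1) by rewrite mulr_gt0.
have [m1 m10 H1] := value_expand (divr_gt0 e0 M21).
have kp0 : 0 <= k * enorm (pb t) by rewrite mulr_ge0 ?(hd_k hd) ?enorm_ge0.
have kp1 : 0 < k * enorm (pb t) + 1 by rewrite ltr_wpDl.
have m11 : 0 < Num.min m1 1 by rewrite lt_min m10 ltr01.
have [m m0 [+ mC m1']] := small_radius kp1 m11 (divr_gt0 e0 (ltr0n R 2)).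
rewrite le_min => /andP[mm1 _].
have [m2 m20 [_ m2C m21]] := small_radius M1 m0 m0.
exists m2 => // tau h tau0 taum hm; have h0 := enorm_ge0 h.
have Dm : enorm h + M * tau <= m.
  by have := ler_wpM2l M0 taum; lra.
have D0 : 0 <= enorm h + M * tau by rewrite addr_ge0 // mulr_ge0.
split; [exact: le_trans taum m21|exact: le_trans Dm m1'| |].
  apply: le_trans mC; apply: ler_pM => //; by rewrite lerDl.
move=> z zD; have zE : z = xb t + (z - xb t) by rewrite subrKC.
have [ez Vz] := H1 t (z - xb t) tT (le_trans zD (le_trans Dm mm1)).
rewrite -zE in ez Vz; split => //; apply: le_trans Vz _.
have -> : e / 2 * (tau + enorm h) = e / (2 * (M + 1)) * ((M + 1) * (tau + enorm h)).
  by field; rewrite gt_eqF.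
rewrite ler_wpM2l //; first by rewrite divr_ge0 // ltW.
apply: le_trans zD _; have := mulr_ge0 M0 h0; lra.
Qed.

(** Dynamic programming along a trajectory whose velocity maximizes the
    pairing with pb(t). *)
Lemma value_earlier_upper t e : t0 <= t <= T -> 0 < e ->
  exists2 m : R, 0 < m & forall tau h, 0 <= tau -> tau <= m -> enorm h <= m ->
    (exists z, joined F (t - tau) (xb t + h) T z) /\
    V (t - tau) (xb t + h) <=
      phi (xb T) - tau * H (xb t) (pb t) - dotv (pb t) h + e * (tau + enorm h).
Proof.
move=> tT e0; have [m m0 Hm] := earlier_radius tT e0.
exists m => // tau h tau0 taum hm; have [_ D1 kD HD] := Hm tau h tau0 taum hm.
have [t0t tT'] := andP tT; have xtr := xr tT.
have st : t - tau <= t by rewrite gerBl.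
have tauE : t - (t - tau) = tau by rewrite subKr.
have [g sg gmax] := selection_max hd (pb t).
have xhr : enorm (xb t + h) + M * (t - (t - tau)) <= rho.
  by rewrite tauE; have := enormD (xb t) h; lra.
have [y [ty ys yb dy]] := selection_flow rho0 hd true sg st xhr.
rewrite tauE in yb.
have yx s : t - tau <= s <= t -> enorm (y s) <= rho /\
    enorm (y s - xb t) <= enorm h + M * tau.
  move=> /yb[y1 y2]; split => //.
  have -> : y s - xb t = h + (y s - (xb t + h)).
    by apply/rowP => i; rewrite !mxE; ring.
  by apply: le_trans (enormD _ _) _; rewrite lerD2l.
have [_ ytD] := yx t ltac:(by rewrite st lexx).
have [ez Vy] := HD _ ytD.
have jy : joined F (t - tau) (xb t + h) t (y t) by rewrite -ys; exact: traj_joined.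
split; first by have [z jz] := ez; exists z; exact: joined_trans jy jz.
apply: le_trans (value_dpp gamma0 Hgamma hphi st tT' jy ez) _.
have xtrho : enorm (xb t) <= rho by rewrite (le_trans xtr) // gerBl.
have rate := pairing_ge_ham st ty.1 xtrho dy gmax yx.
rewrite tauE ys in rate.
have ktau := ler_wpM2r tau0 kD.
have pE : dotv (pb t) (y t - xb t) = dotv (pb t) h + dotv (pb t) (y t - (xb t + h)).
  by rewrite -dotvDr; congr dotv; apply/rowP => i; rewrite !mxE; ring.
have eh : 0 <= e * enorm h by rewrite mulr_ge0 ?enorm_ge0 // ltW.
move: Vy; rewrite ler_norml pE => /andP[_ Vy]; lra.
Qed.

(** Every trajectory from xb(t) + h passes at time t through a point where
    V(t, .) is bounded below by its expansion. *)
Lemma value_earlier_lower t e : t0 <= t <= T -> 0 < e ->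
  exists2 m : R, 0 < m & forall tau h, 0 <= tau -> tau <= m -> enorm h <= m ->
    forall z, joined F (t - tau) (xb t + h) T z ->
    phi (xb T) - tau * H (xb t) (pb t) - dotv (pb t) h - e * (tau + enorm h)
      <= phi z.
Proof.
move=> tT e0; have [m m0 Hm] := earlier_radius tT e0.
exists m => // tau h tau0 taum hm _ [w [tw ws <-]].
have [tau1 D1 kD HD] := Hm tau h tau0 taum hm; have M0 := hd_M hd.
have [t0t tT'] := andP tT; have xtr := xr tT.
have st : t - tau <= t by rewrite gerBl.
have tauE : t - (t - tau) = tau by rewrite subKr.
have t01 : t0 - 1 <= t - tau by rewrite lerB.
have h1 : enorm h <= 1 by apply: le_trans D1; rewrite lerDl mulr_ge0.
have wr s : t - tau <= s <= t -> enorm (w s) <= rho.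
  move=> /andP[s1 s2]; have sT := le_trans s2 tT'.
  apply: (reach_rho t01 s1 sT); last exact: traj_sub tw.
  by exists t => //; rewrite ws addrC addKr.
have tw' : traj F (t - tau) t w by apply: traj_sub tw.
have HMw s : t - tau <= s <= t -> forall v, F (w s) v -> enorm v <= M.
  by move=> sab v; apply: (hd_bound hd); apply: (rho_le_r rho0); exact: wr.
have wx s : t - tau <= s <= t -> enorm (w s) <= rho /\
    enorm (w s - xb t) <= enorm h + M * tau.
  move=> sab; split; first exact: wr.
  have -> : w s - xb t = h + (w s - w (t - tau)).
    by rewrite ws; apply/rowP => i; rewrite !mxE; ring.
  apply: le_trans (enormD _ _) _; rewrite lerD2l.
  move: sab => /andP[s1 s2]; apply: le_trans (traj_lip st tw' HMw (lexx _) s1 s2) _.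
  by rewrite ler_wpM2l // -[leRHS]tauE lerB.
have [_ wtD] := wx t ltac:(by rewrite st lexx).
have [_ Vw] := HD _ wtD.
have jw : joined F t (w t) T (w T) by apply: traj_joined; exact: traj_sub tw.
apply: le_trans (value_le gamma0 Hgamma hphi tT' jw).
have xtrho : enorm (xb t) <= rho by rewrite (le_trans xtr) // gerBl.
have rate := pairing_le_ham (pb t) st tw' xtrho wx.
rewrite tauE ws in rate.
have ktau := ler_wpM2r tau0 kD.
have pE : dotv (pb t) (w t - xb t) = dotv (pb t) h + dotv (pb t) (w t - (xb t + h)).
  by rewrite -dotvDr; congr dotv; apply/rowP => i; rewrite !mxE; ring.
have eh : 0 <= e * enorm h by rewrite mulr_ge0 ?enorm_ge0 // ltW.
move: Vw; rewrite ler_norml pE => /andP[Vw _]; lra.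
Qed.

Lemma value_expand_earlier t e : t0 <= t <= T -> 0 < e ->
  exists2 m : R, 0 < m & forall tau h, 0 <= tau -> tau <= m -> enorm h <= m ->
    `|V (t - tau) (xb t + h) - phi (xb T) + tau * H (xb t) (pb t) + dotv (pb t) h|
      <= e * (tau + enorm h).
Proof.
move=> tT e0; have [m1 m10 H1] := value_earlier_upper tT e0.
have [m2 m20 H2] := value_earlier_lower tT e0.
exists (Num.min m1 m2); first by rewrite lt_min m10.
move=> tau h tau0; rewrite !le_min => /andP[t1 t2] /andP[h1 h2].
have [ez up] := H1 tau h tau0 t1 h1.
have := value_ge ez (H2 tau h tau0 t2 h2).
by move: up; rewrite ler_norml => up low; apply/andP; split; lra.
Qed.

End Regular.

End Sensitivity.

(** * Differentiability in time and space *)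

Section TimeSpace.
Context {R : realType} {n : nat}.
Implicit Types (t : R) (x q : 'rV[R]_n).

Definition tx_form (a : R) q (z : R * 'rV[R]_n) : R := a * z.1 + dotv q z.2.

Fact tx_form_is_linear a q : linear (tx_form a q).
Proof.
move=> b u v; rewrite /tx_form /= dotvDr dotvZr /GRing.scale /=; ring.
Qed.

HB.instance Definition _ a q := GRing.isLinear.Build R (R * 'rV[R]_n)%type R *%R
  (tx_form a q) (tx_form_is_linear a q).

Lemma tx_form_continuous a q : continuous (tx_form a q).
Proof.
move=> z; apply: cvgD.
  by apply: cvgM; [exact: cvg_cst|exact: cvg_fst].
apply: (@continuous_comp _ _ _ snd (dotv q) z); first exact: cvg_snd.
exact: dotv_continuous.
Qed.

(** On the product, whose norm is the maximum, |tau| + |h| is at most 1 + n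
    times the norm of (tau, h).  The partial derivative in time is the case
    h = 0. *)
Lemma tx_differentiable (W : R -> 'rV[R]_n -> R) t x (a : R) q :
  (forall e : R, 0 < e -> exists2 m : R, 0 < m & forall (tau : R) h,
     `|tau| <= m -> enorm h <= m ->
     `|W (t + tau) (x + h) - W t x - (a * tau + dotv q h)| <= e * (`|tau| + enorm h)) ->
  differentiable (fun z : R * 'rV[R]_n => W z.1 z.2) (t, x) /\
  derive1 (fun s => W s x) t = a.
Proof.
move=> HW; split.
  have [] // := @differentiable_expand R (R * 'rV[R]_n)%type
    (fun z => W z.1 z.2) (t, x) (tx_form a q) (@tx_form_continuous a q).
  move=> e e0; have n0 : 0 < 1 + n%:R :> R by rewrite ltr_pwDl.
  have [m m0 Hm] := HW (e / (1 + n%:R)) (divr_gt0 e0 n0).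
  exists (m / (1 + n%:R)); first by rewrite divr_gt0.
  move=> [tau h]; rewrite ltr_pdivlMr // => hm.
  have t1 : `|tau| <= `|(tau, h)| by rewrite prod_normE le_max lexx.
  have h1 : enorm h <= n%:R * `|(tau, h)|.
    by apply: le_trans (enorm_le_norm h) _; rewrite ler_wpM2l // prod_normE le_max lexx orbT.
  have nn : 0 <= n%:R * `|(tau, h)| by rewrite mulr_ge0.
  have nz : 0 <= `|(tau, h)| by [].
  have := Hm tau h ltac:(lra) ltac:(lra); rewrite /tx_form /= => /le_trans; apply.
  have -> : e * `|(tau, h)| = e / (1 + n%:R) * ((1 + n%:R) * `|(tau, h)|).
    by field; rewrite gt_eqF.
  rewrite ler_wpM2l //; first by rewrite divr_ge0 // ltW.
  lra.
have lc : continuous ( *:%R a : R^o -> R^o).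
  move=> z; apply: cvgM; [exact: cvg_cst|exact: cvg_id].
have [|df dE] := @differentiable_expand R R (fun s => W s x) t ( *:%R a : R^o -> R^o) lc.
  move=> e e0; have [m m0 Hm] := HW e e0; exists m => // tau /ltW taum.
  have := Hm tau 0 taum; rewrite enorm0 dotv0r !addr0 => /(_ (ltW m0)).
  by [].
by rewrite derive1E' // dE; exact: mulr1.
Qed.

End TimeSpace.

Theorem corollary3p3 (R : realType) (n : nat) (T : R)
  (F : 'rV[R]_n -> set 'rV[R]_n) (phi : 'rV[R]_n -> R)
  (hSH : assumption_SH F) (hH : assumption_H F)
  (hphi : lipschitz_near_pts phi)
  (t0 : R) (x0 : 'rV[R]_n) (ht0 : t0 <= T)
  (xbar : R -> 'rV[R]_n) (hopt : optimal F phi T t0 x0 xbar)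
  (hsuper : superdiff phi (xbar T) !=set0)
  (pbar : R -> 'rV[R]_n) (hparc : is_arc t0 T pbar)
  (hxdot : ae_deriv t0 T xbar
     (fun s d => subdiff (hamiltonian F (xbar s)) (pbar s) d))
  (hpdot : ae_deriv t0 T pbar
     (fun s d => subdiff (fun x => hamiltonian F x (pbar s)) (xbar s) (- d)))
  (hpT : superdiff phi (xbar T) (- pbar T)) :
  (subdiff (value F phi T t0) x0 !=set0 ->
   forall t : R, t0 <= t <= T ->
     differentiable (value F phi T t) (xbar t) /\
     grad (value F phi T t) (xbar t) = - pbar t) /\
  (locally_semiconcave phi ->
   subdiff (value F phi T t0) x0 !=set0 ->
   forall t : R, t0 <= t < T ->
     differentiable (fun z : R * 'rV[R]_n => value F phi T z.1 z.2)
       (t, xbar t) /\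
     grad_tx (value F phi T) t (xbar t)
       = (hamiltonian F (xbar t) (pbar t), - pbar t)).
Proof.
have [_ _ [gamma gamma0 Hgamma]] := hSH.
have [/admissibleE[tx x0E] _] := hopt.
have [r0 r00 Hr0] := arc_bounded ht0 tx.1.
(* By traj_growth, rho bounds whatever starts within distance 1 of xb at a
   time between t0 - 1 and T. *)
pose rho := expR (4 * gamma * (T - t0 + 1)) * (1 + (r0 + 1) ^+ 2).
have g4 : 0 <= 4 * gamma by rewrite mulr_ge0 // ltW.
have exp1 : 1 <= expR (4 * gamma * (T - t0 + 1)).
  rewrite -[leLHS]expR0 ler_expR mulr_ge0 //; lra.
have rho1 : 1 + (r0 + 1) ^+ 2 <= rho.
  by rewrite /rho ler_peMl // addr_ge0 // sqr_ge0.
have rhor : r0 + 1 <= rho.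
  apply: le_trans rho1; have := sqr_ge0 (r0 + 1); rewrite expr2; nra.
have rho0 : 0 < rho by lra.
have xr s : t0 <= s <= T -> enorm (xbar s) <= rho - 1.
  by move=> /Hr0; lra.
have reach s t y : t0 - 1 <= s -> s <= t -> t <= T ->
    (exists2 t', t0 <= t' <= T & enorm (y s - xbar t') <= 1) ->
    traj F s t y -> enorm (y t) <= rho.
  move=> s0 st tT [t' t'T ys] ty.
  have yr : enorm (y s) <= r0 + 1.
    by have := enormD (y s - xbar t') (xbar t'); have := Hr0 t' t'T; rewrite subrK; lra.
  have h1 := traj_growth gamma0 Hgamma st ty.
  have h2 : 1 + enorm (y t) ^+ 2 <= rho.
    apply: le_trans h1 _; apply: ler_pM; rewrite ?expR_ge0 // ?addr_ge0 ?sqr_ge0 //.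
      rewrite ler_expR ler_wpM2l //; lra.
    by rewrite lerD2l ler_sqr ?nnegrE ?enorm_ge0 ?addr_ge0.
  by apply: le_trans h2; have := sqr_ge0 (enorm (y t) - 1); have := sqr_ge0 (enorm (y t)); lra.
(* The ball for H is larger than rho to contain the cube of side 2 rho used
   to truncate fields. *)
have r0' : 0 < n.+1%:R * rho by rewrite mulr_gt0.
have [k [c [M hd]]] := ham_data_ball hSH hH r0'.
have part1 := value_differentiable_x rho0 hd gamma0 Hgamma hphi ht0 hopt xr hparc
  hxdot hpdot hpT.
split=> [|_] sub0; first exact: part1.
move=> t /andP[t0t tT].
have tT' : t0 <= t <= T by rewrite t0t ltW.
have [d1 g1] := part1 sub0 t tT'.
have later := value_expand_later rho0 hd gamma0 Hgamma hphi ht0 hopt xr hparc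
  hxdot hpdot hpT sub0 tT'.
have earlier := value_expand_earlier rho0 hd gamma0 Hgamma hphi ht0 hopt reach xr
  hparc hxdot hpdot hpT sub0 tT'.
have Vt := value_optimal gamma0 Hgamma hphi hopt tT'.
have [|d2 g2] := @tx_differentiable R n (value F phi T) t (xbar t)
  (hamiltonian F (xbar t) (pbar t)) (- pbar t); last by rewrite /grad_tx g1 g2.
clear d1 g1 part1 reach.
move=> e e0; rewrite Vt.
move: (hamiltonian F (xbar t) (pbar t)) later earlier => Ht later earlier.
have [m1 m10 H1] := later e e0; have [m2 m20 H2] := earlier e e0.
exists (Num.min (T - t) (Num.min m1 m2)).
  by rewrite !lt_min subr_gt0 tT m10.
move=> tau h; rewrite !le_min => /andP[tau0 /andP[tau1 tau2]] /andP[_ /andP[h1 h2]].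
have [p|p] := leP 0 tau.
  rewrite ger0_norm // in tau0 tau1 *.
  have := H1 tau h p tau1 ltac:(lra) h1.
  congr (`|_| <= _); rewrite dotvNl; ring.
rewrite ltr0_norm // in tau2 *.
have := H2 (- tau) h ltac:(lra) tau2 h2.
rewrite opprK; congr (`|_| <= _); rewrite dotvNl; ring.
Qed.
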